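(* Let $\Lambda(x)=\sum_d \Lambda_d x^d$ and $P(x)=\sum_k P_k x^k$ be degree distributions (node perspective) with finite maximal degrees, and let $\mathcal{C}=\mathrm{LDPC}(n,\Lambda,P)$ be the standard irregular LDPC ensemble. Consider transmission over one of the following channels: (i) the BEC$(\epsilon)$ at any erasure probability $\epsilon$; (ii) the BIAWGNC$(\epsilon)$ at any noise level $\epsilon$; (iii) a BMS$(\epsilon)$ channel family, for every $\epsilon$ in an open interval on which condition H holds. Then for every such $\epsilon$, $$\liminf_{n\to+\infty}\mathbb{E}_{\mathcal{C}}[h_n]\;\geq\;\sup_{d_V} h_{RS}[d_V;\Lambda,P],$$ where the supremum runs over all probability densities $d_V$ of a real random variable $V$ such that the law of $2V$ is symmetric (its density $a$ satisfies $a(x)=e^{x}a(-x)$).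
   Context: Standard ensemble $\mathrm{LDPC}(n,\Lambda,P)$: random Tanner graphs with $n$ variable nodes, a fraction $\Lambda_d$ of which have degree $d$, and check nodes a fraction $P_k$ of which have degree $k$, the edges being matched uniformly at random (configuration model); the code is the set of binary words satisfying all parity checks. A codeword is chosen uniformly and sent through a binary-input memoryless output-symmetric (BMS) channel with transition density $p_{Y|X}(y|x)$ depending on a noise parameter $\epsilon$ (smoothly, so that all derivatives in $\epsilon$ below exist and may be taken under the integral). $h_n=\frac1n H_n(\underline X\mid\underline Y)$ is the conditional entropy per bit (natural logarithms) and $\mathbb{E}_{\mathcal{C}}$ the average over the ensemble. The log-likelihood is $l=\ln\frac{p_{Y|X}(y|0)}{p_{Y|X}(y|1)}$ and $t=\tanh(l/2)$; expectations over $l$ (or $t$) are taken under the distribution $c_L$ (resp. $c_D$) induced when $X=0$ is sent. For BIAWGNC$(\epsilon)$, $c_L$ is the Gaussian density with mean $\epsilon^{-2}$ and variance $2\epsilon^{-2}$. Condition H: with $m_0^{(2p)}=\mathbb{E}[t^{2p}]$, $m_1^{(2p)}=\frac{d}{d\epsilon}\mathbb{E}[t^{2p}]$, $m_2^{(2p)}=\frac{d^2}{d\epsilon^2}\mathbb{E}[t^{2p}]$, the series $\sum_{p\ge0}(p+1)m_0^{(2p)}$, $\sum_{p\ge1}(5/2)^{2p}|m_1^{(2p)}|$, $\sum_{p\ge1}\frac{|m_2^{(2p)}|}{2p(2p-1)}$ converge, and $(\sqrt2-1)(5/2)^2|m_1^{(2)}|>\sum_{p\ge2}(5/2)^{2p}|m_1^{(2p)}|$.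 Replica-symmetric functional: let $V_1,V_2,\dots$ be i.i.d. copies of $V\sim d_V$; let $k$ be a random check degree with edge-perspective law $\mathbb{P}(k)=kP_k/P'(1)$ and set $U=\tanh^{-1}\big[\prod_{i=1}^{k-1}\tanh V_i\big]$; let $U_1,U_2,\dots$ be i.i.d. copies of $U$, $d$ a random variable-node degree with law $\Lambda_d$, and $l\sim c_L$, all independent. Then $$h_{RS}[d_V;\Lambda,P]=\mathbb{E}\Big[\ln\Big(e^{l/2}\prod_{c=1}^{d}(1+\tanh U_c)+e^{-l/2}\prod_{c=1}^{d}(1-\tanh U_c)\Big)\Big]+\frac{\Lambda'(1)}{P'(1)}\mathbb{E}\Big[\ln\Big(1+\prod_{i=1}^{k'}\tanh V_i\Big)\Big]-\Lambda'(1)\mathbb{E}\big[\ln(1+\tanh V\tanh U)\big]-\frac{\Lambda'(1)}{P'(1)}\ln 2,$$ where in the second term $k'$ has the node-perspective law $P_{k'}$, and in the third term $V$ and $U$ are independent.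
   Formalization: The first term of h_RS is normalized by subtracting E[l/2] (e^{l/2}, e^{-l/2} become 1, e^{-l}), since as printed the bound can exceed ln 2; the liminf runs over n for which all node counts are integers; P'(1)>0 is assumed. *)

(* Defs.v *)
From HB Require Import structures.
From mathcomp Require Import all_boot all_order all_algebra all_fingroup.
From mathcomp Require Import all_classical all_reals all_analysis.
Set Implicit Arguments. Unset Strict Implicit. Unset Printing Implicit Defensive.
Import Order.TTheory GRing.Theory Num.Theory.
Import numFieldNormedType.Exports.
Local Open Scope classical_set_scope.
Local Open Scope ring_scope.

Section LDPC.
Variable R : realType.

Definition tanhR (x : R) : R := (expR x - expR (- x)) / (expR x + expR (- x)).

(* Degree distributions (node perspective), given by their finite list  *)
(* of coefficients: L`_d = Lambda_d  (finite maximal degree).           *)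
Definition deg_dist (L : seq R) : Prop :=
  (forall i, 0 <= L`_i) /\ \sum_(i < size L) L`_i = 1.

Definition dpoly1 (L : seq R) : R := \sum_(i < size L) i%:R * L`_i.

Definition nchecksR (Lam P : seq R) (n : nat) : R := n%:R * dpoly1 Lam / dpoly1 P.

Definition admissible (Lam P : seq R) (n : nat) : Prop :=
  (forall d, exists k : nat, n%:R * Lam`_d = k%:R) /\
  (forall k, exists j : nat, nchecksR Lam P n * P`_k = j%:R).

Definition nV (Lam : seq R) (n d : nat) : nat := Num.truncn (n%:R * Lam`_d).
Definition nC (Lam P : seq R) (n k : nat) : nat := Num.truncn (nchecksR Lam P n * P`_k).
Definition mC (Lam P : seq R) (n : nat) : nat := \sum_(k < size P) nC Lam P n k.

Definition vdeg (Lam : seq R) (n : nat) : seq nat :=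
  flatten [seq nseq (nV Lam n d) d | d <- iota 0 (size Lam)].
Definition cdeg (Lam P : seq R) (n : nat) : seq nat :=
  flatten [seq nseq (nC Lam P n k) k | k <- iota 0 (size P)].

(* sockets: the j-th socket belongs to node  (sockets degs)`_j          *)
Definition sockets (degs : seq nat) : seq nat :=
  flatten [seq nseq (nth 0 degs i) i | i <- iota 0 (size degs)].
Definition vsock (Lam : seq R) (n : nat) : seq nat := sockets (vdeg Lam n).
Definition csock (Lam P : seq R) (n : nat) : seq nat := sockets (cdeg Lam P n).
Definition nedges (Lam : seq R) (n : nat) : nat := size (vsock Lam n).

(* The Tanner graph given by the matching pi : variable socket j is     *)
(* joined to check socket pi j; the code is the set of binary words     *)
(* satisfying every parity check (multi-edges counted with multiplicity)*)
Definition ldpc_code (Lam P : seq R) (n : nat) (pi : {perm 'I_(nedges Lam n)}) :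
  {set n.-tuple bool} :=
  [set x : n.-tuple bool | [forall c : 'I_(mC Lam P n),
     ~~ odd (\sum_(j < nedges Lam n | nth 0 (csock Lam P n) (pi j) == c)
                (nth false x (nth 0 (vsock Lam n) j) : nat))]].

(* Conditional entropy H(X | Y) (in nats) of a uniformly chosen         *)
(* codeword of C sent through n uses of a memoryless channel with       *)
(* output space Y, reference measure mu and transition densities        *)
(* p x y = p_{Y|X}(y|x) w.r.t. mu.                                      *)
Section Entropy.
Context d (Y : measurableType d) (mu : {measure set Y -> \bar R})
  (p : bool -> Y -> R).

Fixpoint iint (k : nat) (F : seq Y -> \bar R) : \bar R :=
  match k with
  | 0 => F [::]
  | k'.+1 => (\int[mu]_y iint k' (fun s => F (y :: s)))%E
  end.

Definition Wlik (n : nat) (x : n.-tuple bool) (y : seq Y) : R :=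
  \prod_(i < n) p (tnth x i) (nth point y i).

(* H(X|Y) = E_Y [ sum_x P(x|Y) ln (1 / P(x|Y)) ] *)
Definition cond_entropy (n : nat) (C : {set n.-tuple bool}) : \bar R :=
  iint n (fun y => ((#|C|%:R)^-1 *
     \sum_(x in C) Wlik x y * ln ((\sum_(x' in C) Wlik x' y) / Wlik x y))%:E).

Definition ens_avg_h (Lam P : seq R) (n : nat) : \bar R :=
  (((#|{perm 'I_(nedges Lam n)}|%:R)^-1 * (n%:R)^-1)%:E *
    (\sum_(pi : {perm 'I_(nedges Lam n)}) cond_entropy (@ldpc_code Lam P n pi)))%E.

(* liminf_{n -> oo} E_C[h_n], along the n for which the ensemble is defined *)
Definition liminf_h (Lam P : seq R) : \bar R :=
  limn_einf (fun n => if `[< admissible Lam P n >] then ens_avg_h Lam P n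
                      else +oo%E).

(* Expectation over l ~ c_L (X = 0 sent) is written as an integral over *)
(* y w.r.t. p(y|0) mu(dy), with e^{-l} = p(y|1)/p(y|0).                 *)
Section RS.
Variable dV : probability R R.

Fixpoint vint (k : nat) (F : seq R -> \bar R) : \bar R :=
  match k with
  | 0 => F [::]
  | k'.+1 => (\int[dV]_v vint k' (fun s => F (v :: s)))%E
  end.

Definition prod_tanh (s : seq R) : R := \prod_(v <- s) tanhR v.

(* edge-perspective check degree law *)
Definition rho (P : seq R) (k : nat) : R := k%:R * P`_k / dpoly1 P.

(* E[G(tanh U)], tanh U = prod_{i=1}^{k-1} tanh V_i, k ~ rho *)
Definition EtanhU (P : seq R) (G : R -> \bar R) : \bar R :=
  (\sum_(k < size P) (rho P k)%:E * vint k.-1 (fun s => G (prod_tanh s)))%E.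

Fixpoint EtanhUs (P : seq R) (dd : nat) (G : seq R -> \bar R) : \bar R :=
  match dd with
  | 0 => G [::]
  | dd'.+1 => EtanhU P (fun u => EtanhUs P dd' (fun s => G (u :: s)))
  end.

(* first term, normalized by -E[l/2]:
   E[ ln( prod_c (1 + tanh U_c) + e^{-l} prod_c (1 - tanh U_c) ) ] *)
Definition hRS_term1 (Lam P : seq R) : \bar R :=
  (\sum_(dd < size Lam) (Lam`_dd)%:E *
     \int[mu]_y ((p false y)%:E *
        EtanhUs P dd (fun s => (ln (\prod_(u <- s) (1 + u) +
                      p true y / p false y * \prod_(u <- s) (1 - u)))%:E)))%E.

Definition hRS (Lam P : seq R) : \bar R :=
  (hRS_term1 Lam P
   + (dpoly1 Lam / dpoly1 P)%:E *
       (\sum_(k < size P) (P`_k)%:E * vint k (fun s => (ln (1 + prod_tanh s))%:E))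
   - (dpoly1 Lam)%:E *
       (\int[dV]_v EtanhU P (fun u => (ln (1 + tanhR v * u))%:E))
   - (dpoly1 Lam / dpoly1 P * ln 2)%:E)%E.
End RS.

End Entropy.

(* law of V such that the law of 2V is symmetric: a(x) = e^x a(-x),    *)
(* i.e. P(V in -A) = E[e^{-2V}; V in A] for all Borel A                 *)
Definition symmetric_law (dV : probability R R) : Prop :=
  forall A : set R, measurable A ->
    dV [set - v | v in A] = (\int[dV]_(v in A) (expR (-2 * v))%:E)%E.

Definition hRS_sup d (Y : measurableType d) (mu : {measure set Y -> \bar R})
  (p : bool -> Y -> R) (Lam P : seq R) : \bar R :=
  ereal_sup [set hRS mu p dV Lam P | dV in [set dV : probability R R | symmetric_law dV]].

(* BEC(eps): outputs 0, 1 (received bit) and 2 (erasure), counting      *)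
(* measure on nat.                                                      *)
Definition bec_p (eps : R) (x : bool) (y : nat) : R :=
  if y == 2%N then eps else if y == (x : nat) then 1 - eps else 0.

(* BIAWGNC(eps): y = (1 - 2x) + Z, Z ~ N(0, 2 eps^2), so that c_L is    *)
(* Gaussian with mean eps^-2 and variance 2 eps^-2.                     *)
Definition biawgn_p (eps : R) (x : bool) (y : R) : R :=
  normal_pdf (1 - 2 * (x : nat)%:R) (Num.sqrt 2 * eps) y.

Definition bms_channel d (Y : measurableType d) (mu : {measure set Y -> \bar R})
  (p : bool -> Y -> R) : Prop :=
  [/\ forall x y, 0 <= p x y,
      forall x, measurable_fun setT (p x),
      forall x, (\int[mu]_y (p x y)%:E)%E = 1%E &
      exists sigma : Y -> Y, [/\ measurable_fun setT sigma,
         forall y, sigma (sigma y) = y,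
         forall A, measurable A -> mu (sigma @^-1` A) = mu A &
         forall y, p true y = p false (sigma y)]].

(* t = tanh(l/2) = (p(y|0) - p(y|1)) / (p(y|0) + p(y|1)) *)
Definition tval d (Y : measurableType d) (p : bool -> Y -> R) (y : Y) : R :=
  (p false y - p true y) / (p false y + p true y).

Definition mom0 d (Y : measurableType d) (mu : {measure set Y -> \bar R})
  (pf : R -> bool -> Y -> R) (k : nat) (eps : R) : R :=
  fine (\int[mu]_y (pf eps false y * tval (pf eps) y ^+ (2 * k))%:E)%E.
Definition mom1 d (Y : measurableType d) (mu : {measure set Y -> \bar R})
  (pf : R -> bool -> Y -> R) (k : nat) (eps : R) : R :=
  derive1 (mom0 mu pf k) eps.
Definition mom2 d (Y : measurableType d) (mu : {measure set Y -> \bar R})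
  (pf : R -> bool -> Y -> R) (k : nat) (eps : R) : R :=
  derive1n 2 (mom0 mu pf k) eps.

Definition smooth_family d (Y : measurableType d) (mu : {measure set Y -> \bar R})
  (pf : R -> bool -> Y -> R) (a b : R) : Prop :=
  forall eps, a < eps < b ->
  [/\ forall x y, derivable (fun e => pf e x y) eps 1 /\
                  derivable (derive1 (fun e => pf e x y)) eps 1,
      forall k, derivable (mom0 mu pf k) eps 1 /\
                derivable (derive1 (mom0 mu pf k)) eps 1 &
      forall k j, (1 <= j <= 2)%N ->
        derive1n j (mom0 mu pf k) eps =
        fine (\int[mu]_y (derive1n j
                 (fun e => pf e false y * tval (pf e) y ^+ (2 * k)) eps)%:E)%E].

Definition condH d (Y : measurableType d) (mu : {measure set Y -> \bar R})
  (pf : R -> bool -> Y -> R) (eps : R) : Prop :=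
  [/\ cvgn (series (fun k => k.+1%:R * mom0 mu pf k eps)),
      cvgn (series (fun k => if (1 <= k)%N
                 then (5 / 2) ^+ (2 * k) * `|mom1 mu pf k eps| else 0)),
      cvgn (series (fun k => if (1 <= k)%N
                 then `|mom2 mu pf k eps| / ((2 * k)%:R * (2 * k - 1)%:R) else 0)) &
      (Num.sqrt 2 - 1) * (5 / 2) ^+ 2 * `|mom1 mu pf 1 eps| >
        \big[+%R/0]_(2 <= k <oo) ((5 / 2) ^+ (2 * k) * `|mom1 mu pf k eps|)].

End LDPC.

(* Main.v *)
(* The conditional entropy is, up to explicit constants, the mean of [N ln N], where [N] is the total
   likelihood of a hidden word that is observed through noisy parities ([EE], [PhiF]). The interpolation
   replaces the parity checks one at a time by independent noisy observations of the single bits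
   on their sockets. Replacing one check of degree [k] changes the entropy by [E G(<prod x_i>)] against
   [sum_i E G(m x_i)], where [G] is a power series with nonnegative even coefficients. If the spins
   decorrelate, the overlap moments turn the difference into a sum of terms
   [x^k - k v^(k-1) x + (k-1) v^k >= 0].
   Decorrelation is forced by pinning: a bounded number of checks is dropped, and their freed sockets serve
   as extra noisy observations. The moments increase along these observations and stay bounded, so
   the increments telescope, and by exchangeability of the matching a typical number of pinned
   sockets makes the spins of a random check nearly independent at the cost of o(n).
   On the replica-symmetric side, the channel and the law of [tanh V] are replaced by finitely
   supported ones: the channel by upgrading it to a grid, the law of [tanh V] by rounding [|tanh V|],
   which keeps the symmetry. *)
Require Import Defs.
From HB Require Import structures.
From mathcomp Require Import all_boot all_order all_algebra all_fingroup.
From mathcomp Require Import all_classical all_reals all_analysis.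
From mathcomp Require Import measurable_realfun.
From mathcomp Require Import ring lra.
Import Order.TTheory GRing.Theory Num.Theory.
Import numFieldNormedType.Exports.
Local Open Scope classical_set_scope.
Local Open Scope ring_scope.

Set Implicit Arguments. Unset Strict Implicit. Unset Printing Implicit Defensive.

(** The tangent inequality needs [x] and [v] nonnegative once odd degrees [k] occur. Here [x] is an
    empirical average of even powers of posterior means and [v] is an even moment of the trial law,
    so both are nonnegative. Only even powers appear because the two outcomes of every observation
    are averaged. Weights are never normalised: moments and entropies become homogeneous functionals
    of [w], outcomes of probability zero need no separate treatment, and Jensen's inequality turns
    into sublinearity. The obstacle is the dependence of the spins on one check. The mean of their
    product minus the product of their means is a first-order quantity, while pinning controls the
    growth of second moments. The inequality |t| <= d + t^2/d passes from one to the other and stays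
    linear in the moments, so the increments still telescope over the pinning levels. The numbers of
    pins and of dropped checks are fixed before [n], so every loss is bounded or a small multiple of
    [n]. On the code side, observing all parities exactly gives the same entropy as conditioning on
    even parities, because the cosets of a code are translates of it. *)

Section Entropy_function.
Variable R : realType.
Implicit Types (x y r : R).

(** * The function x ln x and the even power series of its symmetrised increment *)

Definition eta x : R := x * ln x.

(** This is [ln 2] minus the entropy of a bit of mean [x], that is, the capacity of a binary
    symmetric channel of bias [x]. [gpoly] truncates its Taylor series at 0. *)
Definition gfun x : R := 2^-1 * (eta (1 + x) + eta (1 - x)).

Definition gcoef (p : nat) : R := ((p.+1.*2)%:R * (p.*2.+1)%:R)^-1.

Definition gpoly (N : nat) x : R := \sum_(p < N) gcoef p * x ^+ p.+1.*2.

Lemma eta0 : eta 0 = 0. Proof. by rewrite /eta mul0r. Qed.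

Lemma eta1 : eta 1 = 0. Proof. by rewrite /eta ln1 mulr0. Qed.

Lemma etaM (a b : R) : 0 <= a -> 0 <= b -> eta (a * b) = b * eta a + a * eta b.
Proof.
rewrite /eta !le_eqVlt => /predU1P[<-|a0] /predU1P[<-|b0].
- by rewrite !(mul0r, mulr0, addr0).
- by rewrite !(mul0r, mulr0, addr0).
- by rewrite !(mul0r, mulr0, addr0).
by rewrite lnM ?posrE//; ring.
Qed.

Lemma ln_le_sub1 (a : R) : 0 < a -> ln a <= a - 1.
Proof. by move=> a0; have := @le_ln1Dx R (a - 1); rewrite addrCA subrr addr0; apply; lra. Qed.

Lemma eta_ge_sub1 (a : R) : 0 <= a -> a - 1 <= eta a.
Proof.
rewrite le_eqVlt => /predU1P[<-|a0]; first by rewrite eta0 sub0r lerN10.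
have := @ln_le_sub1 a^-1; rewrite invr_gt0 => /(_ a0).
rewrite lnV ?posrE// => h; rewrite /eta.
have : a * - ln a <= a * (a^-1 - 1) by rewrite ler_pM2l.
by rewrite mulrBr divff ?gt_eqF//; lra.
Qed.

Lemma ge0_gcoef p : 0 <= gcoef p.
Proof. by rewrite /gcoef invr_ge0 mulr_ge0. Qed.

Lemma gfunN x : gfun (- x) = gfun x.
Proof. by rewrite /gfun opprK addrC. Qed.

Lemma gfun0 : gfun 0 = 0.
Proof. by rewrite /gfun addr0 subr0 eta1 addr0 mulr0. Qed.

Lemma gfun1 : gfun 1 = ln 2.
Proof.
by rewrite /gfun subrr eta0 addr0 /eta -[1 + 1]/(2 : R) mulrA mulVf ?mul1r ?pnatr_eq0.
Qed.

Lemma gpolyN N x : gpoly N (- x) = gpoly N x.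
Proof. by apply: eq_bigr => p _; rewrite exprNn -signr_odd odd_double expr0 mul1r. Qed.

Lemma ge0_exp_even x p : 0 <= x ^+ p.*2.
Proof. by rewrite -mul2n exprM exprn_ge0// sqr_ge0. Qed.

Lemma ge0_gpoly N x : 0 <= gpoly N x.
Proof. by apply: sumr_ge0 => p _; rewrite mulr_ge0 ?ge0_gcoef// ge0_exp_even. Qed.

Lemma gfun_le_ln2 x : -1 <= x <= 1 -> gfun x <= ln 2.
Proof.
move=> /andP[x0 x1]; rewrite /gfun /eta.
have h (a : R) : 0 <= a <= 2 -> a * ln a <= a * ln 2.
  case/andP; rewrite le_eqVlt => /predU1P[<-|a0] a2; first by rewrite !mul0r.
  by rewrite ler_pM2l// ler_ln ?posrE//.
have h1 := h (1 + x); have h2 := h (1 - x).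
have : (1 + x) * ln (1 + x) <= (1 + x) * ln 2 by apply: h1; lra.
have : (1 - x) * ln (1 - x) <= (1 - x) * ln 2 by apply: h2; lra.
lra.
Qed.

(** By [etaM] the factor [N] comes out of both terms. If [N] vanishes so does [M], and the quotient
    [M / N] is then 0 by convention. *)
Lemma gain_eta (N M : R) : `|M| <= N ->
  2^-1 * (eta (N + M) + eta (N - M)) = eta N + N * gfun (M / N).
Proof.
move=> MN; have N0 : 0 <= N by apply: le_trans MN.
have [N00|Nn0] := eqVneq N 0.
  move: MN; rewrite N00 normr_le0 => /eqP ->.
  by rewrite addr0 subr0 eta0 mul0r !addr0 mulr0.
have Np : 0 < N by rewrite lt_neqAle eq_sym Nn0.
have h : `|M / N| <= 1 by rewrite normrM normfV (ger0_norm N0) ler_pdivrMr// mul1r.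
have /andP[h1 h2] : -1 <= M / N <= 1 by rewrite -ler_norml.
rewrite /gfun.
have -> : N + M = N * (1 + M / N) by field.
have -> : N - M = N * (1 - M / N) by field.
by rewrite !etaM ?(ltW Np)//; first field; lra.
Qed.

Lemma nondecr_deriv (f f' : R -> R) a b : a <= b ->
  (forall x, a <= x <= b -> is_derive x 1 f (f' x)) ->
  (forall x, a <= x <= b -> 0 <= f' x) -> f a <= f b.
Proof.
move=> ab df f0.
have [||c cab] := @MVT_segment R f f' a b ab.
- by move=> x; rewrite in_itv/= => /andP[/ltW ? /ltW ?]; apply: df; apply/andP.
- apply: derivable_within_continuous => x; rewrite in_itv/= => xab.
  by have [] := df x xab.
by rewrite -subr_ge0 => ->; rewrite mulr_ge0 ?subr_ge0// f0// -in_itv.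
Qed.

Definition artanh_poly (N : nat) x : R := \sum_(p < N) x ^+ p.*2.+1 / (p.*2.+1)%:R.

Lemma is_derive_gpoly N x : is_derive x 1 (gpoly N) (artanh_poly N x).
Proof.
elim: N => [|N IH].
  have -> : gpoly 0 = cst 0 by apply/funext => y; rewrite /gpoly big_ord0.
  by rewrite /artanh_poly big_ord0; exact: is_derive_cst.
have -> : gpoly N.+1 = gpoly N + gcoef N \*: (@id R ^+ N.+1.*2).
  apply/funext => y; rewrite /gpoly big_ord_recr/= [in RHS]/GRing.add/=.
  by congr (_ + _); rewrite /GRing.scale/=; congr (_ * _); rewrite fctE.
apply: is_derive_eq.
rewrite /artanh_poly big_ord_recr/=; congr (_ + _).
by rewrite /GRing.scale/= mulr1 /gcoef;  field; rewrite nat1r !pnatr_eq0.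
Qed.

Lemma is_derive_artanh_poly N x : is_derive x 1 (artanh_poly N) (\sum_(p < N) x ^+ p.*2).
Proof.
elim: N => [|N IH].
  have -> : artanh_poly 0 = cst 0 by apply/funext => y; rewrite /artanh_poly big_ord0.
  by rewrite big_ord0; exact: is_derive_cst.
have -> : artanh_poly N.+1 = artanh_poly N + (N.*2.+1)%:R^-1 \*: (@id R ^+ N.*2.+1).
  apply/funext => y; rewrite /artanh_poly big_ord_recr/= [in RHS]/GRing.add/=.
  by congr (_ + _); rewrite /GRing.scale/= mulrC; congr (_ * _); rewrite fctE.
apply: is_derive_eq.
rewrite big_ord_recr/=; congr (_ + _).
by rewrite /GRing.scale/= mulr1;  field; rewrite nat1r pnatr_eq0.
Qed.


Definition artanhR x : R := 2^-1 * (ln (1 + x) - ln (1 - x)).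

Lemma is_derive_ln_comp (f : R -> R) (df : R) x : 0 < f x -> is_derive x 1 f df ->
  is_derive x 1 (fun y => ln (f y)) (df / f x).
Proof.
move=> fx0 dfx.
have h := @is_derive1_ln R (f x) fx0.
have := @is_derive1_comp R (@ln R) f x _ _ h dfx.
by rewrite mulrC.
Qed.

Lemma is_derive_affine (a b x : R) : is_derive x 1 (fun y => a + b * y) b.
Proof.
have -> : (fun y => a + b * y) = cst a + b \*: @id R by apply/funext.
by apply: is_derive_eq; rewrite add0r /GRing.scale/= mulr1.
Qed.

Lemma is_derive_gfun x : -1 < x < 1 -> is_derive x 1 gfun (artanhR x).
Proof.
move=> /andP[x0 x1].
have d1 : is_derive x 1 (fun y : R => 1 + y) 1.
  by have := is_derive_affine 1 1 x; under eq_fun do rewrite mul1r.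
have d2 : is_derive x 1 (fun y : R => 1 - y) (-1).
  by have := is_derive_affine 1 (-1) x; under eq_fun do rewrite mulN1r.
have p1 : 0 < 1 + x by lra.
have p2 : 0 < 1 - x by lra.
have l1 := @is_derive_ln_comp (fun y => 1 + y) 1 x p1 d1.
have l2 := @is_derive_ln_comp (fun y => 1 - y) (-1) x p2 d2.
have -> : gfun = 2^-1 \*: ((fun y : R => 1 + y) * (fun y : R => ln (1 + y)) +
   (fun y : R => 1 - y) * (fun y : R => ln (1 - y))) by apply/funext => y.
apply: is_derive_eq; rewrite /GRing.scale/= /artanhR; field.
by apply/andP; split; lra.
Qed.

Lemma is_derive_artanhR x : -1 < x < 1 -> is_derive x 1 artanhR (1 - x ^+ 2)^-1.
Proof.
move=> /andP[x0 x1].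
have d1 : is_derive x 1 (fun y : R => 1 + y) 1.
  by have := is_derive_affine 1 1 x; under eq_fun do rewrite mul1r.
have d2 : is_derive x 1 (fun y : R => 1 - y) (-1).
  by have := is_derive_affine 1 (-1) x; under eq_fun do rewrite mulN1r.
have p1 : 0 < 1 + x by lra.
have p2 : 0 < 1 - x by lra.
have l1 := @is_derive_ln_comp (fun y => 1 + y) 1 x p1 d1.
have l2 := @is_derive_ln_comp (fun y => 1 - y) (-1) x p2 d2.
have -> : artanhR = 2^-1 \*: ((fun y : R => ln (1 + y)) - (fun y : R => ln (1 - y))).
  by apply/funext => y.
apply: is_derive_eq; rewrite /GRing.scale/=.
have h1 : 1 + x != 0 by lra.
have h2 : 1 - x != 0 by lra.
have -> : 1 - x ^+ 2 = (1 + x) * (1 - x) by ring.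
by field; rewrite h1 h2.
Qed.

Lemma geom_gap N x : -1 < x < 1 ->
  (1 - x ^+ 2)^-1 - \sum_(p < N) x ^+ p.*2 = x ^+ N.*2 / (1 - x ^+ 2).
Proof.
move=> /andP[x0 x1]; have h : 1 - x ^+ 2 != 0.
  have -> : 1 - x ^+ 2 = (1 + x) * (1 - x) by ring.
  by rewrite mulf_neq0 ?gt_eqF//; lra.
elim: N => [|N IH]; first by rewrite big_ord0 subr0 expr0 mul1r.
rewrite big_ord_recr/= opprD addrA IH doubleS !exprS; field.
by [].
Qed.

(** By [geom_gap] the derivative of the gap is x^(2N)/(1-x^2), which on [0, r] lies between 0 and
    its value at [r]. Integration over a length below 1 preserves both bounds, and [gfun_gap]
    integrates once more. *)
Lemma artanh_gap N r x : 0 <= x <= r -> r < 1 ->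
  0 <= artanhR x - artanh_poly N x <= r ^+ N.*2 / (1 - r ^+ 2).
Proof.
move=> /andP[x0 xr] r1.
have r0 : 0 <= r by apply: le_trans xr.
have z : artanhR 0 - artanh_poly N 0 = 0.
  rewrite /artanhR /artanh_poly addr0 subr0 subrr mulr0 big1 ?subrr// => p _.
  by rewrite exprS mul0r mul0r.
have sq y : 0 <= y <= r -> 0 < 1 - y ^+ 2.
  by move=> /andP[? ?]; rewrite (_ : 1 - y ^+ 2 = (1+y)*(1-y)); [nra|ring].
have dd y : 0 <= y <= x -> is_derive y 1 (artanhR - artanh_poly N) (y ^+ N.*2 / (1 - y ^+ 2)).
  move=> /andP[y0 yx]; rewrite -geom_gap; last lra.
  have h1 := @is_derive_artanhR y ltac:(lra).
  by have h2 := is_derive_artanh_poly N y; apply: is_deriveB.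
apply/andP; split.
  rewrite -z; apply: (@nondecr_deriv (artanhR - artanh_poly N) (fun y => y ^+ N.*2 / (1 - y ^+ 2))) => //.
  by move=> y yx; rewrite divr_ge0 ?ge0_exp_even// ltW// sq//; lra.
pose K := r ^+ N.*2 / (1 - r ^+ 2).
have K0 : 0 <= K by rewrite divr_ge0 ?ge0_exp_even// ltW// sq//; lra.
pose F y := K * y - (artanhR y - artanh_poly N y).
have dF y : 0 <= y <= x -> is_derive y 1 F (K - y ^+ N.*2 / (1 - y ^+ 2)).
  move=> yx; have -> : F = (fun y => 0 + K * y) - (artanhR - artanh_poly N).
    by apply/funext => t; rewrite /F !fctE; ring.
  by have h1 := dd y yx; have h2 := is_derive_affine 0 K y; apply: is_deriveB.
have : F 0 <= F x.
  apply: (@nondecr_deriv F (fun y => K - y ^+ N.*2 / (1 - y ^+ 2))) => //.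
  move=> y yx; have yr : 0 <= y <= r by lra.
  have h : 1 - r ^+ 2 <= 1 - y ^+ 2 by rewrite lerD2l lerN2 lerXn2r ?nnegrE//; lra.
  have rr : 0 <= r <= r by lra.
  rewrite subr_ge0; apply: ler_pM; first exact: ge0_exp_even.
  - by rewrite invr_ge0 ltW// sq.
  - by rewrite lerXn2r ?nnegrE//; lra.
  - by rewrite lef_pV2 ?posrE ?sq.
rewrite /F z mulr0 subr0 subr_ge0 => /le_trans; apply.
by rewrite -/K; nra.
Qed.

Lemma gfun_gap N r x : 0 <= x <= r -> r < 1 ->
  0 <= gfun x - gpoly N x <= r ^+ N.*2 / (1 - r ^+ 2).
Proof.
move=> /andP[x0 xr] r1.
have r0 : 0 <= r by apply: le_trans xr.
have z : gfun 0 - gpoly N 0 = 0.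
  rewrite gfun0 /gpoly big1 ?subrr// => p _.
  by rewrite doubleS exprS mul0r mulr0.
have dd y : 0 <= y <= x -> is_derive y 1 (gfun - gpoly N) (artanhR y - artanh_poly N y).
  move=> /andP[y0 yx].
  have h1 := @is_derive_gfun y ltac:(lra).
  by have h2 := is_derive_gpoly N y; apply: is_deriveB.
have bd y : 0 <= y <= x -> 0 <= artanhR y - artanh_poly N y <= r ^+ N.*2 / (1 - r ^+ 2).
  by move=> ?; apply: artanh_gap => //; lra.
apply/andP; split.
  rewrite -z; apply: (@nondecr_deriv (gfun - gpoly N) (fun y => artanhR y - artanh_poly N y)) => //.
  by move=> y /bd/andP[].
pose K := r ^+ N.*2 / (1 - r ^+ 2).
have K0 : 0 <= K by have /andP[a b] := bd 0 ltac:(lra); apply: le_trans b.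
pose F y := K * y - (gfun y - gpoly N y).
have dF y : 0 <= y <= x -> is_derive y 1 F (K - (artanhR y - artanh_poly N y)).
  move=> yx; have -> : F = (fun y => 0 + K * y) - (gfun - gpoly N).
    by apply/funext => t; rewrite /F !fctE; ring.
  by have h1 := dd y yx; have h2 := is_derive_affine 0 K y; apply: is_deriveB.
have : F 0 <= F x.
  apply: (@nondecr_deriv F (fun y => K - (artanhR y - artanh_poly N y))) => //.
  by move=> y /bd/andP[_]; rewrite subr_ge0.
rewrite /F z mulr0 subr0 subr_ge0 => /le_trans; apply.
by rewrite -/K; nra.
Qed.


Lemma ler_norm_expB (n : nat) x y : `|x| <= 1 -> `|y| <= 1 ->
  `|x ^+ n - y ^+ n| <= n%:R * `|x - y|.
Proof.
move=> x1 y1; elim: n => [|n IH]; first by rewrite !expr0 subrr normr0 mul0r.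
have -> : x ^+ n.+1 - y ^+ n.+1 = x * (x ^+ n - y ^+ n) + (x - y) * y ^+ n by rewrite !exprS; ring.
apply: le_trans (ler_normD _ _) _; rewrite !normrM -natr1 mulrDl mul1r lerD//.
  by apply: le_trans IH; rewrite ler_piMl.
by rewrite ler_piMr// normrX exprn_ile1.
Qed.

Definition glip (N : nat) : R := \sum_(p < N) gcoef p * (p.+1.*2)%:R.

Lemma ge0_glip N : 0 <= glip N.
Proof. by apply: sumr_ge0 => p _; rewrite mulr_ge0 ?ge0_gcoef. Qed.

Lemma gpoly_lip N x y : `|x| <= 1 -> `|y| <= 1 ->
  `|gpoly N x - gpoly N y| <= glip N * `|x - y|.
Proof.
move=> x1 y1; rewrite /gpoly -sumrB /glip mulr_suml.
apply: le_trans (ler_norm_sum _ _ _) _; apply: ler_sum => p _.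
by rewrite -mulrBr normrM (ger0_norm (ge0_gcoef p)) -mulrA ler_wpM2l ?ge0_gcoef// ler_norm_expB.
Qed.

Lemma gpoly_homo N x y : 0 <= x <= y -> gpoly N x <= gpoly N y.
Proof.
move=> /andP[x0 xy]; apply: ler_sum => p _; rewrite ler_wpM2l ?ge0_gcoef//.
by rewrite lerXn2r ?nnegrE// (le_trans x0).
Qed.

Lemma ln2_le1 : ln 2 <= 1 :> R.
Proof. by have := @le_ln1Dx R 1; rewrite -[1 + 1]/(2 : R); apply; lra. Qed.

(** The derivative of [gfun] blows up at 1. With the distance to 1 written as a square, [etaM] gives
    eta(s^2) = 2 s eta(s) >= 2 s (s - 1), which replaces a derivative bound. *)
Lemma gfun_near1 (s : R) : 0 <= s <= 1 -> ln 2 <= gfun (1 - s ^+ 2) + 2 * s.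
Proof.
move=> /andP[s0 s1]; rewrite /gfun.
have u0 : 0 <= s ^+ 2 by apply: sqr_ge0.
have u1 : s ^+ 2 <= 1 by rewrite expr_le1.
have us : s ^+ 2 <= s by rewrite expr2; nra.
have -> : 1 - (1 - s ^+ 2) = s * s by ring.
rewrite etaM//.
have e1 := eta_ge_sub1 s0.
have e2 : s * (s - 1) <= s * eta s by rewrite ler_wpM2l.
set w := 1 + (1 - s ^+ 2); have w1 : 1 <= w by rewrite /w; lra.
have w0 : 0 < w by lra.
have : ln (2 / w) <= 2 / w - 1 by apply: ln_le_sub1; rewrite divr_gt0.
rewrite ln_div ?posrE// => h.
have h2 : w * (ln 2 - ln w) <= w * (2 / w - 1) by rewrite ler_pM2l.
have h3 : w * (2 / w - 1) = 2 - w by field; lra.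
have h4 : w * ln 2 = (2 - s ^+ 2) * ln 2 by rewrite /w; ring.
have h5 : s ^+ 2 * ln 2 <= s ^+ 2 by rewrite ler_piMr// ln2_le1.
move: h2; rewrite h3 mulrBr h4 mulrBl -/(eta w) /w => h2.
by rewrite expr2 in us h5 h2 *; nra.
Qed.

(** Below 1 this is [gfun_gap] with [r] equal to the point. The endpoint is reached through the
    Lipschitz bound of [gpoly] and [gfun <= ln 2], without continuity of [gfun] at 1. *)
Lemma gpoly_le_gfun N x : -1 <= x <= 1 -> gpoly N x <= gfun x.
Proof.
have P r : 0 <= r < 1 -> gpoly N r <= gfun r.
  by move=> /andP[r0 r1]; have := @gfun_gap N r r; rewrite r0 lexx/= => /(_ erefl r1)/andP[]; lra.
wlog x0 : x / 0 <= x => [H|].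
  have [/H//|x0] := leP 0 x; move=> h.
  by rewrite -gpolyN -gfunN; apply: H; lra.
move=> /andP[_]; rewrite le_eqVlt => /predU1P[->|x1]; last by apply: P; rewrite x0.
rewrite gfun1; apply/ler_addgt0Pr => e e0.
pose u := Num.min 1 (e / (glip N + 1)).
have g0 : 0 < glip N + 1 by have := ge0_glip N; lra.
have u0 : 0 < u by rewrite lt_min ltr01 divr_gt0.
have u1 : u <= 1 by rewrite ge_min lexx.
have ue : u * (glip N + 1) <= e by rewrite -ler_pdivlMr// ge_min lexx orbT.
have := @gpoly_lip N 1 (1 - u); rewrite normr1 lexx => /(_ erefl) h.
have : gpoly N 1 - gpoly N (1 - u) <= glip N * u.
  apply: le_trans (ler_norm _) _; apply: le_trans (h _) _.
    by rewrite ler_norml; lra.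
  by rewrite ler_wpM2l ?ge0_glip// ler_norml; lra.
have h1 := P (1 - u) ltac:(lra).
have h2 := @gfun_le_ln2 (1 - u) ltac:(lra).
nra.
Qed.

(** Up to [r = 1 - s^2] the geometric tail is at most e/2. Beyond [r], [gpoly] is nondecreasing
    while [gfun] can rise by at most 2s <= e/2 in view of [gfun_near1]. *)
Lemma gfun_approx (e : R) : 0 < e ->
  exists N, forall x, -1 <= x <= 1 -> gpoly N x <= gfun x <= gpoly N x + e.
Proof.
move=> e0.
pose s := Num.min (2^-1) (e / 4).
have s0 : 0 < s by rewrite lt_min invr_gt0 ltr0n divr_gt0.
have s1 : s <= 2^-1 by rewrite ge_min lexx.
have se : s <= e / 4 by rewrite ge_min lexx orbT.
pose r := 1 - s ^+ 2.
have ss : s ^+ 2 <= s by rewrite expr2; nra.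
have ss0 : 0 < s ^+ 2 by rewrite exprn_gt0.
have r0 : 0 <= r by rewrite /r; lra.
have r1 : r < 1 by rewrite /r; lra.
have d0 : 0 < 1 - r ^+ 2 by rewrite (_ : 1 - r ^+ 2 = (1 - r) * (1 + r)); [nra|ring].
have [N Nr] : exists N, r ^+ N.*2 / (1 - r ^+ 2) <= e / 2.
  have rn : `|r| < 1 by rewrite ger0_norm.
  have e1 : 0 < e / 2 * (1 - r ^+ 2) by rewrite mulr_gt0// divr_gt0.
  have /cvgrPdist_le /(_ _ e1)[] := cvg_expr rn.
  move=> N _ /(_ N.*2 _); rewrite sub0r normrN ger0_norm ?exprn_ge0// => h.
  exists N; rewrite ler_pdivrMr// h//=.
  by rewrite -addnn leq_addl.
exists N => x x1; rewrite gpoly_le_gfun//=.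
wlog x0 : x x1 / 0 <= x => [H|].
  have [/H//|x0] := leP 0 x; first exact.
  by rewrite -gpolyN -gfunN; apply: H; lra.
have rr := @gfun_gap N r.
have [xr|rx] := leP x r.
  by have /andP[_] := rr x ltac:(lra) r1; lra.
have /andP[_ h1] := rr r ltac:(lra) r1.
have h2 := @gpoly_homo N r x ltac:(lra).
have h3 := @gfun_near1 s ltac:(lra).
have h4 := gfun_le_ln2 x1.
rewrite -/r in h3; lra.
Qed.

Lemma ge0_gfun x : -1 <= x <= 1 -> 0 <= gfun x.
Proof. by move=> x1; apply: le_trans (gpoly_le_gfun 0 x1); apply: ge0_gpoly. Qed.

(** Tangent of x^k at [v]. Multiplying the induction hypothesis by [x] leaves the surplus (k+1) v^k
    (x-v)^2. For [k = 0] the truncated exponent [k.-1] has coefficient zero. *)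
Lemma tangent_exp (k : nat) (x v : R) : 0 <= x -> 0 <= v ->
  k%:R * v ^+ k.-1 * x + (1 - k%:R) * v ^+ k <= x ^+ k.
Proof.
move=> x0 v0; case: k => [|k]; first by rewrite !expr0 !mul0r add0r subr0 mul1r.
rewrite /= exprS; elim: k => [|k IH].
  by rewrite !expr0 !expr1 subrr mul0r; lra.
have h := ler_wpM2l x0 IH.
have vk : 0 <= v ^+ k by apply: exprn_ge0.
have h2 : 0 <= (k%:R + 1) * (v ^+ k * (x - v) ^+ 2).
  by rewrite mulr_ge0 ?addr_ge0// mulr_ge0// sqr_ge0.
move: h; rewrite !exprS -!natr1 => h.
apply: le_trans h; rewrite -subr_ge0; apply: le_trans h2 _.
rewrite le_eqVlt; apply/orP; left; apply/eqP; ring.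
Qed.

End Entropy_function.

(** * Finitely supported laws *)

Section Laws.
Variable R : realType.

(** Entries are pairs (weight, value). With finite support every average over observations is a
    finite sum, so integrals enter only where the channel and the law of [V] are approximated. *)
Definition law := seq (R * R).

Definition lawE (l : law) (f : R -> R) : R := \sum_(m <- l) m.1 * f m.2.

Definition is_law (l : law) : Prop :=
  (forall m, m \in l -> 0 <= m.1 /\ -1 <= m.2 <= 1) /\ lawE l (fun=> 1) = 1.

Definition hard : law := [:: (1, 1)].

Lemma lawE_hard f : lawE hard f = f 1.
Proof. by rewrite /lawE big_seq1 mul1r. Qed.

Lemma is_law_hard : is_law hard.
Proof.
split; last by rewrite lawE_hard.
by move=> m; rewrite inE => /eqP ->/=; split => //; apply/andP; split => //; lra.
Qed.

Lemma lawE_le (l : law) f g : is_law l ->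
  (forall u, -1 <= u <= 1 -> f u <= g u) -> lawE l f <= lawE l g.
Proof.
move=> [hl _] fg; rewrite /lawE big_seq [leRHS]big_seq.
by apply: ler_sum => m /hl[? ?]; rewrite ler_wpM2l// fg.
Qed.

Lemma eq_lawE (l : law) f g : (forall u, f u = g u) -> lawE l f = lawE l g.
Proof. by move=> fg; congr lawE; apply/funext. Qed.

Lemma lawED (l : law) f g : lawE l (fun u => f u + g u) = lawE l f + lawE l g.
Proof. by rewrite /lawE -big_split/=; apply: eq_bigr => m _; rewrite mulrDr. Qed.

Lemma lawEZ (l : law) c f : lawE l (fun u => c * f u) = c * lawE l f.
Proof. by rewrite /lawE big_distrr/=; apply: eq_bigr => m _; rewrite mulrCA. Qed.

Lemma lawEZr (l : law) c f : lawE l (fun u => f u * c) = lawE l f * c.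
Proof. by rewrite mulrC -lawEZ; apply: eq_lawE => u; rewrite mulrC. Qed.

Lemma lawE_cst (l : law) c : is_law l -> lawE l (fun=> c) = c.
Proof.
move=> [_ l1]; rewrite -[RHS]mulr1 -l1 -lawEZ.
by apply: eq_lawE => u; rewrite mulr1.
Qed.

Lemma lawE_sum (l : law) (I : Type) (r : seq I) (P : pred I) F :
  lawE l (fun u => \sum_(i <- r | P i) F i u) = \sum_(i <- r | P i) lawE l (F i).
Proof.
rewrite /lawE exchange_big/=; apply: eq_bigr => m _.
by rewrite big_distrr.
Qed.

Lemma lawE_exchange (l l' : law) (F : R -> R -> R) :
  lawE l (fun u => lawE l' (F u)) = lawE l' (fun v => lawE l (F^~ v)).
Proof.
rewrite /lawE; under eq_bigr do rewrite big_distrr/=.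
rewrite exchange_big/=; apply: eq_bigr => m _.
by rewrite big_distrr; apply: eq_bigr => m' _ /=; rewrite mulrCA.
Qed.

Lemma ge0_lawE (l : law) f : is_law l -> (forall u, -1 <= u <= 1 -> 0 <= f u) -> 0 <= lawE l f.
Proof. by move=> hl h; rewrite -(lawE_cst 0 hl); apply: lawE_le. Qed.

End Laws.

(** * Noisy observations of a hidden word, as operations on likelihood weights *)

Section Observations.
Variables (R : realType) (X : finType).
Implicit Types (w : X -> R) (f chi : X -> R) (Psi : (X -> R) -> R).
Local Notation obs := (law R * (X -> R))%type.
Implicit Types (o : obs) (L : seq obs).

Definition nneg w := forall x, 0 <= w x.
Definition spin chi := forall x, -1 <= chi x <= 1.

Definition dot w f : R := \sum_x w x * f x.
Definition mass w : R := \sum_x w x.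

Definition upd w f (u : R) : X -> R := fun x => w x * (1 + u * f x).

(* [o.1] is a distribution of biases [u]; given [u] and the hidden [x], the noisy parity
   [o.2 x] is observed as [+1] or [-1] with probability [(1 +- u * o.2 x) / 2]. Weights [w]
   are likelihoods multiplied by [2] at each observation. *)
Definition Ob o w Psi : R :=
  lawE o.1 (fun u => 2^-1 * (Psi (upd w o.2 u) + Psi (upd w o.2 (- u)))).

Fixpoint EE L w Psi : R :=
  if L is o :: L' then Ob o w (fun w' => EE L' w' Psi) else Psi w.

Definition good o := is_law o.1 /\ spin o.2.

Fixpoint valid L : Prop := if L is o :: L' then good o /\ valid L' else True.

Lemma valid_cat L1 L2 : valid L1 -> valid L2 -> valid (L1 ++ L2).
Proof. by elim: L1 => [|o L IH] //= [? /IH h] /h. Qed.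

Lemma valid_map (I : eqType) (s : seq I) (F : I -> obs) :
  (forall i, i \in s -> good (F i)) -> valid (map F s).
Proof.
elim: s => [|i s IH] //= h; split; first by apply: h; rewrite mem_head.
by apply: IH => j js; apply: h; rewrite inE js orbT.
Qed.

Lemma upd_nneg w f u : nneg w -> spin f -> -1 <= u <= 1 -> nneg (upd w f u).
Proof.
move=> w0 ff u1 x; rewrite mulr_ge0//.
have : `|u * f x| <= 1 by rewrite normrM mulr_ile1// ler_norml.
by rewrite ler_norml; lra.
Qed.

Lemma Ob_le o w Psi1 Psi2 : good o -> nneg w ->
  (forall w, nneg w -> Psi1 w <= Psi2 w) -> Ob o w Psi1 <= Ob o w Psi2.
Proof.
move=> [ol os] w0 h; apply: lawE_le => // u u1.
by rewrite ler_pM2l ?invr_gt0// lerD// h//; apply: upd_nneg => //; lra.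
Qed.

Lemma EE_le L w Psi1 Psi2 : valid L -> nneg w ->
  (forall w, nneg w -> Psi1 w <= Psi2 w) -> EE L w Psi1 <= EE L w Psi2.
Proof.
elim: L w => [|o L IH] w /=; first by move=> _ w0; apply.
by move=> [go vL] w0 h; apply: Ob_le => // w' w'0; apply: IH.
Qed.

Lemma EE_D L w Psi1 Psi2 :
  EE L w (fun w => Psi1 w + Psi2 w) = EE L w Psi1 + EE L w Psi2.
Proof.
elim: L w => [|o L IH] w //=; rewrite /Ob -lawED; apply: eq_lawE => u.
by rewrite !IH; ring.
Qed.

Lemma EE_Z L w c Psi : EE L w (fun w => c * Psi w) = c * EE L w Psi.
Proof.
elim: L w => [|o L IH] w //=; rewrite /Ob -lawEZ; apply: eq_lawE => u.
by rewrite !IH; ring.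
Qed.

Lemma EE_B L w Psi1 Psi2 :
  EE L w (fun w => Psi1 w - Psi2 w) = EE L w Psi1 - EE L w Psi2.
Proof.
rewrite EE_D; congr (_ + _); rewrite -mulN1r -EE_Z; congr (EE _ _ _).
by apply/funext => w'; rewrite mulN1r.
Qed.

Lemma EE_sum L w (I : Type) (r : seq I) (F : I -> (X -> R) -> R) :
  EE L w (fun w => \sum_(i <- r) F i w) = \sum_(i <- r) EE L w (F i).
Proof.
elim: r => [|i r IH].
  rewrite big_nil -[RHS](mul0r (EE L w (fun=> 0))) -EE_Z; congr (EE _ _ _).
  by apply/funext => w'; rewrite big_nil mul0r.
rewrite big_cons -IH -EE_D; congr (EE _ _ _).
by apply/funext => w'; rewrite big_cons.
Qed.

Lemma eq_EE L w Psi1 Psi2 : (forall w, Psi1 w = Psi2 w) -> EE L w Psi1 = EE L w Psi2.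
Proof. by move=> h; congr (EE _ _ _); apply/funext. Qed.

Lemma EE_lincomb L w K (c : nat -> R) (f : nat -> (X -> R) -> R) :
  EE L w (fun w => \sum_(q < K) c q * f q w) = \sum_(q < K) c q * EE L w (f q).
Proof.
rewrite -(big_mkord xpredT (fun q => c q * EE L w (f q))).
under eq_EE do rewrite -(big_mkord xpredT (fun q => c q * f q _)).
by rewrite EE_sum; apply: eq_bigr => q _; rewrite EE_Z.
Qed.

Lemma dot_upd w chi u f : dot (upd w chi u) f = dot w f + u * dot w (fun x => chi x * f x).
Proof.
rewrite /dot big_distrr -big_split/=; apply: eq_bigr => x _.
by rewrite /upd; ring.
Qed.

Lemma massE w : mass w = dot w (fun=> 1).
Proof. by rewrite /mass /dot; apply: eq_bigr => x _; rewrite mulr1. Qed.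

Lemma mass_upd w chi u : mass (upd w chi u) = mass w + u * dot w chi.
Proof.
rewrite !massE dot_upd; congr (_ + _ * _).
by apply: eq_bigr => x _; rewrite mulr1.
Qed.

(** Martingale property: the two updates of one observation average back to [w]. *)
Lemma EE_dot L w f : valid L -> EE L w (fun w => dot w f) = dot w f.
Proof.
elim: L w => [|o L IH] w //= [[ol os] vL]; rewrite /Ob.
rewrite -[RHS](lawE_cst _ ol); apply: eq_lawE => u.
by rewrite !IH// !dot_upd; field.
Qed.

Lemma EE_mass L w : valid L -> EE L w mass = mass w.
Proof.
move=> vL; rewrite massE -(EE_dot w _ vL); apply: eq_EE => w'.
by rewrite massE.
Qed.

Lemma EE_cat L1 L2 w Psi : EE (L1 ++ L2) w Psi = EE L1 w (fun w => EE L2 w Psi).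
Proof.
elim: L1 w => [|o L IH] w //=; apply: eq_lawE => u.
by rewrite !IH.
Qed.

Lemma updC w f g u v : upd (upd w f u) g v = upd (upd w g v) f u.
Proof. by apply/funext => x; rewrite /upd mulrAC. Qed.

(** Updates multiply the weight pointwise and therefore commute; the rest is an exchange of two
    finite sums. Every reordering of observations below rests on this. *)
Lemma ObC o1 o2 w Psi :
  Ob o1 w (fun w => Ob o2 w Psi) = Ob o2 w (fun w => Ob o1 w Psi).
Proof.
rewrite /Ob; transitivity (lawE o1.1 (fun u => lawE o2.1 (fun v =>
   2^-1 * (2^-1 * (Psi (upd (upd w o1.2 u) o2.2 v) + Psi (upd (upd w o1.2 u) o2.2 (- v))) +
    2^-1 * (Psi (upd (upd w o1.2 (- u)) o2.2 v) + Psi (upd (upd w o1.2 (- u)) o2.2 (- v))))))).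
  by apply: eq_lawE => u; rewrite -lawED -lawEZ.
rewrite lawE_exchange; apply: eq_lawE => v; rewrite -lawED -lawEZ.
apply: eq_lawE => u; rewrite !(updC _ o2.2); ring.
Qed.

Lemma EE_catC L1 L2 w Psi : EE (L1 ++ L2) w Psi = EE (L2 ++ L1) w Psi.
Proof.
elim: L1 w => [|o L IH] w /=; first by rewrite cats0.
have -> : EE (L2 ++ o :: L) w Psi = EE (o :: L2 ++ L) w Psi.
  elim: L2 w {IH} => [|o' L' IH] w //=.
  have -> : Ob o' w (fun w' => EE (L' ++ o :: L) w' Psi) =
            Ob o' w (fun w' => Ob o w' (fun w' => EE (L' ++ L) w' Psi)).
    by congr (Ob _ _ _); apply/funext => w'; rewrite IH.
  exact: ObC.
by rewrite /=; congr (Ob _ _ _); apply/funext => w'; apply: IH.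
Qed.

Lemma EE_perm (I : eqType) (F : I -> obs) (s t : seq I) w Psi : perm_eq s t ->
  EE (map F s) w Psi = EE (map F t) w Psi.
Proof.
elim: s t w => [|i s IH] t w.
  by rewrite perm_sym => /perm_nilP ->.
move=> /[dup]/perm_mem/(_ i); rewrite mem_head => /esym/rot_index rt pst.
have : perm_eq (i :: s) (rot (index i t) t) by apply: perm_trans pst _; rewrite perm_sym perm_rot.
rewrite rt perm_cons => /IH h.
have -> : EE (map F t) w Psi = EE (map F (rot (index i t) t)) w Psi.
  by rewrite /rot map_cat EE_catC -map_cat cat_take_drop.
rewrite rt /=; congr (Ob _ _ _); apply/funext => w'; exact: h.
Qed.

(** Convexity together with homogeneity: the functionals whose average can only grow with more
    information. The basic instances are [mom] and minus [Sent]; [PhiF] is not homogeneous and is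
    treated through [Ob_PhiF]. *)
Definition sublin Psi : Prop :=
  (forall w1 w2, nneg w1 -> nneg w2 -> Psi (fun x => w1 x + w2 x) <= Psi w1 + Psi w2) /\
  (forall c w, 0 <= c -> nneg w -> Psi (fun x => c * w x) = c * Psi w).

Lemma nneg_add w1 w2 : nneg w1 -> nneg w2 -> nneg (fun x => w1 x + w2 x).
Proof. by move=> h1 h2 x; rewrite addr_ge0. Qed.

Lemma nneg_scale c w : 0 <= c -> nneg w -> nneg (fun x => c * w x).
Proof. by move=> h1 h2 x; rewrite mulr_ge0. Qed.

Lemma sublin_comb Psi w w1 w2 a b : sublin Psi -> 0 <= a -> 0 <= b -> nneg w1 -> nneg w2 ->
  (forall x, w x = a * w1 x + b * w2 x) -> Psi w <= a * Psi w1 + b * Psi w2.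
Proof.
move=> [sD sZ] a0 b0 w10 w20 h.
have -> : w = (fun x => (a * w1 x) + (b * w2 x)) by apply/funext.
by rewrite -!sZ//; apply: sD; apply: nneg_scale.
Qed.

Lemma sublin_Ob o Psi : good o -> sublin Psi -> sublin (fun w => Ob o w Psi).
Proof.
move=> [ol os] [sD sZ]; split=> [w1 w2 w10 w20|c w c0 w0].
  rewrite /Ob -lawED; apply: lawE_le => // u u1.
  rewrite -mulrDr ler_pM2l ?invr_gt0// addrACA.
  have h v : -1 <= v <= 1 -> Psi (upd (fun x => w1 x + w2 x) o.2 v) <=
     Psi (upd w1 o.2 v) + Psi (upd w2 o.2 v).
    move=> v1; have -> : upd (fun x => w1 x + w2 x) o.2 v =
      (fun x => upd w1 o.2 v x + upd w2 o.2 v x).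
      by apply/funext => x; rewrite /upd mulrDl.
    by apply: sD; apply: upd_nneg.
  by apply: lerD; apply: h; lra.
rewrite /Ob -lawEZ /lawE; apply: eq_big_seq => -[m u] mu; have [_ /= u1] := ol.1 _ mu.
congr (_ * _).
have h v : -1 <= v <= 1 -> Psi (upd (fun x => c * w x) o.2 v) = c * Psi (upd w o.2 v).
  move=> v1; rewrite -sZ//; last exact: upd_nneg.
  by congr Psi; apply/funext => x; rewrite /upd mulrA.
by rewrite !h; [ring|lra|lra].
Qed.

Lemma sublin_EE L Psi : valid L -> sublin Psi -> sublin (fun w => EE L w Psi).
Proof. by elim: L => [|o L IH] //= [go vL] sP; apply: sublin_Ob => //; apply: IH. Qed.

Lemma Ob_ge o w Psi : good o -> sublin Psi -> nneg w -> Psi w <= Ob o w Psi.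
Proof.
move=> [ol os] sP w0; rewrite -[leLHS](lawE_cst _ ol); apply: lawE_le => // u u1.
rewrite mulrDr; apply: sublin_comb => //; rewrite ?invr_ge0//.
- by apply: upd_nneg.
- by apply: upd_nneg => //; lra.
- by move=> x; rewrite /upd; field.
Qed.

Lemma EE_ge L w Psi : valid L -> sublin Psi -> nneg w -> Psi w <= EE L w Psi.
Proof.
elim: L w => [|o L IH] w //= [go vL] sP w0.
by apply: le_trans (Ob_ge go sP w0) _; apply: Ob_le => // w' w'0; apply: IH.
Qed.

(** Bias [u] is a hard observation flipped with probability (1-u)/2: both updates are convex
    combinations of the two hard ones, with exchanged coefficients. *)
Lemma Ob_degrade l chi w Psi : good (l, chi) -> sublin Psi -> nneg w ->
  Ob (l, chi) w Psi <= Ob (hard R, chi) w Psi.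
Proof.
move=> [/= ol os] sP w0; rewrite -[leRHS](lawE_cst _ ol); apply: lawE_le => // u u1.
rewrite /Ob/= lawE_hard.
have n1 : nneg (upd w chi 1) by apply: upd_nneg => //; lra.
have n2 : nneg (upd w chi (-1)) by apply: upd_nneg => //; lra.
have h1 : Psi (upd w chi u) <= (1 + u) / 2 * Psi (upd w chi 1) + (1 - u) / 2 * Psi (upd w chi (-1)).
  by apply: sublin_comb => //; [lra|lra|move=> x; rewrite /upd; field].
have h2 : Psi (upd w chi (- u)) <= (1 - u) / 2 * Psi (upd w chi 1) + (1 + u) / 2 * Psi (upd w chi (-1)).
  by apply: sublin_comb => //; [lra|lra|move=> x; rewrite /upd; field].
lra.
Qed.

Lemma EE_degrade (I : eqType) (s : seq I) (l : I -> law R) (chi : I -> X -> R) w Psi :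
  (forall i, i \in s -> good (l i, chi i)) -> sublin Psi -> nneg w ->
  EE [seq (l i, chi i) | i <- s] w Psi <= EE [seq (hard R, chi i) | i <- s] w Psi.
Proof.
elim: s w => [|i s IH] w //= h sP w0.
have gi := h i (mem_head _ _).
have h' j : j \in s -> good (l j, chi j) by move=> js; apply: h; rewrite inE js orbT.
apply: (@le_trans _ _ (Ob (l i, chi i) w (fun w' => EE [seq (hard R, chi i) | i <- s] w' Psi))).
  by apply: Ob_le => // w' w'0; apply: IH.
apply: Ob_degrade => //; apply: sublin_EE => //.
by apply: valid_map => j /h'[_ ?]; split => //; apply: is_law_hard.
Qed.

Definition mean chi w := dot w chi / mass w.
(** The exponent is 2p+2. The factor [mass w] is the likelihood of the outcome, so from an initial
    mass 1 the [EE] of this is the expected even power of the posterior mean. A weight of mass 0 has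
    mean 0 by the convention on division. *)
Definition mom p chi w := mass w * mean chi w ^+ p.+1.*2.

Lemma dot_le_mass w chi : nneg w -> spin chi -> `|dot w chi| <= mass w.
Proof.
move=> w0 s; apply: le_trans (ler_norm_sum _ _ _) _; apply: ler_sum => x _.
by rewrite normrM (ger0_norm (w0 x)) ler_piMr// ler_norml.
Qed.

Lemma ge0_mass w : nneg w -> 0 <= mass w.
Proof. by move=> w0; apply: sumr_ge0. Qed.

Lemma mean_bound w chi : nneg w -> spin chi -> -1 <= mean chi w <= 1.
Proof.
move=> w0 s; rewrite -ler_norml /mean normrM normfV (ger0_norm (ge0_mass w0)).
have [->|n0] := eqVneq (mass w) 0; first by rewrite invr0 mulr0.
have m0 : 0 < mass w by rewrite lt_neqAle eq_sym n0 ge0_mass.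
by rewrite ler_pdivrMr// mul1r dot_le_mass.
Qed.

Lemma mass_mean w chi : nneg w -> spin chi -> mass w * mean chi w = dot w chi.
Proof.
move=> w0 s; rewrite /mean; have [m0|n0] := eqVneq (mass w) 0; last by rewrite mulrC divfK.
have := dot_le_mass w0 s; rewrite m0 normr_le0 => /eqP ->.
by rewrite !mul0r.
Qed.

Lemma ge0_mom p chi w : nneg w -> 0 <= mom p chi w.
Proof. by move=> w0; rewrite mulr_ge0 ?ge0_mass// ge0_exp_even. Qed.

Lemma exp_even_le1 (x : R) p : -1 <= x <= 1 -> x ^+ p.*2 <= 1.
Proof.
move=> x1; rewrite -mul2n exprM exprn_ile1 ?sqr_ge0//.
by rewrite -real_normK ?num_real// expr_le1// ler_norml.
Qed.

Lemma mom_le_mass p chi w : nneg w -> spin chi -> mom p chi w <= mass w.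
Proof. by move=> w0 s; rewrite ler_piMr ?ge0_mass// exp_even_le1// mean_bound. Qed.

Lemma tangent_even (x b : R) p :
  b ^+ p.*2 + (p.*2)%:R * b ^+ p.*2.-1 * (x - b) <= x ^+ p.*2.
Proof.
have := tangent_exp p.*2 (normr_ge0 x) (normr_ge0 b).
have nE (y : R) : `|y| ^+ p.*2 = y ^+ p.*2.
  by rewrite -mul2n !exprM real_normK ?num_real.
rewrite !nE => h; apply: le_trans h.
case: p nE => [|p] nE; first by rewrite double0 !expr0 !mul0r; lra.
have -> : b ^+ (p.+1).*2 + (p.+1).*2%:R * b ^+ (p.+1).*2.-1 * (x - b) =
  (p.+1).*2%:R * (b ^+ (p.+1).*2.-1 * x) + (1 - (p.+1).*2%:R) * b ^+ (p.+1).*2.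
  by rewrite doubleS/= (exprS b p.*2.+1); ring.
rewrite lerD2r -mulrA ler_wpM2l//.
by apply: le_trans (ler_norm _) _; rewrite normrM normrX.
Qed.

Lemma mom_tangent p chi w b : nneg w -> spin chi ->
  mass w * b ^+ p.+1.*2 + (p.+1.*2)%:R * b ^+ p.+1.*2.-1 * (dot w chi - mass w * b) <= mom p chi w.
Proof.
move=> w0 s; rewrite -(mass_mean w0 s) /mom -mulrBr.
rewrite (mulrCA _ (mass w)) -mulrDr.
by rewrite ler_wpM2l ?ge0_mass// tangent_even.
Qed.

(** [mom] is the perspective of the convex function x^(2p+2). Both summands are compared with the
    tangent at the mean of the sum, and the linear parts cancel. *)
Lemma sublin_mom p chi : spin chi -> sublin (mom p chi).
Proof.
move=> s; split=> [w1 w2 w10 w20|c w c0 w0].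
  set w := fun x => w1 x + w2 x; have w0 : nneg w by apply: nneg_add.
  have h1 := mom_tangent p (mean chi w) w10 s.
  have h2 := mom_tangent p (mean chi w) w20 s.
  have mD : mass w = mass w1 + mass w2 by rewrite /mass -big_split.
  have dD : dot w chi = dot w1 chi + dot w2 chi.
    by rewrite /dot -big_split; apply: eq_bigr => x _; rewrite mulrDl.
  have e : dot w1 chi - mass w1 * mean chi w + (dot w2 chi - mass w2 * mean chi w) = 0.
    by have := mass_mean w0 s; rewrite mD dD; lra.
  apply: le_trans (lerD h1 h2); rewrite addrACA -mulrDl -mD -mulrDr.
  by rewrite e mulr0 addr0.
have cm : mass (fun x => c * w x) = c * mass w by rewrite /mass big_distrr.
have cd : dot (fun x => c * w x) chi = c * dot w chi.
  by rewrite /dot big_distrr/=; apply: eq_bigr => x _; rewrite mulrA.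
rewrite /mom /mean cm cd; have [->|n0] := eqVneq c 0; first by rewrite !mul0r.
have -> : c * dot w chi / (c * mass w) = dot w chi / mass w.
  by rewrite invfM (mulrACA c) divff// mul1r.
by rewrite -mulrA.
Qed.

Definition PhiF w := eta (mass w).

(** Chain rule: this is [gain_eta] with N the mass and M the bias times [dot w o.2]. The gain of an
    observation depends only on the current mean of its spin. *)
Lemma Ob_PhiF o w : good o -> nneg w ->
  Ob o w PhiF = PhiF w + lawE o.1 (fun u => mass w * gfun (u * mean o.2 w)).
Proof.
move=> [ol os] w0; rewrite -[PhiF w](lawE_cst _ ol) -lawED /Ob /lawE.
apply: eq_big_seq => -[m u] mu; have [_ /= u1] := ol.1 _ mu; congr (_ * _).
rewrite /PhiF !mass_upd mulNr gain_eta /mean ?mulrA//.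
rewrite normrM; apply: le_trans (dot_le_mass w0 os).
by rewrite ler_piMl// ler_norml.
Qed.

Lemma umean_bound u chi w : -1 <= u <= 1 -> nneg w -> spin chi -> -1 <= u * mean chi w <= 1.
Proof.
by move=> u1 w0 s; rewrite -ler_norml normrM mulr_ile1// ler_norml// mean_bound.
Qed.

Lemma EE_PhiF_ge L w : valid L -> nneg w -> PhiF w <= EE L w PhiF.
Proof.
elim: L w => [|o L IH] w //= [go vL] w0.
apply: (@le_trans _ _ (Ob o w PhiF)); last by apply: Ob_le => // w' w'0; apply: IH.
have [ol os] := go; rewrite Ob_PhiF// lerDl; apply: ge0_lawE => // u u1.
by rewrite mulr_ge0 ?ge0_mass// ge0_gfun// umean_bound.
Qed.

Lemma EE_PhiF_le L w : valid L -> nneg w ->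
  EE L w PhiF <= PhiF w + (size L)%:R * ln 2 * mass w.
Proof.
elim: L w => [|o L IH] w /=; first by rewrite !mul0r addr0.
move=> [go vL] w0; have [ol os] := go.
apply: (@le_trans _ _ (Ob o w (fun w => PhiF w + (size L)%:R * ln 2 * mass w))).
  by apply: Ob_le => // w' w'0; apply: IH.
have -> : Ob o w (fun w => PhiF w + (size L)%:R * ln 2 * mass w) =
   EE [:: o] w (fun w => PhiF w + (size L)%:R * ln 2 * mass w) by [].
rewrite EE_D EE_Z EE_mass//= Ob_PhiF//.
have -> : (size L).+1%:R * ln 2 * mass w = (size L)%:R * ln 2 * mass w + ln 2 * mass w.
  by rewrite -[(size L).+1%:R]natr1; ring.
suff : lawE o.1 (fun u => mass w * gfun (u * mean o.2 w)) <= ln 2 * mass w by lra.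
rewrite -[leRHS](lawE_cst _ ol); apply: lawE_le => // u u1.
by rewrite mulrC ler_wpM2r ?ge0_mass// gfun_le_ln2// umean_bound.
Qed.

End Observations.
Arguments PhiF {R X} w.

Section Telescope.
Variables (R : realType) (I : Type).
Implicit Types (F G : seq I -> I -> R) (pre rest : seq I).

(** The first argument of [F] collects the entries already treated, since the error made at an entry
    depends on what has been pinned before it. *)
Fixpoint tele F pre rest : R :=
  if rest is i :: r then F pre i + tele F (rcons pre i) r else 0.

Lemma teleD F G pre rest :
  tele (fun p i => F p i + G p i) pre rest = tele F pre rest + tele G pre rest.
Proof. by elim: rest pre => [|i r IH] pre /=; rewrite ?addr0// IH; ring. Qed.

Lemma teleZ c F pre rest : tele (fun p i => c * F p i) pre rest = c * tele F pre rest.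
Proof. by elim: rest pre => [|i r IH] pre /=; rewrite ?mulr0// IH mulrDr. Qed.

Lemma tele_cst (f : I -> R) pre rest : tele (fun=> f) pre rest = \sum_(i <- rest) f i.
Proof. by elim: rest pre => [|i r IH] pre /=; rewrite ?big_nil// big_cons IH. Qed.

Lemma tele_sum (J : Type) (s : seq J) (F : J -> seq I -> I -> R) pre rest :
  tele (fun p i => \sum_(j <- s) F j p i) pre rest = \sum_(j <- s) tele (F j) pre rest.
Proof.
elim: rest pre => [|i r IH] pre /=; first by rewrite big1.
by rewrite IH big_split.
Qed.

End Telescope.

(** * One check against independent observations of its spins, for a fixed weight *)

Section Step.
Variables (R : realType) (X : finType) (I : eqType) (chi : I -> X -> R).
Hypothesis chi_spin : forall i, spin (chi i).
Implicit Types (w : X -> R) (s pre rest : seq I).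

Definition Hs s : seq (law R * (X -> R)) := [seq (hard R, chi i) | i <- s].
Definition Ss (l : law R) s : seq (law R * (X -> R)) := [seq (l, chi i) | i <- s].
Definition pchi s : X -> R := fun x => \prod_(i <- s) chi i x.

Definition delta p pre i w := EE (Hs pre) w (mom p (chi i)) - mom p (chi i) w.
Definition momprod p s w := mass w * \prod_(i <- s) mean (chi i) w ^+ p.+1.*2.

Lemma valid_Hs s : valid (Hs s).
Proof. by apply: valid_map => i _; split; [exact: is_law_hard|exact: chi_spin]. Qed.

Lemma valid_Ss l s : is_law l -> valid (Ss l s).
Proof. by move=> hl; apply: valid_map => i _; split => //=; exact: chi_spin. Qed.

Lemma spin_pchi s : spin (pchi s).
Proof.
move=> x; rewrite -ler_norml /pchi; elim: s => [|i s IH]; first by rewrite big_nil normr1.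
by rewrite big_cons normrM mulr_ile1// ler_norml chi_spin.
Qed.

Lemma ge0_delta p pre i w : nneg w -> 0 <= delta p pre i w.
Proof.
move=> w0; rewrite subr_ge0; apply: EE_ge => //; first exact: valid_Hs.
exact: sublin_mom.
Qed.

(* Expand each [chi i] as the difference of the two multipliers [1 +- chi i], up to [1/2]. *)
Lemma dot_pchi_le s w f : nneg w ->
  `|dot w (fun x => pchi s x * f x)| <= EE (Hs s) w (fun w' => `|dot w' f|).
Proof.
elim: s w => [|i s IH] w w0 /=.
  by rewrite le_eqVlt; apply/orP; left; apply/eqP; congr (`|_|); apply: eq_bigr => x _;
     rewrite /pchi big_nil mul1r.
rewrite /Ob lawE_hard/=.
set g := fun x => pchi s x * f x.
have -> : dot w (fun x => pchi (i :: s) x * f x) =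
    2^-1 * (dot (upd w (chi i) 1) g - dot (upd w (chi i) (-1)) g).
  rewrite !dot_upd; set a := dot w g.
  have -> : dot w (fun x => pchi (i :: s) x * f x) = dot w (fun x => chi i x * g x).
    by apply: eq_bigr => x _; rewrite /pchi big_cons /g /pchi -!mulrA.
  by field.
rewrite normrM ger0_norm ?invr_ge0// ler_pM2l ?invr_gt0//.
apply: le_trans (ler_normB _ _) _; apply: lerD; apply: IH; apply: upd_nneg => //; lra.
Qed.

(** Substitute for Cauchy-Schwarz built on |t| <= d + t^2/d. Being linear in the moments, it passes
    through [EE], through averages over matchings and through sums over pins. The value of [d] is
    fixed only in [step_params]. *)
Definition dev (d : R) p i w := d * mass w + d^-1 * delta 0 p i w.

Lemma norm_dot_sub_le (d m : R) i w : 0 < d -> nneg w ->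
  `|dot w (fun x => chi i x - m)| <=
  d * mass w + d^-1 * (mom 0 (chi i) w - 2 * m * dot w (chi i) + m ^+ 2 * mass w).
Proof.
move=> d0 w0; set a := mean (chi i) w; set N := mass w.
have dE : dot w (chi i) = N * a by rewrite mass_mean.
have -> : dot w (fun x => chi i x - m) = N * (a - m).
  transitivity (dot w (chi i) - m * N); last by rewrite dE; ring.
  rewrite /N /mass big_distrr -sumrB/=; apply: eq_bigr => x _.
  by rewrite mulrBr [w x * m]mulrC.
rewrite dE /mom -/a -/N (_ : 0.+1.*2 = 2%N)//.
have -> : N * a ^+ 2 - 2 * m * (N * a) + m ^+ 2 * N = N * (a - m) ^+ 2 by ring.
have N0 : 0 <= N by apply: ge0_mass.
rewrite normrM (ger0_norm N0) (mulrC d) mulrCA -mulrDr ler_wpM2l//.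
set t := a - m; rewrite -(ler_pM2l d0) mulrDr mulVKf ?gt_eqF//.
have := sqr_ge0 (d - `|t|); rewrite -(real_normK (num_real t)).
have := normr_ge0 t; nra.
Qed.

(** The covariance is bounded by how far pinning [pre] moves the mean of [chi i]. The square is
    expanded about the old mean [m]; [EE_dot] evaluates the cross term, and exactly the growth
    [delta 0] of the second moment remains. *)
Lemma cov_le (d : R) pre i w : 0 < d -> nneg w ->
  `|dot w (fun x => pchi pre x * (chi i x - mean (chi i) w))| <= dev d pre i w.
Proof.
move=> d0 w0; set m := mean _ _.
have h := dot_pchi_le pre (fun x => chi i x - m) w0.
apply: (le_trans h).
apply: (@le_trans _ _ (EE (Hs pre) w (fun w' => d * mass w' +
   d^-1 * (mom 0 (chi i) w' - 2 * m * dot w' (chi i) + m ^+ 2 * mass w')))).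
  by apply: EE_le => //; [exact: valid_Hs|move=> w' w'0; exact: norm_dot_sub_le].
rewrite EE_D !EE_Z EE_D EE_B !EE_Z EE_dot ?EE_mass; try exact: valid_Hs.
rewrite /dev lerD2l ler_pM2l ?invr_gt0// /delta.
rewrite /mom -/m -(mass_mean w0 (chi_spin i)) -/m (_ : 0.+1.*2 = 2%N)//.
by rewrite le_eqVlt; apply/orP; left; apply/eqP; ring.
Qed.

(** Factors are replaced by their means one at a time. Each replacement costs a covariance with the
    preceding spins, multiplied by later means that are at most 1 in absolute value. *)
Lemma pchi_mean_le (d : R) pre rest w : 0 < d -> nneg w ->
  `|dot w (pchi (pre ++ rest)) - (\prod_(i <- rest) mean (chi i) w) * dot w (pchi pre)|
   <= tele (fun p i => dev d p i w) pre rest.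
Proof.
move=> d0 w0; elim: rest pre => [|i r IH] pre /=.
  by rewrite cats0 big_nil mul1r subrr normr0.
have := IH (rcons pre i); rewrite cat_rcons => h.
rewrite big_cons.
set P := \prod_(j <- r) _; set A := dot w (pchi (pre ++ i :: r)).
have -> : A - mean (chi i) w * P * dot w (pchi pre) =
   P * (dot w (fun x => pchi pre x * (chi i x - mean (chi i) w))) +
   (A - P * dot w (pchi (rcons pre i))).
  have -> : dot w (fun x => pchi pre x * (chi i x - mean (chi i) w)) =
     dot w (pchi (rcons pre i)) - mean (chi i) w * dot w (pchi pre).
    rewrite /dot big_distrr/= -sumrB; apply: eq_bigr => x _.
    by rewrite /pchi -cats1 big_cat big_seq1/=; ring.
  by ring.
apply: le_trans (ler_normD _ _) _; apply: lerD => //.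
have P1 : `|P| <= 1.
  rewrite /P; elim: (r) => [|j r' IHr]; first by rewrite big_nil normr1.
  by rewrite big_cons normrM mulr_ile1// ler_norml mean_bound.
rewrite normrM; apply: le_trans (cov_le pre i d0 w0).
by rewrite ler_piMl.
Qed.

Lemma mass_gpoly_prod K s w :
  mass w * gpoly K (\prod_(i <- s) mean (chi i) w) = \sum_(p < K) gcoef R p * momprod p s w.
Proof.
rewrite /gpoly big_distrr/=; apply: eq_bigr => p _.
by rewrite /momprod prodrXl mulrCA.
Qed.

(** The gain of a hard check involves the mean of the product of its spins. [gpoly] bounds [gfun]
    from below and is Lipschitz with constant [glip R K], so [pchi_mean_le] lets the product of the
    means take its place. *)
Lemma check_gain K (d : R) s w : 0 < d -> nneg w ->
  PhiF w + \sum_(p < K) gcoef R p * momprod p s w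
    - glip R K * tele (fun p i => dev d p i w) [::] s
  <= EE [:: (hard R, pchi s)] w PhiF.
Proof.
move=> d0 w0; rewrite /= Ob_PhiF//=; last by split=> //; [exact: is_law_hard|exact: spin_pchi].
rewrite lawE_hard mul1r -addrA lerD2l.
have mb := mean_bound w0 (spin_pchi s).
apply: (@le_trans _ _ (mass w * gpoly K (mean (pchi s) w))); last first.
  by rewrite ler_wpM2l ?ge0_mass// gpoly_le_gfun.
rewrite -mass_gpoly_prod lerBlDr -lerBlDl -mulrBr.
apply: le_trans (ler_norm _) _; rewrite normrM (ger0_norm (ge0_mass w0)).
set Pm := \prod_(i <- s) _.
have Pm1 : `|Pm| <= 1.
  rewrite /Pm; elim: (s) => [|j r' IHr]; first by rewrite big_nil normr1.
  by rewrite big_cons normrM mulr_ile1// ler_norml mean_bound.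
have mb' : `|mean (pchi s) w| <= 1 by rewrite ler_norml.
have h := gpoly_lip K Pm1 mb'.
apply: le_trans (ler_wpM2l (ge0_mass w0) h) _.
rewrite mulrCA ler_wpM2l ?ge0_glip//.
rewrite -{1}(ger0_norm (ge0_mass w0)) -normrM mulrBr mass_mean//; last exact: spin_pchi.
have := pchi_mean_le [::] s d0 w0; rewrite cat0s -/Pm.
have -> : dot w (pchi [::]) = mass w.
  by rewrite massE; apply: eq_bigr => x _; rewrite /pchi big_nil.
by rewrite distrC mulrC.
Qed.

Definition lmom (l : law R) p := lawE l (fun u => u ^+ p.+1.*2).

Lemma lmom_bound l p : is_law l -> 0 <= lmom l p <= 1.
Proof.
move=> hl; apply/andP; split; first by apply: ge0_lawE => // u _; rewrite ge0_exp_even.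
by rewrite -[leRHS](lawE_cst _ hl); apply: lawE_le => // u u1; apply: exp_even_le1.
Qed.

Definition fgain K (e : R) l p i w :=
  \sum_(q < K) gcoef R q * (lmom l q * mom q (chi i) w) +
  \sum_(q < K) gcoef R q * delta q p i w + e * mass w.

(** The earlier soft observations are degraded hard ones, so they raise a moment of [chi i] by at
    most [delta]. Here the gain is needed from above, hence [gpoly + e]. *)
Lemma field_gain1 K e l pre i w : is_law l -> nneg w ->
  (forall x : R, -1 <= x <= 1 -> gfun x <= gpoly K x + e) ->
  EE (Ss l (rcons pre i)) w PhiF <= EE (Ss l pre) w PhiF + fgain K e l pre i w.
Proof.
move=> hl w0 ge; rewrite /Ss map_rcons -cats1 EE_cat/=.
have gi : good (l, chi i) by split => //=; exact: chi_spin.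
have vS := valid_Ss pre hl.
have step w' : nneg w' -> Ob (l, chi i) w' PhiF <=
    PhiF w' + (\sum_(q < K) gcoef R q * (lmom l q * mom q (chi i) w') + e * mass w').
  move=> w'0; rewrite Ob_PhiF//= lerD2l.
  apply: (@le_trans _ _ (lawE l (fun u => mass w' * (gpoly K (u * mean (chi i) w') + e)))).
    apply: lawE_le => // u u1; rewrite ler_wpM2l ?ge0_mass// ge//; exact: umean_bound.
  rewrite lawEZ lawED lawE_cst// mulrDr [e * _]mulrC lerD2r.
  rewrite /gpoly lawE_sum big_distrr/=; apply: ler_sum => q _.
  rewrite /lmom /mom (eq_lawE l (g := fun u => (gcoef R q * mean (chi i) w' ^+ q.+1.*2) * u ^+ q.+1.*2)).
    by rewrite lawEZ le_eqVlt; apply/orP; left; apply/eqP; ring.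
  by move=> u; rewrite exprMn; ring.
apply: le_trans (EE_le vS w0 step) _; rewrite !EE_D EE_Z EE_mass// lerD2l lerD2r.
rewrite -(big_mkord xpredT (fun q => gcoef R q * (lmom l q * mom q (chi i) _))).
under eq_EE do rewrite -(big_mkord xpredT (fun q => gcoef R q * (lmom l q * mom q (chi i) _))).
rewrite EE_sum.
rewrite -(big_mkord xpredT (fun q => gcoef R q * delta q pre i w)) -big_split/=.
apply: ler_sum => q _; rewrite !EE_Z -mulrDr ler_wpM2l ?ge0_gcoef//.
have /andP[v0 v1] := lmom_bound q hl.
have h : EE (Ss l pre) w (mom q (chi i)) <= mom q (chi i) w + delta q pre i w.
  by rewrite addrC subrK; apply: EE_degrade => //; [by move=> j _; split => //=; exact: chi_spin|exact/sublin_mom/chi_spin].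
apply: le_trans (ler_wpM2l v0 h) _; rewrite mulrDr lerD2l ler_piMl// ge0_delta//.
Qed.

Lemma field_gain K e l pre rest w : is_law l -> nneg w ->
  (forall x : R, -1 <= x <= 1 -> gfun x <= gpoly K x + e) ->
  EE (Ss l (pre ++ rest)) w PhiF <=
  EE (Ss l pre) w PhiF + tele (fun p i => fgain K e l p i w) pre rest.
Proof.
move=> hl w0 ge; elim: rest pre => [|i r IH] pre /=; first by rewrite cats0 addr0.
rewrite -cat_rcons; apply: le_trans (IH _) _; rewrite addrA lerD2r.
exact: field_gain1.
Qed.

Definition err K (d e : R) p i w :=
  glip R K * dev d p i w + \sum_(q < K) gcoef R q * delta q p i w + e * mass w.

Lemma check_vs_fields K (d e : R) l s w : is_law l -> 0 < d -> nneg w ->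
  (forall x : R, -1 <= x <= 1 -> gfun x <= gpoly K x + e) ->
  EE (Ss l s) w PhiF
   + \sum_(q < K) gcoef R q * (momprod q s w - lmom l q * \sum_(i <- s) mom q (chi i) w)
   - tele (fun p i => err K d e p i w) [::] s
  <= EE [:: (hard R, pchi s)] w PhiF.
Proof.
move=> hl d0 w0 ge; apply: le_trans (check_gain K s d0 w0).
have := field_gain [::] s hl w0 ge; rewrite cat0s [EE (Ss l [::]) w PhiF]/=.
have -> : tele (fun p i => err K d e p i w) [::] s = glip R K * tele (fun p i => dev d p i w) [::] s
   + tele (fun p i => \sum_(q < K) gcoef R q * delta q p i w) [::] s
   + e * tele (fun _ _ => mass w) [::] s.
  by rewrite /err teleD (teleD (fun p i => glip R K * dev d p i w)) !teleZ.
rewrite /fgain !teleD !teleZ.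
rewrite (tele_cst (fun i => \sum_(q < K) gcoef R q * (lmom l q * mom q (chi i) w))).
have -> : \sum_(q < K) gcoef R q * (momprod q s w - lmom l q * \sum_(i <- s) mom q (chi i) w)
  = \sum_(q < K) gcoef R q * momprod q s w -
    \sum_(i <- s) \sum_(q < K) gcoef R q * (lmom l q * mom q (chi i) w).
  rewrite exchange_big -sumrB; apply: eq_bigr => q _ /=.
  by rewrite mulrBr; congr (_ - _); rewrite -!big_distrr.
lra.
Qed.

End Step.

(** * Averages over uniform matchings, exchangeability, sampling with replacement *)

Section Exchangeability.
Variables (R : realType) (T : finType).
Implicit Types (s t D : seq T).

Definition avgP (f : {perm T} -> R) : R := #|{perm T}|%:R^-1 * \sum_pi f pi.

Lemma card_perm_gt0 : 0 < #|{perm T}|%:R :> R.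
Proof. by rewrite ltr0n; apply/card_gt0P; exists 1%g. Qed.

Lemma avgP_le f g : (forall pi, f pi <= g pi) -> avgP f <= avgP g.
Proof. by move=> fg; rewrite ler_pM2l ?invr_gt0 ?card_perm_gt0// ler_sum. Qed.

Lemma avgP_cst c : avgP (fun=> c) = c.
Proof.
rewrite /avgP sumr_const -[X in c *+ X]/(#|{perm T}|) -[c *+ _]mulr_natl mulrA mulVf ?mul1r//.
by rewrite gt_eqF ?card_perm_gt0.
Qed.

Lemma avgPD f g : avgP (fun pi => f pi + g pi) = avgP f + avgP g.
Proof. by rewrite /avgP big_split mulrDr. Qed.

Lemma avgPZ c f : avgP (fun pi => c * f pi) = c * avgP f.
Proof. by rewrite /avgP -big_distrr/= mulrCA. Qed.

Lemma avgPB f g : avgP (fun pi => f pi - g pi) = avgP f - avgP g.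
Proof. by rewrite /avgP sumrB mulrBr. Qed.

Lemma avgP_sum (J : Type) (r : seq J) (F : J -> {perm T} -> R) :
  avgP (fun pi => \sum_(j <- r) F j pi) = \sum_(j <- r) avgP (F j).
Proof. by rewrite /avgP exchange_big/= big_distrr. Qed.

Lemma eq_avgP f g : (forall pi, f pi = g pi) -> avgP f = avgP g.
Proof. by move=> fg; congr avgP; apply/funext. Qed.

(** The induction composes with the transposition of [g a] and [b], both of which lie in [D] and off
    the part already matched. *)
Lemma perm_extend D s t : uniq s -> uniq t -> size s = size t ->
  {subset s <= D} -> {subset t <= D} ->
  exists g : {perm T}, (forall a, a \notin D -> g a = a) /\ map g s = t.
Proof.
elim/last_ind: s t => [|s a IH] t.
  by case: t => // *; exists 1%g; split => // a _; rewrite perm1.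
case/lastP: t => [|t b]; first by rewrite size_rcons.
rewrite !rcons_uniq !size_rcons => /andP[as_ us] /andP[bt ut] [st] sD tD.
have sD' : {subset s <= D} by move=> x xs; apply: sD; rewrite mem_rcons inE xs orbT.
have tD' : {subset t <= D} by move=> x xs; apply: tD; rewrite mem_rcons inE xs orbT.
have [g [gD gs]] := IH t us ut st sD' tD'.
have aD : a \in D by apply: sD; rewrite mem_rcons mem_head.
have bD : b \in D by apply: tD; rewrite mem_rcons mem_head.
have gaD : g a \in D.
  apply/negPn/negP => h; have := gD _ h => /perm_inj e.
  by move: h; rewrite e aD.
exists (g * tperm (g a) b)%g; split=> [x xD|].
  rewrite permM (gD x xD) tpermD//.
    by apply: contraNneq xD => <-.
  by apply: contraNneq xD => <-.
rewrite map_rcons permM tpermL; congr rcons; rewrite -gs.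
apply/eq_in_map => x xs; rewrite permM tpermD//.
  by apply: contraNneq as_ => /perm_inj ->.
by apply: contraNneq bt => ->; rewrite -gs map_f.
Qed.

(** Left multiplication by [g] preserves the uniform law on matchings. The hypothesis on [F] says
    that relabelling the sockets of [D] changes nothing but the listed sockets. *)
Lemma exch D (F : {perm T} -> seq T -> R) s t :
  (forall (g pi : {perm T}) s, (forall a, a \notin D -> g a = a) -> F (g * pi)%g s = F pi (map g s)) ->
  uniq s -> uniq t -> size s = size t -> {subset s <= D} -> {subset t <= D} ->
  avgP (F^~ s) = avgP (F^~ t).
Proof.
move=> FE us ut st sD tD; have [g [gD gs]] := perm_extend us ut st sD tD.
rewrite /avgP; congr (_ * _); rewrite (reindex_inj (mulgI g))/=.
by apply: eq_bigr => pi _; rewrite FE// gs.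
Qed.

(** Average over [k] independent draws from [D], repetitions allowed. Repetitions make products
    factor ([nsum_prod]); [nsum_le] bounds what they cost. *)
Fixpoint nsum D k (h : seq T -> R) s : R :=
  if k is k'.+1 then (size D)%:R^-1 * \sum_(a <- D) nsum D k' h (rcons s a) else h s.

Lemma nsum_prod D k c (x : T -> R) s :
  nsum D k (fun s => c * \prod_(i <- s) x i) s =
  c * (\prod_(i <- s) x i) * ((size D)%:R^-1 * \sum_(a <- D) x a) ^+ k.
Proof.
elim: k s => [|k IH] s /=; first by rewrite expr0 mulr1.
rewrite (eq_bigr (fun a => (c * (\prod_(i <- s) x i) *
    ((size D)%:R^-1 * \sum_(a <- D) x a) ^+ k) * x a)).
  by rewrite -big_distrr/= exprS; ring.
by move=> a _; rewrite IH -cats1 big_cat big_seq1/=; ring.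
Qed.

Lemma nsum_avgP D k (h : {perm T} -> seq T -> R) s :
  avgP (fun pi => nsum D k (h pi) s) = nsum D k (fun s => avgP (h^~ s)) s.
Proof.
elim: k s => [|k IH] s //=; rewrite avgPZ avgP_sum; congr (_ * _).
by apply: eq_bigr => a _; apply: IH.
Qed.

Lemma nsum_EE (X : finType) L (w : X -> R) D k (h : (X -> R) -> seq T -> R) s :
  EE L w (fun w' => nsum D k (h w') s) = nsum D k (fun s => EE L w (h^~ s)) s.
Proof.
elim: k s => [|k IH] s //=; rewrite EE_Z EE_sum; congr (_ * _).
by apply: eq_bigr => a _; apply: IH.
Qed.

(* At most [n / size D] of the extensions of a sequence of length at most [n] repeat an entry. *)
Lemma nsum_le D (h : seq T -> R) hs (C : R) n k s : uniq D ->
  (forall s, uniq s -> {subset s <= D} -> size s = n -> h s <= hs) ->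
  (forall s, h s <= C) -> 0 <= hs -> 0 <= C -> (size D > 0)%N ->
  uniq s -> {subset s <= D} -> (size s + k)%N = n ->
  nsum D k h s <= hs + C * (k%:R * n%:R / (size D)%:R).
Proof.
move=> uD hu hC hs0 C0 D0.
have m0 : 0 < (size D)%:R :> R by rewrite ltr0n.
have Cb k' s' : nsum D k' h s' <= C.
  elim: k' s' => [|k' IH] s' //=; rewrite mulrC ler_pdivrMr// -sum1_size natr_sum big_distrr/=.
  by apply: ler_sum => a _; rewrite mulr1.
elim: k s => [|k IH] s us sD /=; rewrite ?addn0 ?mul0r ?mulr0 ?addr0 => sn; first exact: hu.
pose c := hs + C * (k%:R * n%:R / (size D)%:R).
have n0 : 0 <= n%:R / (size D)%:R :> R by rewrite divr_ge0.
apply: (@le_trans _ _ ((size D)%:R^-1 * \sum_(a <- D) (c + C * (a \in s)%:R))).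
  rewrite ler_pM2l ?invr_gt0// big_seq [leRHS]big_seq; apply: ler_sum => a aD.
  case: (boolP (a \in s)) => as_; last first.
    rewrite mulr0 addr0; apply: IH.
    - by rewrite rcons_uniq as_.
    - by move=> x; rewrite mem_rcons inE => /predU1P[->//|/sD].
    - by rewrite size_rcons addSnnS.
  rewrite mulr1; apply: le_trans (Cb _ _) _; rewrite lerDr.
  by rewrite addr_ge0// !mulr_ge0// invr_ge0.
rewrite big_split/= big_const_seq count_predT iter_addr_0 -big_distrr/=.
rewrite mulrDr -[c *+ _]mulr_natl mulrA mulVf ?gt_eqF// mul1r /c.
have hc : \sum_(a <- D) (a \in s)%:R <= n%:R :> R.
  rewrite -natr_sum ler_nat; apply: (@leq_trans (size s)); last by rewrite -sn leq_addr.
  have -> : (\sum_(a <- D) (a \in s) = size [seq a <- D | a \in s])%N.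
    by rewrite size_filter -sum1_count [RHS]big_mkcond; apply: eq_bigr => a _; case: (a \in s).
  apply: uniq_leq_size; first exact: filter_uniq.
  by move=> a; rewrite mem_filter => /andP[].
rewrite -addrA lerD2l -[k.+1%:R]natr1 mulrDl mul1r mulrDl mulrDr lerD2l.
by rewrite mulrCA ler_wpM2l// mulrC ler_pM2r ?invr_gt0.
Qed.

End Exchangeability.

Lemma tele_bound (R : realType) (I : Type) (F : seq I -> I -> R) c pre0 rest :
  (forall pre i r, pre0 ++ rest = pre ++ i :: r -> F pre i <= c) ->
  tele F pre0 rest <= (size rest)%:R * c.
Proof.
elim: rest pre0 => [|i r IH] pre0 h /=; first by rewrite mul0r.
rewrite -natr1 mulrDl mul1r addrC lerD//; first by apply: IH => pre j r' e; apply: (h _ _ r'); rewrite -e cat_rcons.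
exact: (h _ _ r).
Qed.

Lemma tele_EE (R : realType) (X : finType) (I : Type) L (w : X -> R)
    (F : (X -> R) -> seq I -> I -> R) pre rest :
  EE L w (fun w' => tele (F w') pre rest) =
  tele (fun p i => EE L w (fun w' => F w' p i)) pre rest.
Proof.
elim: rest pre => [|i r IH] pre /=; last by rewrite EE_D IH.
by rewrite -[RHS](mul0r (EE L w (fun=> 0))) -EE_Z; apply: eq_EE => w'; rewrite mul0r.
Qed.

Lemma tele_avgP (R : realType) (T : finType) (I : Type)
    (F : {perm T} -> seq I -> I -> R) pre rest :
  avgP (fun pi => tele (F pi) pre rest) =
  tele (fun p i => avgP (fun pi => F pi p i)) pre rest.
Proof.
elim: rest pre => [|i r IH] pre /=; last by rewrite avgPD IH.
exact: avgP_cst.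
Qed.

(** The core of pinning: a sequence confined to [0, 1] cannot keep growing. Its increments over a
    shift [j] total at most [j] however large [n] is, so after division by [n] they are
    negligible. *)
Lemma sum_shift_le (R : realType) (M : nat -> R) n j : (forall k, 0 <= M k <= 1) ->
  \sum_(l < n) (M (l + j)%N - M l) <= j%:R.
Proof.
move=> M01; elim: j => [|j IH].
  by rewrite big1// => l _; rewrite addn0 subrr.
rewrite -natr1 (eq_bigr (fun l : 'I_n => (M (l + j)%N - M l) + (M (l.+1 + j)%N - M (l + j)%N))).
  rewrite big_split/= lerD//.
  rewrite -(big_mkord xpredT (fun l => M (l.+1 + j)%N - M (l + j)%N)).
  rewrite (telescope_sumr (fun l => M (l + j)%N))//.
  by have /andP[] := M01 (n + j)%N; have /andP[] := M01 (0 + j)%N; lra.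
by move=> l _; rewrite addnS addSn; ring.
Qed.

(** * The interpolation path, averaged over the matching and over the number of pins *)

Section Path.
Variables (R : realType) (X T C : finType) (chi : T -> X -> R) (chk : T -> C).
Variables (lw : C -> law R) (chan : seq (law R * (X -> R))) (w0 : X -> R) (pool : seq T).
Hypothesis chi_spin : forall a, spin (chi a).
Hypothesis lw_law : forall c, is_law (lw c).
Hypothesis chan_valid : valid chan.
Hypothesis w0_nneg : nneg w0.
Hypothesis w0_mass : mass w0 = 1.
Hypothesis uniq_pool : uniq pool.
Implicit Types (pi : {perm T}) (hs ss : seq C) (c : C).

(** In this section [pi] leads from check sockets to variable sockets, so [cp pi a] is the spin seen
    at check socket [a]. *)
Definition cp pi a := chi (pi a).
Definition blk c := [seq a <- enum T | chk a == c].
Definition hardc pi c : law R * (X -> R) := (hard R, pchi (cp pi) (blk c)).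
Definition softc pi c := Ss (cp pi) (lw c) (blk c).
Definition base pi hs ss := chan ++ map (hardc pi) hs ++ flatten (map (softc pi) ss).

Lemma cp_spin pi a : spin (cp pi a). Proof. exact: chi_spin. Qed.

Lemma uniq_blk c : uniq (blk c). Proof. exact/filter_uniq/enum_uniq. Qed.

Lemma mem_blk c a : (a \in blk c) = (chk a == c).
Proof. by rewrite mem_filter mem_enum andbT. Qed.

Lemma valid_base pi hs ss : valid (base pi hs ss).
Proof.
apply: valid_cat => //; apply: valid_cat.
  apply: valid_map => c _; split; first exact: is_law_hard.
  exact/spin_pchi/cp_spin.
elim: ss => [|c ss IH] //=; apply: valid_cat => //.
by apply: valid_Ss => //; exact: cp_spin.
Qed.

Lemma cp_fix (D : seq T) (g pi : {perm T}) a :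
  (forall a, a \notin D -> g a = a) -> a \notin D -> cp (g * pi)%g a = cp pi a.
Proof. by move=> gD aD; rewrite /cp permM gD. Qed.

(** Observations on checks without sockets in [D] do not notice a relabelling of [D]. This provides
    the invariance asked for by [exch]. *)
Lemma base_fix (D : seq T) (g pi : {perm T}) hs ss :
  (forall a, a \notin D -> g a = a) ->
  (forall a, a \in D -> chk a \notin hs ++ ss) ->
  base (g * pi)%g hs ss = base pi hs ss.
Proof.
move=> gD hD; rewrite /base.
have h c a : c \in hs ++ ss -> a \in blk c -> cp (g * pi)%g a = cp pi a.
  move=> chs; rewrite mem_blk => /eqP ac; apply: (cp_fix _ gD).
  by apply/negP => /hD; rewrite ac chs.
congr (_ ++ _ ++ _).
  apply/eq_in_map => c chs; rewrite /hardc; congr pair.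
  apply/funext => x; rewrite /pchi big_seq [RHS]big_seq; apply: eq_bigr => a ab.
  by rewrite (h c)// mem_cat chs.
congr flatten; apply/eq_in_map => c css; apply/eq_in_map => a ab.
by rewrite (h c)// mem_cat css orbT.
Qed.

Lemma Hs_fix (g pi : {perm T}) s : Hs (cp (g * pi)%g) s = Hs (cp pi) (map g s).
Proof. by rewrite /Hs -map_comp; apply: eq_map => a; rewrite /cp/= permM. Qed.

Definition potential hs ss l :=
  avgP (fun pi => EE (base pi hs ss ++ Hs (cp pi) (take l pool)) w0 PhiF).

Section OneStep.
Variables (hs ss : seq C) (c : C).
Hypothesis c_hs : c \notin hs.
Hypothesis c_ss : c \notin ss.
Hypothesis pool_free : forall a, a \in pool -> chk a \notin hs ++ c :: ss.

(** Sockets that [base pi hs ss] leaves untouched: those available for pins and those of the check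
    being swapped. Within [D] all sockets are exchangeable. *)
Let D := pool ++ blk c.

Lemma D_free a : a \in D -> chk a \notin hs ++ ss.
Proof.
rewrite mem_cat => /orP[/pool_free|].
  by rewrite !mem_cat inE !negb_or => /andP[-> /andP[_ ->]].
by rewrite mem_blk => /eqP ->; rewrite mem_cat negb_or c_hs.
Qed.

Lemma uniq_D : uniq D.
Proof.
rewrite cat_uniq uniq_pool uniq_blk andbT/=; apply/hasPn => a.
rewrite mem_blk => /eqP ac; apply/negP => /pool_free.
by rewrite ac mem_cat inE eqxx orbT.
Qed.

(** The head is the spin whose moment is taken and the tail lists the pins, so that a single list
    carries the whole exchangeable pattern. By [momFE] its average depends on the length only, which
    defines [momM]. *)
Definition momF q pi s :=
  if s is b :: pins then EE (base pi hs ss ++ Hs (cp pi) pins) w0 (mom q (cp pi b)) else 0.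

Definition momM q n := avgP (fun pi => momF q pi (take n.+1 D)).

Lemma valid_B pi pins : valid (base pi hs ss ++ Hs (cp pi) pins).
Proof. by apply: valid_cat; [exact: valid_base|apply: valid_Hs => ?; exact: cp_spin]. Qed.

Lemma momF_bound q pi s : 0 <= momF q pi s <= 1.
Proof.
case: s => [|b pins] /=; first by rewrite lexx ler01.
have vB := valid_B pi pins.
apply/andP; split; last first.
  rewrite -[leRHS]w0_mass -(EE_mass w0 vB).
  by apply: EE_le => // w' w'0; apply: mom_le_mass => //; exact: cp_spin.
apply: le_trans (EE_ge vB _ w0_nneg); last exact/sublin_mom/cp_spin.
exact: ge0_mom.
Qed.

Lemma momM_bound q n : 0 <= momM q n <= 1.
Proof.
apply/andP; split.
  rewrite -[leLHS](avgP_cst T); apply: avgP_le => pi.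
  by have /andP[] := momF_bound q pi (take n.+1 D).
rewrite -[leRHS](avgP_cst T); apply: avgP_le => pi.
by have /andP[] := momF_bound q pi (take n.+1 D).
Qed.

Lemma momFE q s : uniq s -> {subset s <= D} -> (0 < size s)%N ->
  avgP (fun pi => momF q pi s) = momM q (size s).-1.
Proof.
move=> us sD s0; rewrite /momM prednK//.
have sz : (size s <= size D)%N by apply: uniq_leq_size.
apply: (@exch _ _ D (fun pi s => momF q pi s)) => //.
- move=> g pi [|b pins] gD //=; rewrite (base_fix _ gD) ?Hs_fix//; last exact: D_free.
  by congr (EE _ _ (mom _ _)); rewrite /cp permM.
- exact/take_uniq/uniq_D.
- by rewrite size_takel.
- by move=> a /mem_take.
Qed.

Local Notation J l := (take l pool).
Local Notation B l := (fun pi => base pi hs ss ++ Hs (cp pi) (J l)).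

Lemma uniq_Jblk l s : uniq s -> {subset s <= blk c} -> uniq (J l ++ s) /\ {subset J l ++ s <= D}.
Proof.
move=> us sb; split; last first.
  by move=> a; rewrite !mem_cat => /orP[/mem_take ->//|/sb ->]; rewrite orbT.
rewrite cat_uniq take_uniq// us andbT/=; apply/hasPn => a /sb ab.
apply/negP => /mem_take aP; have := uniq_D; rewrite cat_uniq => /and3P[_ /hasPn/(_ a ab)].
by rewrite aP.
Qed.

Lemma avg_delta q l pre i r : (l <= size pool)%N -> blk c = pre ++ i :: r ->
  avgP (fun pi => EE (B l pi) w0 (delta (cp pi) q pre i)) = momM q (l + size pre) - momM q l.
Proof.
move=> lp e.
have ub : uniq (pre ++ [:: i]).
  by have := uniq_blk c; rewrite e -cat1s catA cat_uniq => /and3P[].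
have sb : {subset pre ++ [:: i] <= blk c}.
  by move=> a; rewrite e -[i :: r]cat1s catA [in X in _ -> X]mem_cat => ->.
have perm_cons_cat (s : seq T) : perm_eq (i :: s) (s ++ [:: i]) by rewrite perm_sym cats1 perm_rcons.
have mF s : uniq (s ++ [:: i]) -> {subset s ++ [:: i] <= D} ->
    avgP (fun pi => momF q pi (i :: s)) = momM q (size s).
  move=> us sD; apply: momFE => //; first by rewrite (perm_uniq (perm_cons_cat s)).
  by move=> a; rewrite (perm_mem (perm_cons_cat s)); apply: sD.
have [u1 s1] := uniq_Jblk l ub sb.
have [u2 s2] : uniq (J l ++ [:: i]) /\ {subset J l ++ [:: i] <= D}.
  apply: uniq_Jblk => // a; rewrite inE => /eqP ->.
  by apply: sb; rewrite mem_cat inE eqxx orbT.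
have szJ : size (J l) = l by rewrite size_takel.
transitivity (avgP (fun pi => momF q pi (i :: (J l ++ pre)) - momF q pi (i :: J l))).
  apply: eq_avgP => pi; rewrite /delta EE_B /=; congr (_ - _).
  by rewrite /Hs map_cat catA [in RHS]EE_cat.
rewrite avgPB !mF//; last by rewrite -catA.
- by rewrite size_cat szJ.
- by rewrite -catA.
Qed.

Lemma avg_mom q l i : (l <= size pool)%N -> i \in drop l pool ++ blk c ->
  avgP (fun pi => EE (B l pi) w0 (mom q (cp pi i))) = momM q l.
Proof.
move=> lp iD; rewrite -[X in momM q X](_ : (size (i :: J l)).-1 = l); last by rewrite /= size_takel.
apply: (momFE q (s := i :: J l)) => //=.
  rewrite take_uniq// andbT; apply/negP => iJ.
  move: iD; rewrite mem_cat => /orP[iD|ib].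
    have := uniq_pool; rewrite -(cat_take_drop l pool) cat_uniq => /and3P[_ /hasPn/(_ _ iD)].
    by rewrite iJ.
  have := uniq_D; rewrite cat_uniq => /and3P[_ /hasPn/(_ _ ib)].
  by rewrite (mem_take iJ).
move=> a; rewrite inE mem_cat => /predU1P[->|/mem_take ->//].
by move: iD; rewrite mem_cat => /orP[/mem_drop ->//|->]; rewrite orbT.
Qed.

(** By [avg_delta] every [delta] is a shifted increment of one sequence [momM q], so over the [n]
    pinning levels it totals at most the degree of [c]. Only the terms with [d] and [e] scale with
    [n]. *)
Lemma avg_err K (d e : R) n pre i r : (n <= size pool)%N -> 0 < d -> 0 <= e ->
  blk c = pre ++ i :: r ->
  \sum_(l < n) avgP (fun pi => EE (B l pi) w0 (err (cp pi) K d e pre i)) <=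
  glip R K * (d * n%:R + d^-1 * (size (blk c))%:R)
  + (\sum_(q < K) gcoef R q) * (size (blk c))%:R + e * n%:R.
Proof.
move=> np d0 e0 eb.
pose S q := \sum_(l < n) (momM q (l + size pre) - momM q l).
have Sle q : S q <= (size (blk c))%:R.
  apply: (le_trans (sum_shift_le _ _ (momM_bound q))).
  by rewrite ler_nat eb size_cat leq_addr.
have -> : \sum_(l < n) avgP (fun pi => EE (B l pi) w0 (err (cp pi) K d e pre i)) =
  glip R K * (d * n%:R + d^-1 * S 0) + \sum_(q < K) gcoef R q * S q + e * n%:R.
  have term (l : 'I_n) : avgP (fun pi => EE (B l pi) w0 (err (cp pi) K d e pre i)) =
      glip R K * (d + d^-1 * (momM 0 (l + size pre) - momM 0 l)) +
      \sum_(q < K) gcoef R q * (momM q (l + size pre) - momM q l) + e.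
    have lp : (l <= size pool)%N by apply: leq_trans np; apply: ltnW.
    rewrite -(avg_delta 0 lp eb).
    under [in RHS]eq_bigr do rewrite -(avg_delta _ lp eb).
    rewrite -(big_mkord xpredT (fun q => gcoef R q * avgP (fun pi => EE (B l pi) w0 (delta (cp pi) q pre i)))).
    transitivity (avgP (fun pi => glip R K * (d + d^-1 * EE (B l pi) w0 (delta (cp pi) 0 pre i)) +
       \sum_(0 <= q < K) gcoef R q * EE (B l pi) w0 (delta (cp pi) q pre i) + e)).
      apply: eq_avgP => pi; have vB := valid_B pi (J l).
      have gen (f : nat -> (X -> R) -> R) : EE (B l pi) w0 (fun w =>
          glip R K * (d * mass w + d^-1 * f 0%N w) + \sum_(q < K) gcoef R q * f q w + e * mass w) =
          glip R K * (d + d^-1 * EE (B l pi) w0 (f 0%N)) +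
          \sum_(0 <= q < K) gcoef R q * EE (B l pi) w0 (f q) + e.
        under eq_EE do rewrite -(big_mkord xpredT (fun q => gcoef R q * f q _)).
        rewrite !EE_D !EE_Z EE_D !EE_Z EE_mass// EE_sum w0_mass !mulr1.
        by congr (_ + _ + _); apply: eq_bigr => q _; rewrite EE_Z.
      exact: (gen (fun q => delta (cp pi) q pre i)).
    rewrite !avgPD avgPZ avgPD avgPZ !avgP_cst avgP_sum; congr (_ + _ + _).
    by apply: eq_bigr => q _; rewrite avgPZ.
  rewrite (eq_bigr _ (fun l _ => term l)) !big_split/= sumr_const card_ord -[e *+ n]mulr_natr.
  congr (_ + _ + _).
    by rewrite -big_distrr/= big_split/= sumr_const card_ord -[d *+ n]mulr_natr -big_distrr.
  by rewrite exchange_big/=; apply: eq_bigr => q _; rewrite -big_distrr.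
rewrite lerD2r lerD//.
  by rewrite ler_wpM2l ?ge0_glip// lerD2l ler_pM2l ?invr_gt0.
rewrite big_distrl/=; apply: ler_sum => q _.
by rewrite ler_wpM2l ?ge0_gcoef.
Qed.

(** The sockets of [c] are exchangeable with the unpinned pool sockets. They may thus be replaced by
    draws with replacement from [D'], at a collision cost of k^2 over the size of [D']. For each
    weight the product then becomes the k-th power of one nonnegative overlap [qb], to which
    [tangent_exp] at [v] applies. *)
Lemma avg_momprod q l (v : R) : (l < size pool)%N -> 0 <= v ->
  (1 - (size (blk c))%:R) * v ^+ size (blk c) - (size (blk c))%:R ^+ 2 / (size pool - l)%:R
  <= avgP (fun pi => EE (B l pi) w0 (fun w => momprod (cp pi) q (blk c) w -
        v ^+ (size (blk c)).-1 * \sum_(i <- blk c) mom q (cp pi i) w)).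
Proof.
move=> lp v0; set k := size (blk c).
have lp' : (l <= size pool)%N by apply: ltnW.
pose D' := drop l pool ++ blk c.
have uD' : uniq D'.
  have := uniq_D; rewrite /D -{1}(cat_take_drop l pool) -catA cat_uniq => /and3P[_ _].
  by [].
have sD' : (size pool - l <= size D')%N by rewrite size_cat size_drop leq_addr.
have D'0 : (0 < size D')%N by apply: leq_trans sD'; rewrite subn_gt0.
have m0 : 0 < (size D')%:R :> R by rewrite ltr0n.
pose F pi s := EE (B l pi) w0 (momprod (cp pi) q s).
pose h s := avgP (F^~ s).
have mp01 pi s w : nneg w -> 0 <= momprod (cp pi) q s w <= mass w.
  move=> w'0; rewrite mulr_ge0 ?ge0_mass//=; last first.
    by apply: prodr_ge0 => i _; rewrite ge0_exp_even.
  rewrite ler_piMr ?ge0_mass//; apply: prodr_ile1 => i _.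
  by rewrite ge0_exp_even exp_even_le1// mean_bound//; exact: cp_spin.
have F01 pi s : 0 <= F pi s <= 1.
  have vB := valid_B pi (J l).
  rewrite /F; apply/andP; split; last first.
    rewrite -[leRHS]w0_mass -(EE_mass w0 vB).
    by apply: EE_le => // w' w'0; have /andP[] := mp01 pi s w' w'0.
  rewrite -[leLHS](_ : EE (B l pi) w0 (fun w => 0 * mass w) = 0); last by rewrite EE_Z mul0r.
  by apply: EE_le => // w' w'0; rewrite mul0r; have /andP[] := mp01 pi s w' w'0.
have h01 s : 0 <= h s <= 1.
  apply/andP; split.
    by rewrite -[leLHS](avgP_cst T); apply: avgP_le => pi; have /andP[] := F01 pi s.
  by rewrite -[leRHS](avgP_cst T); apply: avgP_le => pi; have /andP[] := F01 pi s.
have subD' : {subset blk c <= D'} by move=> a ab; rewrite mem_cat ab orbT.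
have hE s : uniq s -> {subset s <= D'} -> size s = k -> h s <= h (blk c).
  move=> us sD sk; rewrite /h (@exch _ _ D' F s (blk c))//; last exact: uniq_blk.
  move=> g pi s' gD; rewrite /F (base_fix _ gD); last first.
    by move=> a; rewrite mem_cat => /orP[/mem_drop aP|ab]; apply: D_free; rewrite mem_cat ?aP ?ab ?orbT.
  rewrite Hs_fix; have -> : map g (J l) = J l.
    rewrite -[RHS]map_id; apply/eq_in_map => a aJ; apply: gD.
    apply/negP; rewrite mem_cat => /orP[aD|ab].
      have := uniq_pool; rewrite -(cat_take_drop l pool) cat_uniq => /and3P[_ /hasPn/(_ _ aD)].
      by rewrite aJ.
    have := uniq_D; rewrite cat_uniq => /and3P[_ /hasPn/(_ _ ab)].
    by rewrite (mem_take aJ).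
  congr EE; apply/funext => w; rewrite /momprod big_map; congr (_ * _).
  by apply: eq_bigr => a _; rewrite /cp permM.
have := @nsum_le R T D' h (h (blk c)) 1 k k [::] uD' hE (fun s => (andP (h01 s)).2)
  (andP (h01 _)).1 ler01 D'0 erefl (fun _ => _) erefl.
rewrite mul1r => /(_ _) nle.
have {nle} nle : nsum D' k h [::] <= h (blk c) + k%:R * k%:R / (size D')%:R by apply: nle.
pose qb pi w := (size D')%:R^-1 * \sum_(a <- D') mean (cp pi a) w ^+ q.+1.*2.
have nE : nsum D' k h [::] = avgP (fun pi => EE (B l pi) w0 (fun w => mass w * qb pi w ^+ k)).
  rewrite /h -nsum_avgP; apply: eq_avgP => pi; rewrite /F -nsum_EE; apply: eq_EE => w.
  by rewrite /momprod nsum_prod big_nil mulr1.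
have sumE : avgP (fun pi => EE (B l pi) w0 (fun w => \sum_(i <- blk c) mom q (cp pi i) w)) =
   k%:R * avgP (fun pi => EE (B l pi) w0 (fun w => mass w * qb pi w)).
  have -> : avgP (fun pi => EE (B l pi) w0 (fun w => \sum_(i <- blk c) mom q (cp pi i) w)) =
      k%:R * momM q l.
    transitivity (\sum_(i <- blk c) avgP (fun pi => EE (B l pi) w0 (mom q (cp pi i)))).
      by rewrite -avgP_sum; apply: eq_avgP => pi; rewrite EE_sum.
    rewrite big_seq (eq_bigr (fun=> momM q l)).
      by rewrite -big_seq big_const_seq count_predT iter_addr_0; exact/esym/mulr_natl.
    by move=> i ib; apply: avg_mom => //; apply: subD'.
  congr (_ * _).
  transitivity ((size D')%:R^-1 * \sum_(a <- D') avgP (fun pi => EE (B l pi) w0 (mom q (cp pi a)))).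
    rewrite big_seq (eq_bigr (fun=> momM q l)); last by move=> i ib; apply: avg_mom.
    rewrite -big_seq big_const_seq count_predT iter_addr_0 -[momM q l *+ _]mulr_natl mulrA mulVf ?mul1r//.
    by rewrite gt_eqF.
  rewrite -avgP_sum -avgPZ; apply: eq_avgP => pi.
  rewrite -EE_sum -EE_Z; apply: eq_EE => w.
  by rewrite /qb mulrCA [in RHS]big_distrr.
have -> : avgP (fun pi => EE (B l pi) w0 (fun w => momprod (cp pi) q (blk c) w -
        v ^+ k.-1 * \sum_(i <- blk c) mom q (cp pi i) w)) =
   h (blk c) - v ^+ k.-1 * (k%:R * avgP (fun pi => EE (B l pi) w0 (fun w => mass w * qb pi w))).
  rewrite -sumE /h -avgPZ -avgPB; apply: eq_avgP => pi.
  by rewrite EE_B EE_Z.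
have tang : (1 - k%:R) * v ^+ k <= nsum D' k h [::] -
   v ^+ k.-1 * (k%:R * avgP (fun pi => EE (B l pi) w0 (fun w => mass w * qb pi w))).
  rewrite nE -!avgPZ -avgPB -[leLHS](avgP_cst T); apply: avgP_le => pi.
  have vB := valid_B pi (J l).
  rewrite -!EE_Z -EE_B -[leLHS]mulr1 -[X in _ * X <= _]w0_mass -(EE_mass w0 vB) -EE_Z; apply: EE_le => // w w'0.
  have qb0 : 0 <= qb pi w.
    by rewrite mulr_ge0 ?invr_ge0// sumr_ge0// => a _; rewrite ge0_exp_even.
  have := ler_wpM2l (ge0_mass w'0) (tangent_exp k qb0 v0).
  lra.
have : k%:R * k%:R / (size D')%:R <= k%:R ^+ 2 / (size pool - l)%:R :> R.
  rewrite -expr2 ler_wpM2l ?sqr_ge0// lef_pV2 ?posrE// ?ltr0n ?subn_gt0//.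
  by rewrite ler_nat.
lra.
Qed.

End OneStep.

Lemma EE_mid A S B (w : X -> R) Psi :
  EE (A ++ S ++ B) w Psi = EE (A ++ B) w (fun w => EE S w Psi).
Proof.
rewrite !EE_cat; apply: eq_EE => w'.
by rewrite -EE_cat EE_catC EE_cat.
Qed.

Lemma sum_gcoef_le1 K : \sum_(q < K) gcoef R q <= 1.
Proof.
have -> : \sum_(q < K) gcoef R q = gpoly K 1.
  by apply: eq_bigr => q _; rewrite expr1n mulr1.
apply: le_trans (gpoly_le_gfun K _) _; first by lra.
by rewrite gfun1 ln2_le1.
Qed.

(** Collision cost at each of the [n] pinning levels, plus the total of [avg_err] for each of the
    [k] sockets. *)
Definition step_err K (d e : R) n k : R :=
  n%:R * (k%:R ^+ 2 / (size pool - n)%:R) +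
  k%:R * (glip R K * (d * n%:R + d^-1 * k%:R) + k%:R + e * n%:R).

(** [v q] stands for an even moment of the trial law. The hypothesis on [lmom] gives the soft
    observations at a check of degree k the moments of a product of k-1 trial values, which is
    precisely the slope of x^k at [v q] up to the factor k. *)
Lemma one_step K (d e : R) n (v : nat -> R) hs ss c :
  c \notin hs -> c \notin ss -> (forall a, a \in pool -> chk a \notin hs ++ c :: ss) ->
  0 < d -> 0 <= e -> (n < size pool)%N -> (forall q, 0 <= v q) ->
  (forall q, lmom (lw c) q = v q ^+ (size (blk c)).-1) ->
  (forall x : R, -1 <= x <= 1 -> gfun x <= gpoly K x + e) ->
  \sum_(l < n) potential hs (c :: ss) l
   + n%:R * (\sum_(q < K) gcoef R q * ((1 - (size (blk c))%:R) * v q ^+ size (blk c)))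
   - step_err K d e n (size (blk c))
  <= \sum_(l < n) potential (c :: hs) ss l.
Proof.
move=> chs css hp d0 e0 np v0 lv ge; set k := size (blk c).
pose B (l : nat) pi := base pi hs ss ++ Hs (cp pi) (take l pool).
have hardE pi l : EE (base pi (c :: hs) ss ++ Hs (cp pi) (take l pool)) w0 PhiF =
    EE (B l pi) w0 (fun w => EE [:: hardc pi c] w PhiF).
  have -> : base pi (c :: hs) ss ++ Hs (cp pi) (take l pool) =
     chan ++ [:: hardc pi c] ++ (map (hardc pi) hs ++ flatten (map (softc pi) ss) ++ Hs (cp pi) (take l pool)).
    by rewrite /base /= -!catA /= -!catA.
  by rewrite EE_mid /B /base -!catA.
have softE pi l : EE (base pi hs (c :: ss) ++ Hs (cp pi) (take l pool)) w0 PhiF =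
    EE (B l pi) w0 (fun w => EE (softc pi c) w PhiF).
  have -> : base pi hs (c :: ss) ++ Hs (cp pi) (take l pool) =
     (chan ++ map (hardc pi) hs) ++ softc pi c ++ (flatten (map (softc pi) ss) ++ Hs (cp pi) (take l pool)).
    by rewrite /base /= -!catA /= -?catA.
  by rewrite EE_mid /B /base -!catA.
have vB pi l : valid (B l pi).
  by apply: valid_cat; [exact: valid_base|apply: valid_Hs => ?; exact: cp_spin].
have stepl (l : 'I_n) : potential hs (c :: ss) l
   + \sum_(q < K) gcoef R q * ((1 - k%:R) * v q ^+ k)
   - (k%:R ^+ 2 / (size pool - n)%:R)
   - tele (fun pre i => avgP (fun pi => EE (B l pi) w0 (err (cp pi) K d e pre i))) [::] (blk c)
   <= potential (c :: hs) ss l.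
  have lp : (l < size pool)%N by apply: leq_trans np; apply: ltnW; rewrite ltnS ltn_ord.
  have lpn : (l <= n)%N by apply: ltnW.
  rewrite /potential (eq_avgP (fun pi => softE pi l)) (eq_avgP (fun pi => hardE pi l)).
  rewrite -(tele_avgP (fun pi pre i => EE (B l pi) w0 (err (cp pi) K d e pre i))).
  pose mp pi q w := momprod (cp pi) q (blk c) w - lmom (lw c) q * \sum_(i <- blk c) mom q (cp pi i) w.
  have main pi : EE (B l pi) w0 (fun w => EE (softc pi c) w PhiF)
      + \sum_(q < K) gcoef R q * EE (B l pi) w0 (mp pi q)
      - tele (fun pre i => EE (B l pi) w0 (err (cp pi) K d e pre i)) [::] (blk c)
      <= EE (B l pi) w0 (fun w => EE [:: hardc pi c] w PhiF).
    have h0 : EE (B l pi) w0 (fun w => EE (softc pi c) w PhiF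
        + \sum_(q < K) gcoef R q * mp pi q w
        - tele (fun pre i => err (cp pi) K d e pre i w) [::] (blk c)) <=
        EE (B l pi) w0 (fun w => EE [:: hardc pi c] w PhiF).
      apply: EE_le => // w w'0.
      exact: (check_vs_fields (cp_spin pi) (blk c) (lw_law c) d0 w'0 ge).
    by move: h0; rewrite EE_B EE_D tele_EE EE_lincomb.
  have := avgP_le main; rewrite avgPB avgPD avgP_sum => h; apply: le_trans h.
  rewrite lerD2r -addrA lerD2l lerBlDr.
  have h q : (1 - k%:R) * v q ^+ k <= avgP (fun pi => EE (B l pi) w0 (mp pi q)) + k%:R ^+ 2 / (size pool - n)%:R.
    rewrite -lerBlDr; have := avg_momprod chs css hp q lp (v0 q).
    rewrite -/k /mp lv => h; apply: le_trans h; rewrite lerD2l lerN2.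
    by rewrite ler_wpM2l ?sqr_ge0// lef_pV2 ?posrE ?ltr0n ?subn_gt0// ler_nat leq_sub2l.
  apply: (@le_trans _ _ (\sum_(q < K) gcoef R q * avgP (fun pi => EE (B l pi) w0 (mp pi q)) +
     (\sum_(q < K) gcoef R q) * (k%:R ^+ 2 / (size pool - n)%:R))).
    rewrite big_distrl -big_split/=; apply: ler_sum => q _.
    by rewrite -mulrDr ler_wpM2l ?ge0_gcoef// h.
  apply: lerD; first by apply: ler_sum => q _; rewrite avgPZ.
  by rewrite ler_piMl ?sum_gcoef_le1// divr_ge0 ?sqr_ge0.
apply: le_trans; last by apply: ler_sum => l _; exact: stepl.
rewrite !sumrB big_split/=.
have nE (x : R) : x *+ n = n%:R * x by exact/esym/mulr_natl.
rewrite !sumr_const card_ord (nE (\sum_(q < K) _)) (nE (k%:R ^+ 2 / _)).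
rewrite -!addrA lerD2l lerD2l /step_err -/k -opprD lerN2 lerD2l.
rewrite -(big_mkord xpredT (fun l => tele (fun pre i => avgP (fun pi => EE (B l pi) w0 (err (cp pi) K d e pre i))) [::] (blk c))).
rewrite -tele_sum; apply: tele_bound => pre i r e1.
rewrite big_mkord; apply: le_trans (avg_err chs css hp K (ltnW np) d0 e0 e1) _.
by rewrite -/k lerD2r lerD2l ler_piMl ?sum_gcoef_le1.
Qed.

(** [catrev] records the order in which the induction stacks the swapped checks. The disjunction
    covers graphs without a check to swap, where the pool may be empty. *)
Lemma path_steps K (d e : R) n (v : nat -> R) hs ss :
  uniq (hs ++ ss) -> (ss = [::] \/ (n < size pool)%N) ->
  (forall a, a \in pool -> chk a \notin hs ++ ss) ->
  0 < d -> 0 <= e -> (forall q, 0 <= v q) ->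
  (forall c q, lmom (lw c) q = v q ^+ (size (blk c)).-1) ->
  (forall x : R, -1 <= x <= 1 -> gfun x <= gpoly K x + e) ->
  \sum_(l < n) potential hs ss l
   + \sum_(c <- ss) (n%:R * (\sum_(q < K) gcoef R q * ((1 - (size (blk c))%:R) * v q ^+ size (blk c)))
   - step_err K d e n (size (blk c)))
  <= \sum_(l < n) potential (catrev ss hs) [::] l.
Proof.
move=> + + + d0 e0 v0 lv ge; elim: ss hs => [|c ss IH] hs u np hp; first by rewrite big_nil addr0.
have {}np : (n < size pool)%N by case: np.
have p : perm_eq (hs ++ c :: ss) ((c :: hs) ++ ss) by rewrite perm_catC perm_cons perm_catC.
have := u; rewrite (perm_uniq p) => u'.
have /IH/= IHc : uniq ((c :: hs) ++ ss) by [].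
have h1 := one_step (K := K) (d := d) (e := e) (n := n) (v := v) (hs := hs) (ss := ss) (c := c).
rewrite big_cons /= addrA.
apply: le_trans (IHc _ _) => //; last 2 first.
- by right.
- by move=> a /hp; rewrite (perm_mem p).
rewrite lerD2r addrA; apply: h1 => //.
- by move: u'; rewrite /= mem_cat negb_or => /andP[/andP[]].
- by move: u'; rewrite /= mem_cat negb_or => /andP[/andP[]].
Qed.

End Path.

(** * Products and mixtures of laws *)

Section Product_laws.
Variable R : realType.
Implicit Types (l tl : law R).

Definition mulL l l' : law R := [seq (m.1 * m'.1, m.2 * m'.2) | m <- l, m' <- l'].

Fixpoint pw tl k : law R := if k is k'.+1 then mulL tl (pw tl k') else hard R.

Lemma lawE_mulL l l' f : lawE (mulL l l') f = lawE l (fun u => lawE l' (fun v => f (u * v))).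
Proof.
rewrite /lawE /mulL big_allpairs_dep; apply: eq_bigr => m _.
by rewrite big_distrr; apply: eq_bigr => m' _ /=; rewrite mulrA.
Qed.

Lemma is_law_mulL l l' : is_law l -> is_law l' -> is_law (mulL l l').
Proof.
move=> [hl l1] [hl' l1']; split; last first.
  by rewrite lawE_mulL l1' l1.
move=> _ /allpairsP[[m m'] /= [/hl[? ?] /hl'[? ?] ->]] /=; split; first exact: mulr_ge0.
by rewrite -ler_norml normrM mulr_ile1// ler_norml.
Qed.

Lemma is_law_pw tl k : is_law tl -> is_law (pw tl k).
Proof. by move=> h; elim: k => [|k IH]; [exact: is_law_hard|exact: is_law_mulL]. Qed.

Lemma lmom_pw tl k q : lmom (pw tl k) q = lmom tl q ^+ k.
Proof.
elim: k => [|k IH]; first by rewrite /lmom lawE_hard expr1n expr0.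
rewrite /lmom /= lawE_mulL exprS -IH /lmom -lawEZr; apply: eq_lawE => u.
by rewrite -lawEZ; apply: eq_lawE => v; rewrite exprMn.
Qed.

Lemma lawE_gpoly l K : lawE l (gpoly K) = \sum_(q < K) gcoef R q * lmom l q.
Proof. by rewrite lawE_sum; apply: eq_bigr => q _; rewrite lawEZ. Qed.

Lemma lawE_gfun_bound l : is_law l -> 0 <= lawE l (@gfun R) <= ln 2.
Proof.
move=> hl; apply/andP; split; first by apply: ge0_lawE => // u u1; exact: ge0_gfun.
by rewrite -[leRHS](lawE_cst _ hl); apply: lawE_le => // u u1; exact: gfun_le_ln2.
Qed.

(** Return from the truncated series to [gfun]. For k >= 1 the factor 1 - k is nonpositive and
    [gpoly <= gfun] already has the right direction; the error [e] pays for k = 0. *)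
Lemma pw_gpoly_gfun tl K (e : R) k : is_law tl -> 0 <= e ->
  (forall x : R, -1 <= x <= 1 -> gfun x <= gpoly K x + e) ->
  (1 - k%:R) * lawE (pw tl k) (@gfun R) - e <=
  \sum_(q < K) gcoef R q * ((1 - k%:R) * lmom tl q ^+ k).
Proof.
move=> hl e0 ge.
have -> : \sum_(q < K) gcoef R q * ((1 - k%:R) * lmom tl q ^+ k) =
    (1 - k%:R) * lawE (pw tl k) (gpoly K).
  rewrite lawE_gpoly big_distrr; apply: eq_bigr => q _ /=.
  by rewrite lmom_pw mulrCA.
case: k => [|k].
  by rewrite subr0 !mul1r /= !lawE_hard; have := ge 1; lra.
have hp := is_law_pw k.+1 hl.
have : lawE (pw tl k.+1) (gpoly K) <= lawE (pw tl k.+1) (@gfun R).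
  by apply: lawE_le => // x x1; exact: gpoly_le_gfun.
have : 1 - k.+1%:R <= 0 :> R by rewrite subr_le0 ler1n.
nra.
Qed.

Definition mixL (I : Type) (s : seq (R * I)) (F : I -> law R) : law R :=
  flatten [seq [seq (a.1 * m.1, m.2) | m <- F a.2] | a <- s].

Lemma lawE_mixL (I : Type) (s : seq (R * I)) (F : I -> law R) f :
  lawE (mixL s F) f = \sum_(a <- s) a.1 * lawE (F a.2) f.
Proof.
rewrite /lawE /mixL big_flatten big_map; apply: eq_bigr => a _.
by rewrite big_map big_distrr; apply: eq_bigr => m _ /=; rewrite mulrA.
Qed.

Lemma is_law_mixL (I : eqType) (s : seq (R * I)) (F : I -> law R) :
  (forall a, a \in s -> 0 <= a.1 /\ is_law (F a.2)) -> \sum_(a <- s) a.1 = 1 ->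
  is_law (mixL s F).
Proof.
move=> h s1; split; last first.
  rewrite lawE_mixL -[RHS]s1 big_seq [RHS]big_seq; apply: eq_bigr => a /h[_ [_ ->]].
  by rewrite mulr1.
move=> m /flattenP[_ /mapP[a /h[a0 [hF _]] ->] /mapP[m' /hF[? ?] ->]] /=.
by split => //; rewrite mulr_ge0.
Qed.

End Product_laws.

(** * Single-bit observations factor over the bits *)

Section Factor.
Variables (R : realType) (n : nat).
Local Notation X := (n.-tuple bool).

Definition sgb (b : bool) : R := if b then -1 else 1.
Definition sg (i : 'I_n) (x : X) : R := sgb (tnth x i).

Lemma sgb_spin : spin sgb.
Proof. by case; rewrite /sgb; apply/andP; split; lra. Qed.

Lemma sg_spin i : spin (sg i). Proof. by move=> x; apply: sgb_spin. Qed.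

Lemma sum_tuple_prod (om : 'I_n -> bool -> R) :
  \sum_(x : X) \prod_i om i (tnth x i) = \prod_i (om i true + om i false).
Proof.
have -> : \prod_i (om i true + om i false) = \prod_i \sum_(b : bool) om i b.
  by apply: eq_bigr => i _; rewrite big_bool.
rewrite bigA_distr_bigA/= (reindex (fun f : {ffun 'I_n -> bool} => [tuple f i | i < n])) /=.
  by apply: eq_bigr => f _; apply: eq_bigr => i _; rewrite tnth_mktuple.
exists (fun x : X => [ffun i => tnth x i]) => [f _|x _].
  by apply/ffunP => i; rewrite ffunE tnth_mktuple.
by apply: eq_from_tnth => i; rewrite tnth_mktuple ffunE.
Qed.

Lemma mass_bool (om : bool -> R) : mass om = om true + om false.
Proof. by rewrite /mass big_bool. Qed.

Lemma eta_prod (I : finType) (r : seq I) (m : I -> R) : uniq r -> (forall i, 0 <= m i) ->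
  eta (\prod_(i <- r) m i) = \sum_(i <- r) (\prod_(j <- r | j != i) m j) * eta (m i).
Proof.
move=> + m0; elim: r => [|i r IH]; first by rewrite !big_nil eta1.
move=> /= /andP[ir ur]; rewrite !big_cons eqxx/= etaM//; last exact: prodr_ge0.
have neq j : j \in r -> j != i by apply: contraTneq => ->.
congr (_ * _ + _).
  by rewrite big_seq [RHS]big_seq_cond; apply: eq_bigl => j; case: (boolP (j \in r)) => // /neq ->.
rewrite IH// big_distrr big_seq [RHS]big_seq; apply: eq_bigr => j jr /=.
by rewrite big_cons eq_sym neq//= mulrA.
Qed.

Definition phi1 (ls : seq (law R)) : R := EE [seq (l, sgb) | l <- ls] (fun=> 2^-1) PhiF.

(** An observation of one bit keeps a product weight a product. x ln x of a product splits by the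
    Leibniz rule [eta_prod], and the changes of the other masses under [u] and [- u] average out, so
    each bit sees only its own observations. *)
Lemma EE_factor (s : seq (law R * 'I_n)) (om : 'I_n -> bool -> R) :
  (forall o, o \in s -> is_law o.1) -> (forall i, nneg (om i)) ->
  EE [seq (o.1, sg o.2) | o <- s] (fun x => \prod_i om i (tnth x i)) PhiF =
  \sum_i (\prod_(j | j != i) mass (om j)) *
    EE [seq (o.1, sgb) | o <- s & o.2 == i] (om i) PhiF.
Proof.
elim: s om => [|[l i0] s IH] om hl om0 /=.
  rewrite /PhiF {1}/mass sum_tuple_prod.
  under eq_bigr do rewrite -mass_bool.
  by rewrite eta_prod ?index_enum_uniq// => i; apply: ge0_mass.
have hl' : forall o, o \in s -> is_law o.1 by move=> o os; apply: hl; rewrite inE os orbT.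
have hl0 : is_law l by apply: (hl (l, i0)); rewrite mem_head.
pose om' u i := if i == i0 then upd (om i) sgb u else om i.
have updE u : upd (fun x : X => \prod_i om i (tnth x i)) (sg i0) u =
    (fun x : X => \prod_i om' u i (tnth x i)).
  apply/funext => x; rewrite /upd (bigD1 i0)//= [RHS](bigD1 i0)//= /om' eqxx /upd /sg.
  rewrite mulrAC; congr (_ * _); apply: eq_bigr => i /negPf ii0.
  by rewrite ii0.
have om'0 u : -1 <= u <= 1 -> forall i, nneg (om' u i).
  by move=> u1 i; rewrite /om'; case: eqP => // _; apply: upd_nneg => //; exact: sgb_spin.
pose E i w := EE [seq (o.1, sgb) | o <- s & o.2 == i] w PhiF.
pose Q i := \prod_(j | j != i) mass (om j).
have IHu u : -1 <= u <= 1 ->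
    EE [seq (o.1, sg o.2) | o <- s] (upd (fun x : X => \prod_i om i (tnth x i)) (sg i0) u) PhiF =
    \sum_i (\prod_(j | j != i) mass (om' u j)) * E i (om' u i).
  by move=> u1; rewrite updE IH//; apply: om'0.
have termE u : -1 <= u <= 1 ->
    2^-1 * (\sum_i (\prod_(j | j != i) mass (om' u j)) * E i (om' u i) +
            \sum_i (\prod_(j | j != i) mass (om' (- u) j)) * E i (om' (- u) i)) =
    \sum_i Q i * (if i == i0 then 2^-1 * (E i (upd (om i) sgb u) + E i (upd (om i) sgb (- u))) else E i (om i)).
  move=> u1; rewrite -big_split/= big_distrr/=; apply: eq_bigr => i _.
  have [->|ii0] := eqVneq i i0.
    rewrite /om' eqxx; have QE v : \prod_(j | j != i0) mass (if j == i0 then upd (om j) sgb v else om j) = Q i0.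
      by apply: eq_bigr => j /negPf ->.
    by rewrite !QE; ring.
  have QE v : \prod_(j | j != i) mass (om' v j) =
      mass (upd (om i0) sgb v) * \prod_(j | (j != i) && (j != i0)) mass (om j).
    rewrite (bigD1 i0) 1?eq_sym//= /om' eqxx; congr (_ * _).
    by apply: eq_bigr => j /andP[_ /negPf ->].
  by rewrite !QE /Q [in RHS](bigD1 i0) 1?eq_sym//= /om' (negPf ii0) !mass_upd; field.
rewrite /Ob/=.
transitivity (lawE l (fun u => \sum_i Q i * (if i == i0 then 2^-1 * (E i (upd (om i) sgb u) + E i (upd (om i) sgb (- u))) else E i (om i)))).
  rewrite /lawE; apply: eq_big_seq => m ml; have [_ m1] := hl0.1 _ ml.
  by rewrite -termE// !IHu//; lra.
rewrite lawE_sum; apply: eq_bigr => i _; rewrite lawEZ; congr (_ * _).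
by rewrite eq_sym; case: eqP => [->|_] //=; rewrite lawE_cst.
Qed.

Lemma EE_factor_half (s : seq (law R * 'I_n)) : (forall o, o \in s -> is_law o.1) ->
  EE [seq (o.1, sg o.2) | o <- s] (fun=> 2^-1 ^+ n) PhiF =
  \sum_i phi1 [seq o.1 | o <- s & o.2 == i].
Proof.
move=> hl; have := @EE_factor s (fun=> fun=> 2^-1) hl (fun _ _ => _).
under [X in EE _ X _]eq_fun do rewrite prodr_const card_ord.
move=> ->; last by move=> ? ?; rewrite invr_ge0.
apply: eq_bigr => i _; rewrite /phi1 -map_comp big1 ?mul1r// => j _.
by rewrite mass_bool; lra.
Qed.

Lemma phi1_bound (ls : seq (law R)) : (forall l, l \in ls -> is_law l) ->
  0 <= phi1 ls <= (size ls)%:R * ln 2.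
Proof.
move=> hl; have v : valid [seq (l, sgb) | l <- ls].
  by apply: valid_map => l lls; split; [exact: hl|exact: sgb_spin].
have w0 : nneg (fun _ : bool => 2^-1 : R) by move=> ?; rewrite invr_ge0.
have m1 : mass (fun _ : bool => 2^-1 : R) = 1 by rewrite mass_bool; lra.
have P0 : PhiF (fun _ : bool => 2^-1 : R) = 0 by rewrite /PhiF m1 eta1.
apply/andP; split; first by rewrite -P0; apply: EE_PhiF_ge.
have := EE_PhiF_le v w0; rewrite P0 m1 add0r mulr1 size_map.
exact.
Qed.

End Factor.

(** * The two ends of the path on a Tanner graph *)

Section Graph.
Variables (R : realType) (n : nat) (T C : finType) (var : T -> 'I_n) (chk : T -> C).
Variables (tl ch : law R).
Hypothesis tl_law : is_law tl.
Hypothesis ch_law : is_law ch.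
Local Notation X := (n.-tuple bool).
Implicit Types (pi : {perm T}).

Definition vspin (e : T) : X -> R := sg R (var e).
Definition kdeg c := size (blk chk c).
Definition socks i := [seq e <- enum T | var e == i].
(** The message a check sends along one edge: the product of the trial values on its other edges. A
    check of degree 0 has no socket to carry it. *)
Definition lwk c := pw tl (kdeg c).-1.
Definition chan : seq (law R * (X -> R)) := [seq (ch, sg R i) | i <- enum 'I_n].
Definition u0 : X -> R := fun=> 2^-1 ^+ n.
Definition checks pi := [seq hardc vspin chk pi c | c <- enum C].
Definition gq k := lawE (pw tl k) (@gfun R).

Lemma vspin_spin a : spin (vspin a). Proof. exact: sg_spin. Qed.

Lemma lwk_law c : is_law (lwk c). Proof. exact: is_law_pw. Qed.

Lemma valid_chan : valid chan.
Proof. by apply: valid_map => i _; split => //; exact: sg_spin. Qed.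

Lemma nneg_u0 : nneg u0. Proof. by move=> x; rewrite /u0 exprn_ge0 ?invr_ge0. Qed.

Lemma mass_u0 : mass u0 = 1.
Proof.
by rewrite /mass /u0 sumr_const card_tuple card_bool -[LHS]mulr_natl natrX -exprMn mulfV ?expr1n.
Qed.

Lemma EE_cat_PhiF_ge A B (w : X -> R) : valid A -> valid B -> nneg w ->
  EE A w PhiF <= EE (A ++ B) w PhiF.
Proof. by move=> vA vB w0; rewrite EE_cat; apply: EE_le => // w' w'0; apply: EE_PhiF_ge. Qed.

Lemma EE_cat_PhiF_le A B (w : X -> R) : valid A -> valid B -> nneg w -> mass w = 1 ->
  EE (A ++ B) w PhiF <= EE A w PhiF + (size B)%:R * ln 2.
Proof.
move=> vA vB w0 w1; rewrite EE_cat.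
have -> : EE A w PhiF + (size B)%:R * ln 2 = EE A w (fun w => PhiF w + (size B)%:R * ln 2 * mass w).
  by rewrite EE_D EE_Z EE_mass// w1 mulr1.
by apply: EE_le => // w' w'0; apply: EE_PhiF_le.
Qed.

Definition softall pi := [seq (lwk (chk a), cp vspin pi a) | a <- enum T].

Lemma valid_soft pi (s : seq T) : valid [seq (lwk (chk a), cp vspin pi a) | a <- s].
Proof. by apply: valid_map => a _; split; [exact: lwk_law|exact: vspin_spin]. Qed.

Section Drop.
Variables (kept dr : seq C).
Hypothesis enumC : perm_eq (kept ++ dr) (enum C).
Definition dpool := [seq a <- enum T | chk a \in dr].

Lemma soft_split pi :
  perm_eq (flatten (map (blk chk) kept) ++ dpool) (enum T).
Proof.
have u : uniq (kept ++ dr) by rewrite (perm_uniq enumC) enum_uniq.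
move: (u); rewrite cat_uniq => /and3P[uk /hasPn hd ud].
have inC c : c \in kept ++ dr by rewrite (perm_mem enumC) mem_enum.
apply: uniq_perm; last 2 first.
- exact: enum_uniq.
- move=> a; rewrite mem_enum mem_cat; apply/orP.
  have := inC (chk a); rewrite mem_cat => /orP[ak|ad]; [left|right].
    by apply/flattenP; exists (blk chk (chk a)); [exact: map_f|rewrite mem_blk].
  by rewrite mem_filter ad mem_enum.
rewrite cat_uniq filter_uniq ?enum_uniq// andbT; apply/andP; split.
  have gen (s : seq C) : uniq s -> uniq (flatten (map (blk chk) s)).
    elim: s => [|c s IH] //= /andP[cs us].
    rewrite cat_uniq uniq_blk IH// andbT/=; apply/hasPn => a /flattenP[_ /mapP[c' c's ->]].
    by rewrite !mem_blk => /eqP ->; apply: contraNN cs => /eqP <-.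
  exact: gen.
apply/hasPn => a; rewrite mem_filter => /andP[ad _]; apply/negP.
move=> /flattenP[_ /mapP[c' c's ->]]; rewrite mem_blk => /eqP e.
by have := hd _ ad; rewrite e c's.
Qed.

(** The path inequality summed over [m] pinning levels is divided by [m], which leaves
    [step_err / m] per kept check. The pins and the missing observations on the pool cost at most
    [ln 2] each, by [EE_PhiF_le]. *)
Lemma drop_bound K (d e : R) m :
  (0 < m)%N -> (kept = [::] \/ (m < size dpool)%N) ->
  (forall c, c \in dr -> (0 < kdeg c)%N) -> 0 < d -> 0 <= e ->
  (forall x : R, -1 <= x <= 1 -> gfun x <= gpoly K x + e) ->
  avgP (fun pi => EE (chan ++ softall pi) u0 PhiF)
   + \sum_(c <- enum C) (1 - (kdeg c)%:R) * gq (kdeg c)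
   - \sum_(c <- kept) (step_err dpool K d e m (kdeg c) / m%:R + e)
   - m%:R * ln 2 - (size dpool)%:R * ln 2
  <= avgP (fun pi => EE (chan ++ checks pi) u0 PhiF).
Proof.
move=> m0 mp dr0 d0 e0 ge.
have mR : 0 < m%:R :> R by rewrite ltr0n.
have u : uniq (kept ++ dr) by rewrite (perm_uniq enumC) enum_uniq.
move: (u); rewrite cat_uniq => /and3P[uk /hasPn hd ud].
have vch := valid_chan; have nu := nneg_u0; have mu := mass_u0.
have ud' : uniq dpool by rewrite filter_uniq ?enum_uniq.
have vH pi s : valid (Hs (cp vspin pi) s) by apply: valid_Hs => a; exact: vspin_spin.
have vHc pi (s : seq C) : valid [seq hardc vspin chk pi c | c <- s].
  by apply: valid_map => c _; split; [exact: is_law_hard|apply: spin_pchi => a; exact: vspin_spin].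
set full := avgP (fun pi => EE (chan ++ checks pi) u0 PhiF).
pose pot := potential vspin chk lwk chan u0 dpool.
(* At the hard end the pins are removed for [ln 2] each, and restoring the dropped checks can only
   raise the value. *)
have top (l : 'I_m) : pot (catrev kept [::]) [::] l - m%:R * ln 2 <= full.
  rewrite -[m%:R * ln 2](avgP_cst T) -avgPB; apply: avgP_le => pi.
  rewrite lerBlDr; apply: (@le_trans _ _ (EE (chan ++ [seq hardc vspin chk pi c | c <- kept]) u0 PhiF + l%:R * ln 2)).
    have -> : base vspin chk lwk chan pi (catrev kept [::]) [::] ++ Hs (cp vspin pi) (take l dpool)
      = chan ++ [seq hardc vspin chk pi c | c <- catrev kept [::]] ++ Hs (cp vspin pi) (take l dpool).
      by rewrite /base/= cats0 catA.
    have -> : EE (chan ++ [seq hardc vspin chk pi c | c <- catrev kept [::]] ++ Hs (cp vspin pi) (take l dpool)) u0 PhiF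
       = EE ((chan ++ [seq hardc vspin chk pi c | c <- kept]) ++ Hs (cp vspin pi) (take l dpool)) u0 PhiF.
      rewrite -catA !EE_cat; apply: eq_EE => w; rewrite !EE_cat; apply: EE_perm.
      by rewrite catrevE cats0 perm_rev.
    apply: le_trans (EE_cat_PhiF_le _ _ _ _) _ => //; first exact: valid_cat.
    rewrite lerD2l ler_wpM2r ?ln_ge0 ?ler1n// ler_nat size_map size_take.
    by case: ltnP => // /leq_trans; apply.
  apply: lerD; last first.
    by rewrite ler_wpM2r ?ln_ge0 ?ler1n// ler_nat ltnW.
  have -> : EE (chan ++ checks pi) u0 PhiF =
     EE ((chan ++ [seq hardc vspin chk pi c | c <- kept]) ++ [seq hardc vspin chk pi c | c <- dr]) u0 PhiF.
    rewrite -catA !EE_cat; apply: eq_EE => w.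
    by rewrite -map_cat; apply: EE_perm; rewrite perm_sym.
  by apply: EE_cat_PhiF_ge => //; exact: valid_cat.
(* At the soft end it is the observations on the pool sockets that cost [ln 2] each, while the pins
   only help. *)
have bot (l : 'I_m) : avgP (fun pi => EE (chan ++ softall pi) u0 PhiF) - (size dpool)%:R * ln 2
    <= pot [::] kept l.
  rewrite -[(size dpool)%:R * ln 2](avgP_cst T) -avgPB; apply: avgP_le => pi.
  rewrite lerBlDr.
  pose S s := [seq (lwk (chk a), cp vspin pi a) | a <- s].
  have bE : base vspin chk lwk chan pi [::] kept = chan ++ S (flatten (map (blk chk) kept)).
    rewrite /base/=; congr (_ ++ _); rewrite /S map_flatten -map_comp; congr flatten.
    apply/eq_map => c; apply/eq_in_map => a; rewrite mem_blk => /eqP ->//.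
  have -> : EE (chan ++ softall pi) u0 PhiF = EE ((chan ++ S (flatten (map (blk chk) kept))) ++ S dpool) u0 PhiF.
    rewrite -catA !EE_cat; apply: eq_EE => w; rewrite -map_cat.
    by apply: EE_perm; rewrite perm_sym soft_split.
  apply: le_trans (EE_cat_PhiF_le _ _ _ _) _ => //.
  - by apply: valid_cat => //; exact: valid_soft.
  - exact: valid_soft.
  rewrite size_map lerD2r bE; apply: EE_cat_PhiF_ge => //.
  by apply: valid_cat => //; exact: valid_soft.
have pfree a : a \in dpool -> chk a \notin [::] ++ kept.
  by rewrite mem_filter => /andP[/hd].
have path : \sum_(l < m) pot [::] kept l + \sum_(c <- kept)
      (m%:R * (\sum_(q < K) gcoef R q * ((1 - (kdeg c)%:R) * lmom tl q ^+ kdeg c))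
       - step_err dpool K d e m (kdeg c)) <= \sum_(l < m) pot (catrev kept [::]) [::] l.
  apply: path_steps => //.
  - exact: vspin_spin.
  - exact: lwk_law.
  - by move=> q; have /andP[] := lmom_bound q tl_law.
  - by move=> c q; rewrite lmom_pw.
have S1 : \sum_(l < m) pot (catrev kept [::]) [::] l - m%:R * (m%:R * ln 2) <= m%:R * full.
  have : \sum_(l < m) (pot (catrev kept [::]) [::] l - m%:R * ln 2) <= \sum_(l < m) full.
    by apply: ler_sum => l _; exact: top.
  by rewrite sumrB !sumr_const card_ord -[(m%:R * ln 2) *+ m]mulr_natl -[full *+ m]mulr_natl.
have S2 : m%:R * (avgP (fun pi => EE (chan ++ softall pi) u0 PhiF) - (size dpool)%:R * ln 2)
    <= \sum_(l < m) pot [::] kept l.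
  set bb := _ - _ * ln 2; have : \sum_(l < m) bb <= \sum_(l < m) pot [::] kept l.
    by apply: ler_sum => l _; exact: bot.
  by rewrite sumr_const card_ord -[bb *+ m]mulr_natl.
have S3 : \sum_(c <- kept) m%:R * ((1 - (kdeg c)%:R) * gq (kdeg c) - (step_err dpool K d e m (kdeg c) / m%:R + e))
  <= \sum_(c <- kept) (m%:R * (\sum_(q < K) gcoef R q * ((1 - (kdeg c)%:R) * lmom tl q ^+ kdeg c))
     - step_err dpool K d e m (kdeg c)).
  apply: ler_sum => c _; have := pw_gpoly_gfun (kdeg c) tl_law e0 ge; rewrite -/(gq _) => h.
  have := ler_wpM2l (ltW mR) h.
  have -> : m%:R * ((1 - (kdeg c)%:R) * gq (kdeg c) - (step_err dpool K d e m (kdeg c) / m%:R + e)) =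
    m%:R * ((1 - (kdeg c)%:R) * gq (kdeg c) - e) - step_err dpool K d e m (kdeg c).
    by field; rewrite gt_eqF.
  lra.
(* Dropped checks have degree at least 1, so their terms are nonpositive and may be included in the
   smaller sum. *)
have S4 : \sum_(c <- enum C) (1 - (kdeg c)%:R) * gq (kdeg c) <= \sum_(c <- kept) (1 - (kdeg c)%:R) * gq (kdeg c).
  rewrite -(perm_big _ enumC)/= big_cat/= gerDl big_seq sumr_le0// => c /dr0 k0.
  rewrite mulr_le0_ge0//; first by rewrite subr_le0 ler1n.
  by have /andP[] := lawE_gfun_bound (is_law_pw (kdeg c) tl_law).
move: S3; rewrite -big_distrr sumrB/= => S3.
rewrite -(ler_pM2l mR); move: S1 S2 S3 path; rewrite -/pot -/(kdeg _).
set p1 := \sum_(l < m) pot [::] kept l; set p2 := \sum_(l < m) pot (catrev _ _) _ _.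
set st := \sum_(c <- kept) (_ / _ + _); set sk := \sum_(c <- kept) (_ * _ - _).
move=> S1 S2 S3 path.
have S4' := ler_wpM2l (ltW mR) S4.
rewrite !mulrBr mulrDr; move: S1 S2 S3 path S4'; rewrite !mulrBr; lra.
Qed.

End Drop.

Definition mix : law R := mixL [seq ((#|T|%:R)^-1, a) | a <- enum T] (fun a => lwk (chk a)).

Lemma lawE_mix f : lawE mix f = #|T|%:R^-1 * \sum_(a : T) lawE (lwk (chk a)) f.
Proof. by rewrite lawE_mixL big_map big_distrr/= -big_enum/=. Qed.

(** [Ob] is linear in the law of the bias, so drawing sockets independently amounts to observing
    through the averaged law [mix]. *)
Lemma nsum_mix (s : seq (law R)) (k : nat) (t : seq T) :
  nsum (enum T) k (fun t => phi1 (s ++ [seq lwk (chk a) | a <- t])) t =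
  phi1 (s ++ [seq lwk (chk a) | a <- t] ++ nseq k mix).
Proof.
elim: k t => [|k IH] t /=; first by rewrite cats0.
transitivity (#|T|%:R^-1 * \sum_(a <- enum T)
    EE [seq (l, @sgb R) | l <- s ++ [seq lwk (chk a) | a <- t]] (fun=> 2^-1)
      (fun w => Ob (lwk (chk a), @sgb R) w (fun w => EE [seq (l, @sgb R) | l <- nseq k mix] w PhiF))).
  rewrite -cardE; congr (_ * _); apply: eq_bigr => a _; rewrite IH /phi1.
  transitivity (EE ([seq (l, @sgb R) | l <- s ++ [seq lwk (chk a) | a <- t]] ++
     (lwk (chk a), @sgb R) :: [seq (l, @sgb R) | l <- nseq k mix]) (fun=> 2^-1) PhiF); last by rewrite EE_cat.
  by congr (EE _ _ _); rewrite map_rcons cat_rcons catA map_cat.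
rewrite -EE_sum -EE_Z /phi1 catA [in RHS]map_cat [in RHS]EE_cat; apply: eq_EE => w /=.
by rewrite /Ob lawE_mix big_enum.
Qed.

Lemma nsum_map_perm (f : seq T -> R) pi k t :
  nsum (enum T) k (fun t => f (map pi t)) t = nsum (enum T) k f (map pi t).
Proof.
elim: k t => [|k IH] t //=; congr (_ * _).
rewrite !big_enum/= [RHS](reindex_inj (@perm_inj _ pi))/=.
by apply: eq_bigr => a _; rewrite IH map_rcons.
Qed.

Definition samp_err (d : nat) : R := (d.+1)%:R * ln 2 * (d%:R * d%:R / #|T|%:R).

(** At the soft end the bits decouple ([EE_factor_half]). The sockets of one bit are matched to
    distinct uniform check sockets, and replacing these by independent draws costs [samp_err]. *)
Lemma soft_bound :
  \sum_(i < n) (phi1 (ch :: nseq (size (socks i)) mix) - samp_err (size (socks i)))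
  <= avgP (fun pi => EE (chan ++ softall pi) u0 PhiF).
Proof.
pose f (s : seq T) := phi1 ([:: ch] ++ [seq lwk (chk a) | a <- s]).
have fE pi : EE (chan ++ softall pi) u0 PhiF = \sum_i f (map (pi^-1)%g (socks i)).
  pose s := [seq (ch, i) | i <- enum 'I_n] ++ [seq (lwk (chk a), var (pi a)) | a <- enum T].
  have -> : chan ++ softall pi = [seq (o.1, sg R o.2) | o <- s].
    by rewrite /s map_cat; congr (_ ++ _); exact: map_comp.
  have sl : forall o, o \in s -> is_law o.1.
    move=> o; rewrite mem_cat => /orP[/mapP[i _ ->]//|/mapP[a _ ->]].
    exact: lwk_law.
  transitivity (\sum_i phi1 [seq o.1 | o <- s & o.2 == i]); first exact: (EE_factor_half sl). apply: eq_bigr => i _.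
  have selE (r : seq T) (F : T -> law R) (v : T -> 'I_n) :
      [seq o.1 | o <- [seq (F a, v a) | a <- r] & o.2 == i] = [seq F a | a <- r & v a == i].
    by elim: r => //= a r IH; case: eqP => //= _; rewrite IH.
  have chE (r : seq 'I_n) : [seq o.1 | o <- [seq (ch, j) | j <- r] & o.2 == i] = nseq (count_mem i r) ch.
    by elim: r => //= a r IH; case: eqP => //= _; rewrite IH.
  rewrite /s filter_cat map_cat selE chE count_uniq_mem ?enum_uniq// mem_enum/=.
  rewrite /f /phi1 /=; congr (Ob _ _ _); apply/funext => w.
  rewrite -[in LHS]map_comp -[in RHS](map_comp (fun l => (l, @sgb R)) (fun a => lwk (chk a))).
  apply: EE_perm; apply: uniq_perm.
  - exact/filter_uniq/enum_uniq.
  - rewrite map_inj_uniq; [exact/filter_uniq/enum_uniq|exact: perm_inj].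
  - move=> a; rewrite mem_filter mem_enum andbT /=; apply/idP/mapP => [ai|[e]].
      by exists (pi a); rewrite ?permK// mem_filter ai mem_enum.
    by rewrite mem_filter => /andP[ei _] ->; rewrite permKV.
rewrite (eq_avgP fE) avgP_sum; apply: ler_sum => i _.
set d := size (socks i).
pose h s := avgP (fun pi => f (map pi s)).
have -> : avgP (fun pi => f (map (pi^-1)%g (socks i))) = h (socks i).
  rewrite /h /avgP; congr (_ * _).
  by rewrite [RHS](reindex_inj invg_inj).
have us : uniq (socks i) by rewrite filter_uniq ?enum_uniq.
have fb s : 0 <= f s <= (size s).+1%:R * ln 2.
  have := @phi1_bound R ([:: ch] ++ [seq lwk (chk a) | a <- s]); rewrite size_cat size_map.
  apply => l; rewrite mem_cat inE => /orP[/eqP ->//|/mapP[a _ ->]]; exact: lwk_law.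
have nE : nsum (enum T) d h [::] = phi1 (ch :: nseq d mix).
  rewrite -nsum_avgP; have e pi : nsum (enum T) d (fun s => f (map pi s)) [::] = phi1 (ch :: nseq d mix).
    by rewrite nsum_map_perm nsum_mix.
  by rewrite (eq_avgP e) avgP_cst.
have [d0|dp] := posnP d.
  rewrite -nE /samp_err d0 !mul0r mulr0 subr0 /=.
  by move/eqP: d0; rewrite size_eq0 => /eqP ->.
have T0 : (0 < size (enum T))%N.
  by move: dp; rewrite /d; case: (socks i) (mem_enum T) => // e s /(_ e); case: (enum T).
have ln20 : 0 <= ln 2 :> R by rewrite ln_ge0 ?ler1n.
pose hh s := if size s == d then h s else 0.
have nh k t : (size t + k)%N = d -> nsum (enum T) k hh t = nsum (enum T) k h t.
  elim: k t => [|k IH] t /=; first by rewrite addn0 /hh => ->; rewrite eqxx.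
  by move=> e; congr (_ * _); apply: eq_bigr => a _; rewrite IH// size_rcons addSnnS.
have hb s : 0 <= h s <= (size s).+1%:R * ln 2.
  apply/andP; split.
    by rewrite -[leLHS](avgP_cst T); apply: avgP_le => pi; have /andP[] := fb (map pi s).
  rewrite -[leRHS](avgP_cst T); apply: avgP_le => pi.
  by have /andP[] := fb (map pi s); rewrite size_map.
rewrite lerBlDr -nE -nh// /samp_err cardE.
apply: nsum_le => //; first exact: enum_uniq.
- move=> s us' _ sd; rewrite /hh sd eqxx /h (@exch _ _ (enum T) (fun pi s => f (map pi s)) s (socks i))//.
  + move=> g pi s' _; congr f; rewrite -map_comp; apply: eq_map => a.
    by rewrite permM.
  + by move=> a _; rewrite mem_enum.
  + by move=> a _; rewrite mem_enum.
- move=> s; rewrite /hh; case: eqP => [sd|_].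
    by have /andP[_] := hb s; rewrite sd.
  by rewrite mulr_ge0.
- by have /andP[] := hb (socks i).
- by rewrite mulr_ge0.
Qed.

End Graph.

(** * Posterior entropy and its relation to the functional [PhiF] *)

Section Entropy.
Variables (R : realType) (X : finType).
Implicit Types (w : X -> R).

Definition Sent w : R := \sum_x w x * ln (mass w / w x).

Lemma le_mass w x : nneg w -> w x <= mass w.
Proof. by move=> w0; rewrite /mass (bigD1 x)//= lerDl sumr_ge0. Qed.

Lemma SentE w : nneg w -> Sent w = eta (mass w) - \sum_x eta (w x).
Proof.
move=> w0; have -> : eta (mass w) = \sum_x w x * ln (mass w) by rewrite -big_distrl.
rewrite /Sent -sumrB; apply: eq_bigr => x _.
have := w0 x; rewrite le_eqVlt => /predU1P[<-|wx]; first by rewrite eta0 !mul0r subr0.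
rewrite ln_div ?posrE//; last exact: lt_le_trans (le_mass x w0).
by rewrite mulrBr.
Qed.

Lemma SentZ c w : 0 <= c -> Sent (fun x => c * w x) = c * Sent w.
Proof.
rewrite le_eqVlt => /predU1P[<-|c0].
  by rewrite mul0r /Sent big1// => x _; rewrite mul0r mul0r.
rewrite /Sent big_distrr/=; apply: eq_bigr => x _.
have -> : mass (fun x => c * w x) = c * mass w by rewrite /mass big_distrr.
by rewrite invfM mulrACA divff ?gt_eqF// mul1r mulrA.
Qed.

(** Log-sum inequality. [key] is ln z <= z - 1 at z = (Y/x)(a+b)/(A+B), and its correction terms
    cancel when the two instances are added. *)
Lemma log_sum2 (a b A B : R) : 0 <= a <= A -> 0 <= b <= B ->
  a * ln (A / a) + b * ln (B / b) <= (a + b) * ln ((A + B) / (a + b)).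
Proof.
move=> /andP[a0 aA] /andP[b0 bB].
have [ab0|abn] := eqVneq (a + b) 0.
  have [-> ->] : a = 0 /\ b = 0 by split; lra.
  by rewrite !mul0r !addr0 mul0r.
have ab0 : 0 < a + b by rewrite lt_neqAle eq_sym abn addr_ge0.
have AB0 : 0 < A + B by lra.
have key x Y : 0 <= x <= Y -> x * ln (Y / x) <= x * ln ((A + B) / (a + b)) + (Y * ((a + b) / (A + B)) - x).
  move=> /andP[]; rewrite le_eqVlt => /predU1P[<- Y0|x0 xY].
    by rewrite !mul0r add0r subr0 mulr_ge0// divr_ge0// ltW.
  have Y0 : 0 < Y by apply: lt_le_trans xY.
  have := @ln_le_sub1 R (Y / x * ((a + b) / (A + B))).
  rewrite !mulr_gt0 ?invr_gt0// => /(_ isT).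
  have -> : ln (Y / x * ((a + b) / (A + B))) = ln (Y / x) - ln ((A + B) / (a + b)).
    have p1 : 0 < (A + B) / (a + b) by rewrite divr_gt0.
    rewrite [LHS]lnM ?posrE ?divr_gt0//; congr (_ + _).
    by rewrite -[(a + b) / _]invf_div lnV ?posrE.
  move=> h; have := ler_wpM2l (ltW x0) h.
  have -> : x * (Y / x * ((a + b) / (A + B)) - 1) = Y * ((a + b) / (A + B)) - x.
    by field; rewrite !gt_eqF.
  lra.
have h1 := key a A; have h2 := key b B.
apply: le_trans (lerD (h1 _) (h2 _)) _; rewrite ?a0 ?b0//.
rewrite addrACA -mulrDl gerDl le_eqVlt; apply/orP; left; apply/eqP.
by field; rewrite gt_eqF.
Qed.

Lemma Sent_super w1 w2 : nneg w1 -> nneg w2 ->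
  Sent w1 + Sent w2 <= Sent (fun x => w1 x + w2 x).
Proof.
move=> h1 h2; rewrite /Sent -big_split/=; apply: ler_sum => x _.
have -> : mass (fun x => w1 x + w2 x) = mass w1 + mass w2 by rewrite /mass big_split.
by apply: log_sum2; rewrite ?h1 ?h2 le_mass.
Qed.

Lemma sublin_NSent : sublin (fun w => - Sent w).
Proof.
split=> [w1 w2 h1 h2|c w c0 w0]; last by rewrite SentZ// mulrN.
by rewrite -opprD lerN2 Sent_super.
Qed.

(** For spins equal to 1 or -1, an observation of bias [u] splits every entry [w x] into the same
    two factors 1 + u and 1 - u. The mean increase of [eta (w x)] is then [w x * gfun u] whatever
    the spin at [x], so the second sum in [SentE] becomes explicit. *)
Lemma EE_Sent (L : seq (law R * (X -> R))) w : valid L -> nneg w ->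
  (forall o, List.In o L -> forall x, o.2 x = 1 \/ o.2 x = -1) ->
  EE L w Sent = EE L w PhiF - \sum_x eta (w x) - (\sum_(o <- L) lawE o.1 (@gfun R)) * mass w.
Proof.
elim: L w => [|o L IH] w /=.
  by move=> _ w0 _; rewrite big_nil mul0r subr0 SentE.
move=> [[ol os] vL] w0 pm.
have pm' o' : List.In o' L -> forall x, o'.2 x = 1 \/ o'.2 x = -1 by move=> h; apply: pm; right.
have pmo x : o.2 x = 1 \/ o.2 x = -1 by apply: pm; left.
have etaE u x : -1 <= u <= 1 ->
    2^-1 * (eta (upd w o.2 u x) + eta (upd w o.2 (- u) x)) = eta (w x) + w x * gfun u.
  move=> u1; rewrite /upd !(etaM (w0 x)); try by (case: (pmo x) => ->; lra).
  by case: (pmo x) => ->; rewrite /gfun ?(mulr1, mulrN1, opprK); field.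
rewrite big_cons mulrDl.
have -> : Ob o w (fun w' => EE L w' Sent) =
   Ob o w (fun w' => EE L w' PhiF) - \sum_x eta (w x) - lawE o.1 (@gfun R) * mass w
    - (\sum_(o <- L) lawE o.1 (@gfun R)) * mass w.
  rewrite /Ob -lawEZr.
  set G := \sum_(o <- L) _.
  rewrite -[\sum_x eta (w x)](lawE_cst _ ol) -[G * mass w](lawE_cst _ ol).
  rewrite /lawE -!sumrB; apply: eq_big_seq => m ml; have [_ m1] := ol.1 _ ml.
  rewrite -!mulrBr; congr (_ * _).
  have n1 : nneg (upd w o.2 m.2) by apply: upd_nneg.
  have n2 : nneg (upd w o.2 (- m.2)) by apply: upd_nneg => //; lra.
  rewrite !IH// !mass_upd -/G.
  have : 2^-1 * (\sum_x eta (upd w o.2 m.2 x) + \sum_x eta (upd w o.2 (- m.2) x)) =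
     \sum_x eta (w x) + gfun m.2 * mass w.
    rewrite -big_split/= big_distrr/= /mass big_distrr -big_split/=.
    by apply: eq_bigr => x _; rewrite etaE// [gfun _ * _]mulrC.
  lra.
ring.
Qed.

End Entropy.

(** * Conditioning on a parity replaced by observing it *)

Section Cosets.
Local Close Scope classical_set_scope.
Variables (R : realType) (n : nat).
Local Notation X := (n.-tuple bool).
Implicit Types (w chi : X -> R) (x y : X).

Definition xadd x y : X := [tuple tnth x i (+) tnth y i | i < n].

Lemma xaddK y : involutive (xadd^~ y).
Proof. by move=> x; apply: eq_from_tnth => i; rewrite !tnth_mktuple -addbA addbb addbF. Qed.

Definition shift y w : X -> R := fun x => w (xadd x y).

Definition ischar chi := (forall x, chi x = 1 \/ chi x = -1) /\
  (forall x y, chi (xadd x y) = chi x * chi y).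

Lemma ischar_sg i : ischar (sg R i).
Proof.
split=> [x|x y]; rewrite /sg /sgb; first by case: (tnth x i); [right|left].
by rewrite tnth_mktuple; case: (tnth x i); case: (tnth y i) => /=; ring.
Qed.

Lemma ischar_prod (I : Type) (s : seq I) (F : I -> X -> R) :
  (forall i, ischar (F i)) -> ischar (fun x => \prod_(i <- s) F i x).
Proof.
move=> h; split=> [x|x y] /=.
  elim: s => [|i s IH]; first by left; rewrite big_nil.
  by rewrite big_cons; move: IH; have [->|->] := (h i).1 x => -[] ->;
    rewrite ?mulr1 ?mulrN1 ?opprK; auto.
by rewrite -big_split/=; apply: eq_bigr => i _; rewrite (h i).2.
Qed.

Lemma spin_char chi : ischar chi -> spin chi.
Proof. by move=> [h _] x; case: (h x) => ->; apply/andP; split; lra. Qed.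

Lemma mass_shift y w : mass (shift y w) = mass w.
Proof. by rewrite /mass [RHS](reindex_inj (inv_inj (xaddK y))). Qed.

Lemma Sent_shift y w : Sent (shift y w) = Sent w.
Proof. by rewrite /Sent mass_shift [RHS](reindex_inj (inv_inj (xaddK y))). Qed.

Fixpoint allchar (L : seq (law R * (X -> R))) : Prop :=
  if L is o :: L' then (is_law o.1 /\ ischar o.2) /\ allchar L' else True.

(** Translation multiplies a character by a sign, which merely exchanges the outcomes [u] and [- u],
    and these are averaged. *)
Lemma EE_shift L y w : allchar L -> EE L (shift y w) (@Sent R X) = EE L w (@Sent R X).
Proof.
elim: L w => [|o L IH] w /=; first by rewrite Sent_shift.
move=> [[_ [pm mul]] aL]; apply: eq_lawE => u; congr (_ * _).
have updE v : upd (shift y w) o.2 v = shift y (upd w o.2 (v * o.2 y)).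
  apply/funext => x; rewrite /upd /shift mul; case: (pm y) => ->; ring.
rewrite !updE !IH//; case: (pm y) => ->; first by rewrite !mulr1.
by rewrite !mulrN1 opprK addrC.
Qed.

Lemma allchar_valid L : allchar L -> valid L.
Proof. by elim: L => [|o L IH] //= [[? ?] /IH ?]; split => //; split => //; exact: spin_char. Qed.

Lemma EE_SentZ L c w : allchar L -> 0 <= c -> nneg w ->
  EE L (fun x => c * w x) (@Sent R X) = c * EE L w (@Sent R X).
Proof.
move=> aL c0 w0; have [_ h] := sublin_EE (allchar_valid aL) (@sublin_NSent R X).
have E v : EE L v (fun w => - Sent w) = - EE L v (@Sent R X).
  by rewrite -[RHS]mulN1r -EE_Z; apply: eq_EE => v'; rewrite mulN1r.
by have := h c w c0 w0; rewrite !E mulrN => /oppr_inj.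
Qed.

Definition unif (H : {set X}) : X -> R := fun x => (x \in H)%:R / #|H|%:R.

Definition xclosed (H : {set X}) := forall x y, x \in H -> y \in H -> xadd x y \in H.

Lemma nneg_unif H : nneg (unif H).
Proof. by move=> x; rewrite /unif divr_ge0. Qed.

(** If [chi] takes the value -1 on [H], the two outcomes are the uniform weight on [H'] and its
    translate by [x1], with equal entropies by [EE_shift]. Otherwise the outcome -1 has weight 0 and
    the outcome +1 has double weight, which the factor 1/2 compensates. *)
Lemma EE_hard_unif chi L (H : {set X}) : ischar chi -> allchar L -> xclosed H -> H != finset.set0 ->
  EE ((hard R, chi) :: L) (unif H) (@Sent R X) =
  EE L (unif (H :&: [set x | chi x == 1])) (@Sent R X).
Proof.
move=> hchi aL cH H0; have [pm mul] := hchi; set H' := H :&: _.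
rewrite /= /Ob lawE_hard/=.
have e1N : (1 == -1 :> R) = false by apply/negP => /eqP; lra.
have eN1 : (-1 == 1 :> R) = false by rewrite eq_sym.
have cH0 : 0 < #|H|%:R :> R by rewrite ltr0n card_gt0.
have [/existsP[x1 /andP[x1H /eqP x1c]]|/existsPn hn] := boolP [exists x, (x \in H) && (chi x == -1)].
  have bij : #|H :&: [set x | chi x == -1]| = #|H'|.
    have <- : [set xadd x x1 | x in H'] = H :&: [set x | chi x == -1].
      apply/setP => x; apply/imsetP/idP => [[y]|].
        rewrite !inE => /andP[yH /eqP y1] ->; rewrite cH//= mul y1 x1c.
        by rewrite mul1r eqxx.
      rewrite !inE => /andP[xH /eqP xc]; exists (xadd x x1); last by rewrite xaddK.
      by rewrite !inE cH//= mul xc x1c mulrNN mulr1 eqxx.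
    by rewrite card_imset//; exact: inv_inj (xaddK x1).
  have split_card : (#|H| = #|H'| + #|H'|)%N.
    rewrite -{2}bij -cardsUI (_ : H' :&: _ = finset.set0) ?cards0 ?addn0.
      apply/eq_card => x; rewrite !inE; case: (x \in H) => //=.
      by case: (pm x) => ->; rewrite eqxx ?orbT.
    apply/setP => x; rewrite !inE; case: (x \in H) => //=.
    by case: (pm x) => ->; rewrite eqxx/= ?e1N ?eN1.
  have cH' : #|H|%:R = 2 * #|H'|%:R :> R by rewrite split_card natrD; ring.
  have H'0 : #|H'|%:R != 0 :> R.
    by apply: contraTneq cH0 => h; rewrite cH' h mulr0 ltxx.
  have e1 : upd (unif H) chi 1 = unif H'.
    apply/funext => x; rewrite /upd /unif mul1r !inE cH'.
    case: (x \in H) => /=; last by rewrite !mul0r.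
    by case: (pm x) => ->; rewrite ?eqxx ?eN1/=; [field|rewrite subrr mulr0 mul0r].
  have e2 : upd (unif H) chi (-1) = shift x1 (unif H').
    apply/funext => x; rewrite /upd /shift /unif !inE mul x1c cH' mulN1r.
    have -> : (xadd x x1 \in H) = (x \in H).
      by apply/idP/idP => h; [rewrite -(xaddK x1 x)|]; apply: cH.
    case: (x \in H) => /=; last by rewrite !mul0r.
    case: (pm x) => ->; rewrite ?mulrNN ?mul1r ?mulr1 ?eqxx ?eN1/=; last by field.
    by rewrite subrr mulr0 mul0r.
  by rewrite e1 e2 EE_shift//; field.
have H'H : H' = H.
  apply/setP => x; rewrite !inE; have := hn x; case: (x \in H) => //=.
  by case: (pm x) => ->; rewrite eqxx.
have e1 : upd (unif H) chi 1 = (fun x => 2 * unif H x).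
  apply/funext => x; rewrite /upd /unif; have := hn x; case: (x \in H) => /=; last by rewrite !mul0r mulr0.
  by case: (pm x) => ->; rewrite ?eqxx// => _; field; rewrite gt_eqF.
have e2 : upd (unif H) chi (-1) = (fun x => 0 * unif H x).
  apply/funext => x; rewrite /upd /unif; have := hn x; case: (x \in H) => /=; last by rewrite !mul0r.
  by case: (pm x) => ->; rewrite ?eqxx// => _; rewrite mulr1 subrr mulr0 mul0r.
by rewrite e1 e2 H'H !EE_SentZ//; try exact: nneg_unif; field.
Qed.

Lemma EE_hards_unif (chis : seq (X -> R)) L (H : {set X}) x0 :
  (forall chi, List.In chi chis -> ischar chi /\ chi x0 = 1) ->
  allchar L -> xclosed H -> x0 \in H ->
  EE ([seq (hard R, chi) | chi <- chis] ++ L) (unif H) (@Sent R X) =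
  EE L (unif (H :&: [set x | all (fun chi => chi x == 1) chis])) (@Sent R X).
Proof.
elim: chis H => [|chi chis IH] H hc aL cH xH.
  by congr (EE _ (unif _) _); apply/setP => x; rewrite !inE andbT.
have [hchi c0] := hc chi (or_introl erefl).
have hc' chi' : List.In chi' chis -> ischar chi' /\ chi' x0 = 1 by move=> h; apply: hc; right.
have aL' : allchar ([seq (hard R, chi) | chi <- chis] ++ L).
  elim: chis hc' {IH hc} => [|c s IH'] h //=; split.
    by split; [exact: is_law_hard|exact: (h c (or_introl erefl)).1].
  by apply: IH' => c' h'; apply: h; right.
rewrite [_ ++ _]/= EE_hard_unif//; last by apply/set0Pn; exists x0.
rewrite IH//.
- congr (EE _ (unif _) _); apply/setP => x; rewrite !inE /=.
  by rewrite andbA.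
- move=> x y; rewrite !inE => /andP[xh /eqP x1] /andP[yh /eqP y1].
  by rewrite cH//= hchi.2 x1 y1 mulr1.
- by rewrite !inE xH c0 eqxx.
Qed.

End Cosets.

(** * Comparison of integrals *)

Section Monotone_integral.
Context d (Y : measurableType d) (R : realType) (mu : {measure set Y -> \bar R}).
Local Open Scope ereal_scope.

(** The integral of a nonnegative function is a supremum over the simple functions below it, hence
    monotone for arbitrary functions. The iterated integrands of the entropy and of [hRS] can thus
    be compared pointwise. *)
Lemma ge0_le_integral_any (f g : Y -> \bar R) : (forall y, 0 <= f y) -> (forall y, f y <= g y) ->
  \int[mu]_y f y <= \int[mu]_y g y.
Proof.
move=> f0 fg; have g0 y : 0 <= g y by apply: le_trans (fg y).
rewrite !ge0_integralTE//; apply: le_ereal_sup => _ [h hf <-]; exists h => //.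
by move=> y; apply: le_trans (fg y); apply: hf.
Qed.

Lemma le_integral_any (f g : Y -> \bar R) : (forall y, f y <= g y) ->
  \int[mu]_y f y <= \int[mu]_y g y.
Proof.
move=> fg; rewrite integralE [leRHS]integralE; apply: leeB.
  apply: ge0_le_integral_any => y; first exact: funepos_ge0.
  by apply: (@funepos_le _ _ setT f g) => [x _|]; [exact: fg|rewrite in_setT].
apply: ge0_le_integral_any => y; first exact: funeneg_ge0.
by apply: (@funeneg_le _ _ setT f g) => [x _|]; [exact: fg|rewrite in_setT].
Qed.

End Monotone_integral.

(** * Upgrading a symmetric channel to finitely many biases *)

Section Channel_grid.
Variables (R : realType) (N : nat).
Hypothesis N0 : (0 < N)%N.
Implicit Types (t : R).

Definition gpos t : R := (t + 1) * N%:R / 2.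
Definition gidx t : nat := Num.truncn (gpos t).
Definition gfrac t : R := gpos t - (gidx t)%:R.
(** An index is a cell with a choice of its left or right end. The point t = 1 falls into cell [N],
    whose right end would leave [-1, 1]; the minimum caps it, and its weight [gfrac] is then 0. *)
Definition gval (j : 'I_N.+1 * bool) : R := Num.min 1 ((j.1 + j.2)%:R * 2 / N%:R - 1).
(** Barycentric weights of [t] between the ends of its cell. They preserve the mean ([gwt_mean]), so
    an observation of bias [t] is a mixture of observations with the neighbouring grid biases. *)
Definition gwt (j : 'I_N.+1 * bool) t : R :=
  (gidx t == j.1)%:R * (if j.2 then gfrac t else 1 - gfrac t).

Lemma NR0 : 0 < N%:R :> R. Proof. by rewrite ltr0n. Qed.

Lemma gpos_bound t : -1 <= t <= 1 -> 0 <= gpos t <= N%:R.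
Proof.
move=> t1; have h := NR0; rewrite /gpos; apply/andP; split.
  by rewrite !mulr_ge0 ?invr_ge0//; lra.
by nra.
Qed.

Lemma gidx_bound t : -1 <= t <= 1 -> (gidx t)%:R <= gpos t < (gidx t).+1%:R.
Proof. by move=> /gpos_bound/andP[p0 _]; exact: truncn_itv. Qed.

Lemma gidx_le t : -1 <= t <= 1 -> (gidx t < N.+1)%N.
Proof.
move=> t1; have /andP[h _] := gidx_bound t1; have /andP[_ h2] := gpos_bound t1.
by rewrite ltnS -(ler_nat R); apply: le_trans h2.
Qed.

Lemma gfrac_bound t : -1 <= t <= 1 -> 0 <= gfrac t <= 1.
Proof.
move=> /gidx_bound/andP[h1 h2]; rewrite /gfrac; move: h2; rewrite -natr1 => h2.
by apply/andP; split; lra.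
Qed.

Lemma ge0_gwt j t : -1 <= t <= 1 -> 0 <= gwt j t.
Proof.
move=> /gfrac_bound/andP[h1 h2]; rewrite mulr_ge0//; case: j.2 => //.
by rewrite subr_ge0.
Qed.

Lemma gval_bound j : -1 <= gval j <= 1.
Proof.
rewrite /gval le_min ge_min lexx/= andbT; apply/andP; split; first by lra.
have : 0 <= (j.1 + j.2)%:R * 2 / N%:R :> R by rewrite divr_ge0// mulr_ge0.
by lra.
Qed.

Lemma gwt_sum t (F : 'I_N.+1 * bool -> R) : -1 <= t <= 1 ->
  \sum_j gwt j t * F j = \sum_(b : bool) (if b then gfrac t else 1 - gfrac t) * F (inord (gidx t), b).
Proof.
move=> t1; rewrite (eq_bigr (fun j => gwt (j.1, j.2) t * F (j.1, j.2))); last by case.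
rewrite -(pair_bigA _ (fun i b => gwt (i, b) t * F (i, b)))/=.
have jE : (inord (gidx t) : 'I_N.+1) = gidx t :> nat by rewrite inordK// gidx_le.
rewrite (bigD1 (inord (gidx t)))//= [X in _ + X]big1 ?addr0.
  by apply: eq_bigr => b _; rewrite /gwt /= jE eqxx mul1r.
move=> i hi; apply: big1 => b _; rewrite /gwt/=.
suff -> : (gidx t == i :> nat) = false by rewrite !mul0r.
apply/negbTE; apply: contraNneq hi => e; apply/eqP/val_inj => /=.
by rewrite jE e.
Qed.

Lemma gwt_sum1 t : -1 <= t <= 1 -> \sum_j gwt j t = 1.
Proof.
move=> t1; have := gwt_sum (fun=> 1) t1; under eq_bigr do rewrite mulr1.
by move=> ->; rewrite big_bool/=; lra.
Qed.

Lemma gval_step t b : -1 <= t <= 1 -> (b = true -> gfrac t <> 0) ->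
  gval (inord (gidx t), b) = (gidx t + b)%:R * 2 / N%:R - 1.
Proof.
move=> t1 hb; rewrite /gval /= inordK ?gidx_le//.
apply/min_idPr; rewrite lerBlDr ler_pdivrMr ?NR0//.
have hN := gpos_bound t1; have hi := gidx_bound t1.
suff : (gidx t + b)%:R <= N%:R :> R by lra.
rewrite ler_nat; case: b hb => hb; last by rewrite addn0 -ltnS gidx_le.
rewrite addn1 -(ltr_nat R).
have f0 : 0 < gfrac t by rewrite lt_neqAle eq_sym; have /andP[-> _] := gfrac_bound t1; rewrite andbT; exact/eqP/hb.
move: f0; rewrite /gfrac; lra.
Qed.

Lemma gwt_mean t : -1 <= t <= 1 -> \sum_j gwt j t * gval j = t.
Proof.
move=> t1; rewrite gwt_sum// big_bool/=.
have n0 := NR0.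
have E0 : gval (inord (gidx t), false) = (gidx t)%:R * 2 / N%:R - 1.
  by rewrite gval_step//= addn0.
have E1 : gfrac t * gval (inord (gidx t), true) = gfrac t * ((gidx t)%:R * 2 / N%:R + 2 / N%:R - 1).
  have [->|/eqP f0] := eqVneq (gfrac t) 0; first by rewrite !mul0r.
  by rewrite gval_step//= natrD; ring.
rewrite E0 E1 /gfrac /gpos; field; lra.
Qed.

Lemma gwt_near t j : -1 <= t <= 1 -> gwt j t != 0 -> `|t - gval j| <= 2 / N%:R.
Proof.
move=> t1; rewrite /gwt; case: (boolP (gidx t == j.1)) => [/eqP e|]; last by rewrite mul0r eqxx.
rewrite mul1r => h; have n0 := NR0.
have -> : j = (inord (gidx t), j.2).
  by case: j e {h} => i b /= e; congr pair; apply/val_inj; rewrite /= inordK ?gidx_le.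
rewrite gval_step//; last by move=> jb; move: h; rewrite jb => /eqP.
have /andP[f0 f1] := gfrac_bound t1.
have -> : t - ((gidx t + j.2)%:R * 2 / N%:R - 1) = (gfrac t - (j.2)%:R) * (2 / N%:R).
  by rewrite /gfrac /gpos natrD; field; lra.
rewrite normrM [X in _ * X]ger0_norm ?divr_ge0// ler_piMl ?divr_ge0//.
by rewrite ler_norml; case: j.2; rewrite ?subr0 /=; apply/andP; split; lra.
Qed.

End Channel_grid.

Section BMS_channel.
Context (R : realType) d (Y : measurableType d) (mu : {measure set Y -> \bar R}).
Variables (p : bool -> Y -> R) (N : nat).
Hypothesis bms : bms_channel mu p.
Hypothesis N0 : (0 < N)%N.
Implicit Types (y : Y).

Let p0 x y : 0 <= p x y. Proof. by case: bms. Qed.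
Let mp x : measurable_fun setT (p x). Proof. by case: bms. Qed.
Let ip x : (\int[mu]_y (p x y)%:E)%E = 1%E. Proof. by case: bms. Qed.

Definition half y : R := (p false y + p true y) / 2.
Definition tv y : R := Defs.tval p y.

Lemma ge0_half y : 0 <= half y. Proof. by rewrite divr_ge0// addr_ge0. Qed.

Lemma tv_bound y : -1 <= tv y <= 1.
Proof.
have a0 := p0 false y; have b0 := p0 true y.
rewrite /tv /Defs.tval; have [->|n0] := eqVneq (p false y + p true y) 0.
  by rewrite invr0 mulr0; apply/andP; split; lra.
have s0 : 0 < p false y + p true y by rewrite lt_neqAle eq_sym n0 addr_ge0.
by rewrite ler_pdivlMr// ler_pdivrMr//; apply/andP; split; lra.
Qed.

(** The channel read as an observation: the output has density [half], and given [y] the bias is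
    [tv y]. Where both densities vanish, [tv y] is 0 by the convention on division and the identity
    persists. *)
Lemma p_half x y : p x y = half y * (1 + tv y * sgb R x).
Proof.
have a0 := p0 false y; have b0 := p0 true y.
rewrite /half /tv /Defs.tval; have [e|n0] := eqVneq (p false y + p true y) 0.
  by rewrite e mul0r mul0r; case: x; lra.
by case: x; rewrite /sgb; field.
Qed.

Lemma measurable_half : measurable_fun setT half.
Proof.
apply: (@measurable_funM _ _ _ _ (fun y => p false y + p true y) (cst 2^-1)) => //.
exact: measurable_funD.
Qed.

Lemma measurable_tv : measurable_fun setT tv.
Proof.
have -> : tv = (fun y => (p false y - p true y) * (p false y + p true y) `^ (-1)).
  by apply/funext => y; rewrite /tv /Defs.tval powR_inv1// addr_ge0.
apply: measurable_funM; first exact: measurable_funB.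
exact: (measurableT_comp (@measurable_powR R (-1)) (measurable_funD (mp false) (mp true))).
Qed.

Lemma int_half : (\int[mu]_y (half y)%:E = 1)%E.
Proof.
under eq_integral do rewrite /half mulrC EFinM.
rewrite ge0_integralZl//=; last first.
- by move=> y _; rewrite lee_fin addr_ge0.
- by apply/measurable_EFinP; exact: measurable_funD.
under eq_integral do rewrite EFinD.
rewrite ge0_integralD//=; last 4 first.
- by move=> y _; rewrite lee_fin.
- exact/measurable_EFinP.
- by move=> y _; rewrite lee_fin.
- exact/measurable_EFinP.
by rewrite !ip -EFinD -EFinM; congr EFin; lra.
Qed.

Lemma measurable_gwt (j : 'I_N.+1 * bool) (f : Y -> R) :
  measurable_fun setT f -> (forall y, -1 <= f y <= 1) ->
  measurable_fun setT (fun y => gwt j (f y)).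
Proof.
move=> mf f1.
have mg : measurable_fun setT (fun y => gpos N (f y)).
  apply: measurable_funM => //; apply: measurable_funM => //.
  exact: measurable_funD.
have -> : (fun y => gwt j (f y)) = (fun y => if ((j.1 : nat)%:R <= gpos N (f y)) && (gpos N (f y) < j.1.+1%:R)
    then (if j.2 then gpos N (f y) - (j.1 : nat)%:R else 1 - (gpos N (f y) - (j.1 : nat)%:R)) else 0).
  apply/funext => y; rewrite /gwt.
  case: (boolP (gidx N (f y) == j.1 :> nat)) => [/eqP e|ne].
    by rewrite mul1r /gfrac e; have := gidx_bound N0 (f1 y); rewrite e => ->.
  rewrite mul0r; case: ifP => // /truncn_def h.
  by move: ne; rewrite /gidx h eqxx.
apply: measurable_fun_ifT.
- by apply: measurable_and; [exact: measurable_fun_ler|exact: measurable_fun_ltr].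
- by case: j.2; repeat apply: measurable_funB => //.
- exact: measurable_cst.
Qed.

Definition wint (j : 'I_N.+1 * bool) : \bar R := (\int[mu]_y (half y * gwt j (tv y))%:E)%E.
Definition wfin j : R := fine (wint j).

Lemma gwt_le1 (j : 'I_N.+1 * bool) (t : R) : -1 <= t <= 1 -> gwt j t <= 1.
Proof.
move=> t1; rewrite -(gwt_sum1 N0 t1) (bigD1 j)//= lerDl.
by apply: sumr_ge0 => i _; exact: ge0_gwt.
Qed.

(** The output involution preserves [mu] and [half] and changes the sign of [tv]. *)
Lemma wint_neg j : (\int[mu]_y (half y * gwt j (- tv y))%:E = wint j)%E.
Proof.
have [_ _ _ [sg [msg sK smu spq]]] := bms.
have hs y : half (sg y) = half y by rewrite /half (spq (sg y)) sK -(spq y) addrC.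
have ts y : tv (sg y) = - tv y.
  by rewrite /tv /Defs.tval (spq (sg y)) sK -(spq y) -mulNr opprB [p true y + p false y]addrC.
have -> : (\int[mu]_y (half y * gwt j (- tv y))%:E =
   \int[mu]_(y in sg @^-1` setT) ((fun y => (half y * gwt j (tv y))%:E) \o sg) y)%E.
  by rewrite preimage_setT; apply: eq_integral => y _ /=; rewrite hs ts.
rewrite -(ge0_integral_pushforward msg)//=; last 2 first.
- apply/measurable_EFinP; apply: measurable_funM; first exact: measurable_half.
  by apply: measurable_gwt; [exact: measurable_tv|exact: tv_bound].
- by move=> y _; rewrite lee_fin mulr_ge0 ?ge0_half ?ge0_gwt ?tv_bound.
apply: eq_measure_integral => A mA _.
exact: smu.
Qed.

Lemma wint_fin j : wint j \is a fin_num.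
Proof.
rewrite ge0_fin_numE; last first.
  by apply: integral_ge0 => y _; rewrite lee_fin mulr_ge0 ?ge0_half ?ge0_gwt ?tv_bound.
apply: (@le_lt_trans _ _ (\int[mu]_y (half y)%:E)%E); last by rewrite int_half ltry.
apply: ge0_le_integral_any => y.
  by rewrite lee_fin mulr_ge0 ?ge0_half ?ge0_gwt ?tv_bound.
by rewrite lee_fin ler_piMr ?ge0_half// gwt_le1 ?tv_bound.
Qed.

Lemma integrable_wt (j : 'I_N.+1 * bool) (f : Y -> R) : (f = tv \/ f = (fun y => - tv y)) ->
  mu.-integrable setT (fun y => (half y * gwt j (f y))%:E).
Proof.
move=> hf.
have f1 y : -1 <= f y <= 1 by have := tv_bound y; case: hf => ->; lra.
have mf : measurable_fun setT f.
  by case: hf => ->; [exact: measurable_tv|apply: measurableT_comp => //; exact: measurable_tv].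
apply/integrableP; split.
  apply/measurable_EFinP; apply: measurable_funM; first exact: measurable_half.
  exact: measurable_gwt.
have -> : (\int[mu]_x `|(half x * gwt j (f x))%:E| = \int[mu]_y (half y * gwt j (f y))%:E)%E.
  by apply: eq_integral => y _; rewrite gee0_abs// lee_fin mulr_ge0 ?ge0_half ?ge0_gwt// f1.
have -> : (\int[mu]_y (half y * gwt j (f y))%:E = wint j)%E.
  by case: hf => ->; [|exact: wint_neg].
have := wint_fin j; rewrite ge0_fin_numE//.
by apply: integral_ge0 => y _; rewrite lee_fin mulr_ge0 ?ge0_half ?ge0_gwt ?tv_bound.
Qed.

Lemma grid_integral (c1 c2 : 'I_N.+1 * bool -> R) :
  (\int[mu]_y (\sum_j (2^-1 * c1 j * (half y * gwt j (tv y))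
     + 2^-1 * c2 j * (half y * gwt j (- tv y))))%:E
   = (\sum_j wfin j * (2^-1 * (c1 j + c2 j)))%:E)%E.
Proof.
have i1 j := integrable_wt j (or_introl erefl).
have i2 j := integrable_wt j (or_intror erefl).
have spl j y : (2^-1 * c1 j * (half y * gwt j (tv y)) + 2^-1 * c2 j * (half y * gwt j (- tv y)))%:E =
   ((2^-1 * c1 j)%:E * (half y * gwt j (tv y))%:E + (2^-1 * c2 j)%:E * (half y * gwt j (- tv y))%:E)%E.
  by rewrite -!EFinM -EFinD.
under eq_integral do rewrite -sumEFin.
rewrite integral_sum//=; last first.
  move=> j; under eq_fun do rewrite spl.
  by apply: integrableD => //; apply: integrableZl.
rewrite -sumEFin; apply: eq_bigr => j _.
under eq_integral do rewrite spl.
rewrite integralD//=; [|exact: integrableZl|exact: integrableZl].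
rewrite !integralZl// wint_neg -/(wint j) -(fineK (wint_fin j)) -/(wfin j).
by rewrite -!EFinM -EFinD; congr EFin; ring.
Qed.

Definition chlaw : law R := [seq (wfin j, gval R j) | j <- enum {: 'I_N.+1 * bool}].

Lemma lawE_chlaw f : lawE chlaw f = \sum_j wfin j * f (gval R j).
Proof. by rewrite /lawE big_map big_enum. Qed.

Lemma is_law_chlaw : is_law chlaw.
Proof.
split.
  move=> m /mapP[j _ ->] /=; split; last exact: gval_bound.
  by apply: fine_ge0; apply: integral_ge0 => y _; rewrite lee_fin mulr_ge0 ?ge0_half ?ge0_gwt ?tv_bound.
rewrite lawE_chlaw.
have := grid_integral (fun=> 1) (fun=> 1).
have -> : (\int[mu]_y (\sum_(j : 'I_N.+1 * bool) (2^-1 * 1 * (half y * gwt j (tv y))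
     + 2^-1 * 1 * (half y * gwt j (- tv y))))%:E = 1)%E.
  transitivity (\int[mu]_y (half y)%:E)%E; last exact: int_half.
  apply: eq_integral => y _; congr EFin.
  have t1 := tv_bound y.
  transitivity (half y * (2^-1 * (\sum_(j : 'I_N.+1 * bool) gwt j (tv y) + \sum_(j : 'I_N.+1 * bool) gwt j (- tv y)))).
    by rewrite -big_split/= mulrA big_distrr/=; apply: eq_bigr => j _; ring.
  by rewrite !gwt_sum1//; lra.
move=> [h]; rewrite [RHS]h; apply: eq_bigr => j _; congr (_ * _); lra.
Qed.

(** [kappa (tv y)] is dominated by [c0] plus its interpolation from the grid points near [tv y], and
    likewise from the negatives of those near [- tv y]. Taking half of each yields the symmetric
    form that [grid_integral] evaluates. *)
Lemma grid_upper (kappa : R -> R) (c0 : R) (f : Y -> \bar R) :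
  (forall t g, -1 <= t <= 1 -> -1 <= g <= 1 -> `|t - g| <= 2 / N%:R -> kappa t <= kappa g + c0) ->
  (forall y, f y <= (half y * kappa (tv y))%:E)%E ->
  (\int[mu]_y f y <= (lawE chlaw (fun u => 2^-1 * (kappa u + kappa (- u))) + c0)%:E)%E.
Proof.
move=> hk hf.
have := grid_integral (fun j => kappa (gval R j) + c0) (fun j => kappa (- gval R j) + c0).
have -> : \sum_(j : 'I_N.+1 * bool) wfin j * (2^-1 * (kappa (gval R j) + c0 + (kappa (- gval R j) + c0))) =
    lawE chlaw (fun u => 2^-1 * (kappa u + kappa (- u))) + c0.
  rewrite -[X in _ + X](lawE_cst _ is_law_chlaw) -lawED lawE_chlaw.
  by apply: eq_bigr => j _; congr (_ * _); lra.
move=> <-; apply: le_integral_any => y; apply: le_trans (hf y) _; rewrite lee_fin.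
have t1 := tv_bound y; have t1' : -1 <= - tv y <= 1 by lra.
have k1 : kappa (tv y) <= \sum_(j : 'I_N.+1 * bool) gwt j (tv y) * (kappa (gval R j) + c0).
  rewrite -[leLHS]mul1r -(gwt_sum1 N0 t1) big_distrl; apply: ler_sum => j _ /=.
  have [->|n0] := eqVneq (gwt j (tv y)) 0; first by rewrite !mul0r.
  rewrite ler_wpM2l ?ge0_gwt//; apply: hk => //; first exact: gval_bound.
  exact: gwt_near.
have k2 : kappa (tv y) <= \sum_(j : 'I_N.+1 * bool) gwt j (- tv y) * (kappa (- gval R j) + c0).
  rewrite -[leLHS]mul1r -(gwt_sum1 N0 t1') big_distrl; apply: ler_sum => j _ /=.
  have [->|n0] := eqVneq (gwt j (- tv y)) 0; first by rewrite !mul0r.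
  rewrite ler_wpM2l ?ge0_gwt//; apply: hk => //; first by have := gval_bound R j; lra.
  by rewrite opprK -[X in `|X|]opprK normrN opprD; exact: gwt_near.
have h0 := ge0_half y.
have := ler_wpM2l h0 (lerD k1 k2).
have -> : half y * (\sum_(j : 'I_N.+1 * bool) gwt j (tv y) * (kappa (gval R j) + c0) + \sum_(j : 'I_N.+1 * bool) gwt j (- tv y) * (kappa (- gval R j) + c0)) =
  2 * \sum_(j : 'I_N.+1 * bool) (2^-1 * (kappa (gval R j) + c0) * (half y * gwt j (tv y))
     + 2^-1 * (kappa (- gval R j) + c0) * (half y * gwt j (- tv y))).
  by rewrite -big_split !big_distrr/=; apply: eq_bigr => j _; field.
lra.
Qed.

End BMS_channel.

Lemma sublin_sum (R : realType) (X : finType) (Psi : (X -> R) -> R) (J : Type) (r : seq J)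
    (a : J -> R) (w : J -> X -> R) : sublin Psi ->
  (forall j, 0 <= a j) -> (forall j, nneg (w j)) ->
  Psi (fun x => \sum_(j <- r) a j * w j x) <= \sum_(j <- r) a j * Psi (w j).
Proof.
move=> [sD sZ] a0 w0; elim: r => [|j r IH].
  have -> : (fun x => \sum_(j <- [::]) a j * w j x) = (fun x => 0 * (fun=> 0) x).
    by apply/funext => x; rewrite big_nil mul0r.
  by rewrite sZ// mul0r big_nil.
have -> : (fun x => \sum_(j <- j :: r) a j * w j x) =
    (fun x => (fun x => a j * w j x) x + (fun x => \sum_(j <- r) a j * w j x) x).
  by apply/funext => x; rewrite big_cons.
rewrite big_cons; apply: le_trans (sD _ _ _ _) _.
- exact: nneg_scale.
- by move=> x; apply: sumr_ge0 => i _; rewrite mulr_ge0//; apply: w0.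
by rewrite sZ// lerD2l.
Qed.

(** * Lower bound of the conditional entropy through the upgraded channel *)

Section Iterated.
Context (R : realType) d (Y : measurableType d) (mu : {measure set Y -> \bar R}).

Lemma iint_ext k (F G : seq Y -> \bar R) :
  (forall ys, size ys = k -> F ys = G ys) -> iint mu k F = iint mu k G.
Proof.
elim: k F G => [|k IH] F G h /=; first exact: h.
apply: eq_integral => y _; apply: IH => ys sys; apply: h.
by rewrite /= sys.
Qed.

Variables (p : bool -> Y -> R) (N n : nat).
Hypothesis bms : bms_channel mu p.
Hypothesis N0 : (0 < N)%N.
Local Notation X := (n.-tuple bool).
Local Notation ch := (chlaw mu p N).
Local Notation S := (@Sent R X).

Definition chobs (s : seq 'I_n) : seq (law R * (X -> R)) := [seq (ch, sg R i) | i <- s].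

Lemma valid_chobs s : valid (chobs s).
Proof. by apply: valid_map => i _; split; [exact: is_law_chlaw|exact: sg_spin]. Qed.

Lemma allchar_chobs s : allchar (chobs s).
Proof. by elim: s => //= i s IH; split => //; split; [exact: is_law_chlaw|exact: ischar_sg]. Qed.

Lemma EE_Sent_super s (J : Type) (r : seq J) (a : J -> R) (w : J -> X -> R) :
  (forall j, 0 <= a j) -> (forall j, nneg (w j)) ->
  \sum_(j <- r) a j * EE (chobs s) (w j) S <= EE (chobs s) (fun x => \sum_(j <- r) a j * w j x) S.
Proof.
move=> a0 w0; have := sublin_sum r (sublin_EE (valid_chobs s) (@sublin_NSent R X)) a0 w0.
have E v : EE (chobs s) v (fun w => - S w) = - EE (chobs s) v S.
  by rewrite -[RHS]mulN1r -EE_Z; apply: eq_EE => v'; rewrite mulN1r.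
rewrite E; under eq_bigr do rewrite E mulrN.
by rewrite sumrN lerN2.
Qed.

(** Upgrading lowers the entropy: for each output the likelihood weight is the mixture [wpE] of
    updates at grid biases, and [Sent] is superadditive. One output is integrated at a time. *)
Lemma iint_EE (s : seq 'I_n) w : nneg w ->
  ((EE (chobs s) w S)%:E <= iint mu (size s)
     (fun ys => (S (fun x => w x * \prod_(q <- zip s ys) p (tnth x q.1) q.2))%:E))%E.
Proof.
have [p0 _ _ _] := bms.
elim: s w => [|i s IH] w w0.
  rewrite /= lee_fin le_eqVlt; apply/orP; left; apply/eqP; congr (S _).
  by apply/funext => x; rewrite big_nil mulr1.
pose up g := upd w (sg R i) g.
have gv j : -1 <= gval R (j : 'I_N.+1 * bool) <= 1 by exact: gval_bound.
have gv' j : -1 <= - gval R (j : 'I_N.+1 * bool) <= 1 by have := gv j; lra.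
have up0 g : -1 <= g <= 1 -> nneg (up g) by move=> g1; apply: upd_nneg => //; exact: sg_spin.
have -> : EE (chobs (i :: s)) w S = \sum_j wfin mu p j *
   (2^-1 * (EE (chobs s) (up (gval R (j : 'I_N.+1 * bool))) S + EE (chobs s) (up (- gval R j)) S)).
  by rewrite /= /Ob lawE_chlaw.
rewrite -(grid_integral bms N0) /=; apply: le_integral_any => y.
have wpE : (fun x => w x * p (tnth x i) y) =
   (fun x => \sum_(jb : ('I_N.+1 * bool) * bool)
      (2^-1 * half p y * gwt jb.1 (if jb.2 then tv p y else - tv p y)) *
      up (if jb.2 then gval R jb.1 else - gval R jb.1) x).
  apply/funext => x; have t1 := tv_bound bms y.
  have t1' : -1 <= - tv p y <= 1 by lra.
  rewrite -(pair_bigA _ (fun (j : 'I_N.+1 * bool) (b : bool) => (2^-1 * half p y * gwt j (if b then tv p y else - tv p y)) *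
      up (if b then gval R j else - gval R j) x))/=.
  under eq_bigr do rewrite big_bool/=.
  transitivity (\sum_(j : 'I_N.+1 * bool) (2^-1 * half p y * w x) * (gwt j (tv p y) * 1 + gwt j (- tv p y) * 1 +
     sg R i x * (gwt j (tv p y) * gval R j) - sg R i x * (gwt j (- tv p y) * gval R j))).
    rewrite -big_distrr/= sumrB !big_split/= -!big_distrr/=.
    have s1 := gwt_sum1 N0 t1; have s2 := gwt_sum1 N0 t1'.
    under eq_bigr do rewrite mulr1; under [\sum_i gwt i (- _) * 1]eq_bigr do rewrite mulr1.
    by rewrite s1 s2 !gwt_mean// (p_half bms) /sg; field.
  by apply: eq_bigr => j _; rewrite /up /upd; ring.
have wp0 : nneg (fun x => w x * p (tnth x i) y) by move=> x; rewrite mulr_ge0.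
apply: (@le_trans _ _ (EE (chobs s) (fun x => w x * p (tnth x i) y) S)%:E); last first.
  apply: le_trans (IH _ wp0) _; rewrite le_eqVlt; apply/orP; left; apply/eqP.
  apply: iint_ext => ys _; congr (S _)%:E; apply/funext => x.
  by rewrite big_cons/= mulrA.
rewrite lee_fin wpE.
have h0 := ge0_half bms y; have t1 := tv_bound bms y.
pose a (jb : ('I_N.+1 * bool) * bool) := 2^-1 * half p y * gwt jb.1 (if jb.2 then tv p y else - tv p y).
pose v (jb : ('I_N.+1 * bool) * bool) := up (if jb.2 then gval R jb.1 else - gval R jb.1).
have a0 jb : 0 <= a jb.
  rewrite /a mulr_ge0//; first by rewrite mulr_ge0 ?invr_ge0.
  by apply: (ge0_gwt N0); case: jb.2; lra.
have v0 jb : nneg (v jb) by apply: up0; case: jb.2.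
apply: le_trans (EE_Sent_super s (index_enum _) a0 v0).
rewrite (eq_bigr (fun jb => a (jb.1, jb.2) * EE (chobs s) (v (jb.1, jb.2)) S)); last by case.
rewrite -(pair_bigA _ (fun (j : 'I_N.+1 * bool) (b : bool) => a (j, b) * EE (chobs s) (v (j, b)) S))/=.
apply: ler_sum => j _; rewrite big_bool/= /a /v/=.
by rewrite le_eqVlt; apply/orP; left; apply/eqP; ring.
Qed.

Lemma zip_enum (ys : seq Y) x : size ys = n ->
  \prod_(q <- zip (enum 'I_n) ys) p (tnth x q.1) q.2 = Wlik p (x : X) ys.
Proof.
move=> sy; rewrite /Wlik.
have -> : zip (enum 'I_n) ys = [seq (i, nth point ys (i : 'I_n)) | i <- enum 'I_n].
  have {1}-> : ys = [seq nth point ys (i : 'I_n) | i <- enum 'I_n].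
    apply: (@eq_from_nth _ point); first by rewrite size_map size_enum_ord.
    move=> k; rewrite sy => kn.
    by rewrite (nth_map (Ordinal kn)) ?size_enum_ord// nth_enum_ord.
  rewrite -[X in zip X _]map_id zip_map //.
by rewrite big_map big_enum.
Qed.

Lemma cond_entropy_chan (C : {set X}) : C != finset.set0 ->
  ((EE (chobs (enum 'I_n)) (unif R C) S)%:E <= cond_entropy mu p C)%E.
Proof.
move=> C0; apply: le_trans (iint_EE (enum 'I_n) (@nneg_unif R n C)) _.
rewrite size_enum_ord le_eqVlt; apply/orP; left; apply/eqP.
apply: iint_ext => ys sy; congr EFin.
pose w (x : X) := (x \in C)%:R * Wlik p x ys.
have -> : (fun x => unif R C x * \prod_(q <- zip (enum 'I_n) ys) p (tnth x q.1) q.2) =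
   (fun x => #|C|%:R^-1 * w x).
  by apply/funext => x; rewrite zip_enum// /unif /w; ring.
rewrite SentZ ?invr_ge0//; congr (_ * _).
have mw : mass w = \sum_(x in C) Wlik p x ys.
  rewrite /mass [RHS]big_mkcond; apply: eq_bigr => x _; rewrite /w.
  by case: (x \in C); rewrite ?mul1r ?mul0r.
rewrite /Sent mw [RHS]big_mkcond; apply: eq_bigr => x _; rewrite /w.
by case: (x \in C); rewrite ?mul1r ?mul0r.
Qed.

Definition zerox : X := [tuple false | i < n].

(** The uniform weight on the code is exchanged for the uniform weight on all words with the
    parities observed exactly, and [EE_Sent] applies. The term [n%:R * ln 2] is minus the sum of
    [eta] over the entries 2^-n, and each parity subtracts [gfun 1 = ln 2]. *)
Lemma cond_entropy_ge (chis : seq (X -> R)) (C : {set X}) :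
  (forall chi, List.In chi chis -> ischar chi /\ chi zerox = 1) ->
  (forall x, (x \in C) = all (fun chi => chi x == 1) chis) ->
  ((EE ([seq (hard R, chi) | chi <- chis] ++ chobs (enum 'I_n)) (@u0 R n) PhiF
     + n%:R * ln 2 - (size chis)%:R * ln 2 - n%:R * lawE ch (@gfun R))%:E
   <= cond_entropy mu p C)%E.
Proof.
move=> hc CE.
have zC : zerox \in C.
  rewrite CE; elim: chis hc {CE} => //= chi s IH h.
  by rewrite (h chi (or_introl erefl)).2 eqxx IH// => chi' h'; apply: h; right.
have C0 : C != finset.set0 by apply/set0Pn; exists zerox.
apply: le_trans (cond_entropy_chan C0); rewrite lee_fin.
have CT : C = finset.setT :&: [set x | all (fun chi => chi x == 1) chis]%SET.
  by apply/setP => x; rewrite !inE CE.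
have aC := allchar_chobs (enum 'I_n).
have uT : unif R (finset.setT : {set X}) = @u0 R n.
  apply/funext => x; rewrite /unif /u0 inE cardsT card_tuple card_bool mul1r natrX.
  by rewrite exprVn.
have cT : xclosed (finset.setT : {set X}) by move=> x y _ _; rewrite inE.
rewrite CT -(EE_hards_unif (x0 := zerox) hc aC cT) ?inE// uT.
have aL : allchar ([seq (hard R, chi) | chi <- chis] ++ chobs (enum 'I_n)).
  elim: chis hc {CE CT} => [|chi s IH] h //=; split.
    by split; [exact: is_law_hard|exact: (h chi (or_introl erefl)).1].
  by apply: IH => chi' h'; apply: h; right.
rewrite EE_Sent; last 3 first.
- exact: allchar_valid.
- exact: nneg_u0.
- move=> o; elim: (_ ++ _) aL => //= o' L IH [[_ [pm _]] aL] [<-//|/IH]; exact.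
rewrite mass_u0 mulr1 big_cat/= !big_map/=.
rewrite [\sum_(j <- chis) _](eq_bigr (fun=> ln 2)); last by move=> chi _; rewrite lawE_hard gfun1.
rewrite !big_const_seq !count_predT !iter_addr_0 -enumT size_enum_ord.
have -> : \sum_x eta (@u0 R n x) = - (n%:R * ln 2).
  rewrite /u0 sumr_const card_tuple card_bool /eta.
  have -> : ln (2^-1 ^+ n) = - (n%:R * ln 2) :> R.
    by rewrite lnXn ?invr_gt0// lnV ?posrE// mulNrn mulr_natl.
  rewrite -[LHS]mulr_natl mulrA natrX -exprMn mulfV ?expr1n ?mul1r//.
rewrite -[ln 2 *+ _]mulr_natl -[lawE _ _ *+ _]mulr_natl; lra.
Qed.

End Iterated.

(** * Symmetric laws in the variable tanh V *)

Section Tanh.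
Variable R : realType.
Implicit Types (v t : R).

Lemma tanhR_bound v : -1 < tanhR v < 1.
Proof.
have a := expR_gt0 v; have b := expR_gt0 (- v).
rewrite /tanhR; have s : 0 < expR v + expR (- v) by lra.
by rewrite ltr_pdivlMr// ltr_pdivrMr//; apply/andP; split; lra.
Qed.

Lemma tanhR_bound_le v : -1 <= tanhR v <= 1.
Proof. by have := tanhR_bound v; lra. Qed.

Lemma tanhRN v : tanhR (- v) = - tanhR v.
Proof. by rewrite /tanhR opprK -mulNr opprB addrC [expR v + _]addrC. Qed.

Lemma tanhR_expR v : (1 + tanhR v) * expR (-2 * v) = 1 - tanhR v.
Proof.
have a := expR_gt0 v; have b := expR_gt0 (- v).
have -> : expR (-2 * v) = expR (- v) / expR v.
  by rewrite -expRN -expRD; congr expR; lra.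
by rewrite /tanhR; field; rewrite !gt_eqF//; lra.
Qed.

Lemma measurable_tanhR : measurable_fun setT (@tanhR R).
Proof.
have m1 : measurable_fun setT (fun v : R => expR (- v)).
  by apply: measurableT_comp => //; exact: measurable_expR.
have -> : @tanhR R = (fun v => (expR v - expR (- v)) * (expR v + expR (- v)) `^ (-1)).
  by apply/funext => v; rewrite /tanhR powR_inv1// addr_ge0// expR_ge0.
apply: measurable_funM; first by apply: measurable_funB => //; exact: measurable_expR.
by apply: (measurableT_comp (@measurable_powR R (-1))); apply: measurable_funD => //; exact: measurable_expR.
Qed.

End Tanh.

Section Symmetric.
Import HBNNSimple.
Variables (R : realType) (dV : probability R R).
Hypothesis sym : symmetric_law dV.
Local Open Scope ereal_scope.

Let E2 (v : R) : R := expR (-2 * v).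

Let mE2 : measurable_fun setT (EFin \o E2).
Proof.
apply/measurable_EFinP; apply: (measurableT_comp (@measurable_expR R)).
by apply: measurable_funM.
Qed.

Lemma sym_indic (A : set R) : measurable A ->
  \int[dV]_v (\1_A (- v)%R)%:E = \int[dV]_v ((\1_A v)%:E * (E2 v)%:E).
Proof.
move=> mA; have := sym mA.
have -> : [set (- v)%R | v in A] = (fun v : R => (- v)%R) @^-1` A.
  apply/seteqP; split => [_ [v Av <-]|v /= Av]; first by rewrite /= opprK.
  by exists (- v)%R; rewrite ?opprK.
have mNA : measurable ((fun v : R => (- v)%R) @^-1` A).
  rewrite -[X in measurable X]setTI; exact: (@oppr_measurable R setT measurableT A mA).
move=> e; transitivity (dV ((fun v : R => (- v)%R) @^-1` A)).
  by rewrite -[X in dV X]setIT; exact: integral_indic.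
rewrite e integral_mkcond; apply: eq_integral => v _.
by rewrite patchE indicE; case: (v \in A); rewrite ?mul1e ?mul0e.
Qed.

(** From indicators, where it is [symmetric_law], to simple functions by linearity, and to the limit
    by monotone convergence. *)
Lemma sym_int (g : R -> \bar R) : measurable_fun setT g -> (forall v, 0 <= g v) ->
  \int[dV]_v g (- v)%R = \int[dV]_v (g v * (E2 v)%:E).
Proof.
move=> mg g0; pose h := nnsfun_approx measurableT mg.
have mopp : measurable_fun setT (fun v : R => (- v)%R) by exact: oppr_measurable.
have mh n : measurable_fun setT (EFin \o h n).
  exact/measurable_EFinP/measurable_funP.
have hg v : g v = lim ((EFin \o h n) v @[n --> \oo]).
  by apply/esym/cvg_lim => //; apply: cvg_nnsfun_approx.
have E20 v : (0 <= E2 v)%R by exact: expR_ge0.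
have -> : \int[dV]_v g (- v)%R = lim (\int[dV]_v (EFin \o h n) (- v)%R @[n --> \oo]).
  under eq_integral => v _ do rewrite hg.
  apply: monotone_convergence => //.
  - by move=> n; exact: (measurableT_comp (mh n) mopp).
  - by move=> n v _ /=; rewrite lee_fin.
  - by move=> v _ a b ab; rewrite lee_fin; exact/lefP/nd_nnsfun_approx.
have -> : \int[dV]_v (g v * (E2 v)%:E) = lim (\int[dV]_v ((EFin \o h n) v * (E2 v)%:E) @[n --> \oo]).
  have fg v : g v * (E2 v)%:E = lim (((EFin \o h n) v * (E2 v)%:E) @[n --> \oo]).
    apply/esym/cvg_lim => //; apply: cvgeZr => //.
    by apply: cvg_nnsfun_approx.
  under eq_integral => v _ do rewrite fg.
  apply: monotone_convergence => //.
  - by move=> n; exact: (emeasurable_funM (mh n) mE2).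
  - by move=> n v _ /=; rewrite mule_ge0 ?lee_fin.
  - by move=> v _ a b ab; rewrite lee_wpmul2r ?lee_fin//; exact/lefP/nd_nnsfun_approx.
suff suf n : \int[dV]_v (EFin \o h n) (- v)%R = \int[dV]_v ((EFin \o h n) v * (E2 v)%:E).
  by under eq_fun do rewrite suf.
have hE v : (EFin \o h n) v = \sum_(y \in range (h n)) (y * \1_(h n @^-1` [set y]) v)%:E.
  by rewrite /= [in LHS]fimfunE -fsumEFin.
have mset r : measurable (h n @^-1` [set r]) by exact: measurable_sfunP.
have mind r : measurable_fun setT (fun v : R => (\1_(h n @^-1` [set r]) v : R)).
  exact: measurable_indic.
have y0 r v : (0 <= r * \1_(h n @^-1` [set r]) v :> R)%R.
  by rewrite -lee_fin; exact: nnfun_muleindic_ge0.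
transitivity (\int[dV]_v \sum_(y \in range (h n)) (y * \1_(h n @^-1` [set y]) (- v)%R)%:E).
  by apply: eq_integral => v _; exact: hE.
rewrite ge0_integral_fsum//; last 2 first.
- move=> y; apply/measurable_EFinP; apply: measurable_funM => //.
  exact: (measurableT_comp (mind y) mopp).
- by move=> y v _; rewrite lee_fin.
transitivity (\int[dV]_v \sum_(y \in range (h n)) ((y * \1_(h n @^-1` [set y]) v)%:E * (E2 v)%:E)); last first.
  apply: eq_integral => v _; rewrite hE ge0_mule_fsuml// => y.
  by rewrite lee_fin.
rewrite ge0_integral_fsum//; last 2 first.
- move=> y; apply: emeasurable_funM => //; apply/measurable_EFinP; exact: measurable_funM.
- by move=> y v _; rewrite mule_ge0 ?lee_fin.
apply: eq_fsbigr => y /set_mem [v0 _ yE].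
have yge0 : (0 <= y)%R by rewrite -yE.
under eq_integral do rewrite EFinM.
rewrite ge0_integralZl//; last by apply/measurable_EFinP; exact: (measurableT_comp (mind y) mopp).
under [RHS]eq_integral do rewrite EFinM -muleA.
rewrite ge0_integralZl//; last 2 first.
- by apply: emeasurable_funM => //; apply/measurable_EFinP.
- by move=> v _; rewrite mule_ge0 ?lee_fin.
by rewrite sym_indic.
Qed.

End Symmetric.

Section Even_reduction.
Variables (R : realType) (dV : probability R R).
Hypothesis sym : symmetric_law dV.

(** Conditional expectation of [f] given the absolute value of t = tanh V: under a symmetric law the
    sign is positive with probability (1+|t|)/2. The expression is even in [t]. *)
Definition symf (f : R -> R) (t : R) : R := 2^-1 * ((1 + t) * f t + (1 - t) * f (- t)).

(** By [tanhR_expR] the share [b] of the integrand, weighted by (1-t)/2, is [g v] times e^(-2v), so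
    the symmetry of the law carries it to the reflection of [g]. *)
Lemma sym_tanh (f : R -> R) : measurable_fun setT (fun v => f (tanhR v)) ->
  (forall t, -1 < t < 1 -> 0 <= f t) ->
  (\int[dV]_v (f (tanhR v))%:E = \int[dV]_v (symf f (tanhR v))%:E)%E.
Proof.
move=> mf f0; have tb := @tanhR_bound R.
have mt : measurable_fun setT (@tanhR R) by exact: measurable_tanhR.
have mopp : measurable_fun setT (fun v : R => - v) by exact: oppr_measurable.
pose g v := 2^-1 * (1 + tanhR v) * f (tanhR v).
have mg : measurable_fun setT g.
  apply: (@measurable_funM _ _ _ _ (fun v => 2^-1 * (1 + tanhR v)) (fun v => f (tanhR v))) => //.
  by apply: measurable_funM => //; exact: measurable_funD.
have g0 v : 0 <= g v by rewrite !mulr_ge0 ?invr_ge0 ?f0 ?tb//; have := tb v; lra.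
pose b v := 2^-1 * (1 - tanhR v) * f (tanhR v).
have mb : measurable_fun setT b.
  apply: (@measurable_funM _ _ _ _ (fun v => 2^-1 * (1 - tanhR v)) (fun v => f (tanhR v))) => //.
  by apply: measurable_funM => //; exact: measurable_funB.
have b0 v : 0 <= b v by rewrite !mulr_ge0 ?invr_ge0 ?f0 ?tb//; have := tb v; lra.
have bE : (\int[dV]_v (b v)%:E = \int[dV]_v (g (- v))%:E)%E.
  rewrite (sym_int sym (g := fun v => (g v)%:E))//; last exact/measurable_EFinP.
  apply: eq_integral => v _; rewrite -EFinM; congr EFin; rewrite /b /g.
  by rewrite -tanhR_expR; ring.
transitivity (\int[dV]_v ((g v)%:E + (b v)%:E))%E.
  by apply: eq_integral => v _; rewrite -EFinD /g /b; congr EFin; field.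
rewrite ge0_integralD//=; last 4 first.
- by move=> v _; rewrite lee_fin.
- exact/measurable_EFinP.
- by move=> v _; rewrite lee_fin.
- exact/measurable_EFinP.
rewrite bE -ge0_integralD//=; last 4 first.
- by move=> v _; rewrite lee_fin.
- exact/measurable_EFinP.
- by move=> v _; rewrite lee_fin.
- by apply/measurable_EFinP; exact: (measurableT_comp mg mopp).
by apply: eq_integral => v _; rewrite -EFinD /g /symf tanhRN; congr EFin; ring.
Qed.

Definition lipk (K C : R) (f : R -> R) : Prop :=
  (forall x y, -1 <= x <= 1 -> -1 <= y <= 1 -> `|f x - f y| <= K * `|x - y|) /\
  (forall x, -1 <= x <= 1 -> `|f x| <= C).

(** Extends a function that is Lipschitz on [-1, 1] to a continuous one on the line, which gives
    measurability in [lip_measurable]. *)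
Definition clamp (x : R) : R := Num.max (-1) (Num.min 1 x).

Lemma clamp_bound x : -1 <= clamp x <= 1.
Proof. by rewrite /clamp le_max lexx/= ge_max ge_min lexx/= andbT; lra. Qed.

Lemma clamp_id x : -1 <= x <= 1 -> clamp x = x.
Proof. by move=> /andP[a b]; rewrite /clamp; rewrite (min_idPr b) (max_idPr a). Qed.

Lemma clamp_lip x y : `|clamp x - clamp y| <= `|x - y|.
Proof.
have := ler_norm (x - y); have := ler_norm (y - x); rewrite (distrC y x) => h1 h2.
have h3 := normr_ge0 (x - y).
have E z : (z <= -1) /\ clamp z = -1 \/ (1 <= z) /\ clamp z = 1 \/ (-1 <= z <= 1) /\ clamp z = z.
  case: (lerP z (-1)) => [l|l].
    left; split => //; rewrite /clamp (min_idPr _); last lra.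
    by apply/max_idPl.
  case: (lerP 1 z) => [u|u]; last by right; right; split; [lra|rewrite clamp_id//; lra].
  right; left; split => //; rewrite /clamp (min_idPl _)//.
  by apply/max_idPr; lra.
rewrite ler_norml.
by case: (E x) => [[a ->]|[[a ->]|[a ->]]]; case: (E y) => [[b ->]|[[b ->]|[b ->]]]; lra.
Qed.

Lemma lip_measurable K C f : lipk K C f -> measurable_fun setT (fun v : R => f (tanhR v)).
Proof.
move=> [fl fC].
have K0 : 0 <= K.
  have := fl 1 0 ltac:(lra) ltac:(lra); rewrite subr0 normr1 mulr1; exact: le_trans.
have cf : continuous (fun x : R => f (clamp x)).
  move=> x; apply/cvgrPdist_le => /= e e0.
  exists (e / (K + 1)) => /=; first by rewrite divr_gt0//; lra.
  move=> y /= xy; apply: le_trans (fl _ _ (clamp_bound x) (clamp_bound y)) _.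
  apply: (@le_trans _ _ ((K + 1) * `|x - y|)).
    apply: ler_pM => //; [lra|exact: clamp_lip].
  by rewrite mulrC -ler_pdivlMr ?ltW//; lra.
have -> : (fun v : R => f (tanhR v)) = (fun x => f (clamp x)) \o @tanhR R.
  by apply/funext => v /=; rewrite clamp_id// tanhR_bound_le.
apply: measurableT_comp; last exact: measurable_tanhR.
exact: continuous_measurable_fun.
Qed.

Definition EV (f : R -> R) : R := fine (\int[dV]_v (f (tanhR v))%:E)%E.

Lemma lip_integrable K C f : lipk K C f -> dV.-integrable setT (fun v => (f (tanhR v))%:E).
Proof.
move=> hl; have [fl fC] := hl; apply/integrableP; split.
  by apply/measurable_EFinP; exact: lip_measurable hl.
apply: (@le_lt_trans _ _ (\int[dV]_v (cst C%:E v))%E).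
  by apply: le_integral_any => v; rewrite /= lee_fin fC// tanhR_bound_le.
by rewrite integral_cst//= probability_setT mule1 ltry.
Qed.

Lemma EV_int K C f : lipk K C f -> (\int[dV]_v (f (tanhR v))%:E = (EV f)%:E)%E.
Proof.
by move=> hl; rewrite /EV fineK//; apply: integrable_fin_num => //; exact: lip_integrable hl.
Qed.

Lemma EV_le K C K' C' f g : lipk K C f -> lipk K' C' g ->
  (forall t, -1 <= t <= 1 -> f t <= g t) -> EV f <= EV g.
Proof.
move=> hf hg fg; rewrite -lee_fin -(EV_int hf) -(EV_int hg).
by apply: le_integral_any => v; rewrite lee_fin fg// tanhR_bound_le.
Qed.

Lemma EV_lin K C K' C' a b f g : lipk K C f -> lipk K' C' g ->
  EV (fun t => a * f t + b * g t) = a * EV f + b * EV g.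
Proof.
move=> hf hg; rewrite {1}/EV.
under eq_integral do rewrite EFinD !EFinM.
rewrite integralD//=; last 2 first.
- by apply: integrableZl => //; exact: lip_integrable hf.
- by apply: integrableZl => //; exact: lip_integrable hg.
rewrite !integralZl//; [|exact: lip_integrable hg|exact: lip_integrable hf].
by rewrite (EV_int hf) (EV_int hg).
Qed.

Lemma EV_cst c : EV (fun=> c) = c.
Proof. by rewrite /EV integral_cst//= probability_setT mule1. Qed.

Lemma lip_cst c : lipk 0 `|c| (fun=> c).
Proof. by split=> [x y _ _|x _]; rewrite ?subrr ?normr0 ?mul0r. Qed.

Lemma lipD K C K' C' f g : lipk K C f -> lipk K' C' g -> lipk (K + K') (C + C') (fun t => f t + g t).
Proof.
move=> [fl fC] [gl gC]; split=> [x y x1 y1|x x1]; last first.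
  by apply: le_trans (ler_normD _ _) _; apply: lerD; [exact: fC|exact: gC].
have -> : f x + g x - (f y + g y) = (f x - f y) + (g x - g y) by ring.
by apply: le_trans (ler_normD _ _) _; rewrite mulrDl; apply: lerD; [exact: fl|exact: gl].
Qed.

Lemma EV_near K C K' C' e f g : lipk K C f -> lipk K' C' g ->
  (forall t, -1 <= t <= 1 -> `|f t - g t| <= e) -> `|EV f - EV g| <= e.
Proof.
move=> hf hg fg.
have E h Kh Ch : lipk Kh Ch h -> EV (fun t => h t + e) = EV h + e.
  move=> hh; have := EV_lin 1 1 hh (lip_cst e); rewrite !mul1r EV_cst => <-.
  by congr EV; apply/funext => t; rewrite !mul1r.
have h1 : EV f <= EV (fun t => g t + e).
  apply: (EV_le hf (lipD hg (lip_cst e))) => t t1.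
  by have := fg t t1; rewrite ler_norml; lra.
have h2 : EV g <= EV (fun t => f t + e).
  apply: (EV_le hg (lipD hf (lip_cst e))) => t t1.
  by have := fg t t1; rewrite ler_norml; lra.
rewrite (E _ _ _ hg) in h1; rewrite (E _ _ _ hf) in h2.
by rewrite ler_norml; lra.
Qed.

Lemma lip_symf K C f : lipk K C f -> lipk (K + C) C (symf f).
Proof.
move=> [fl fC]; split=> [x y x1 y1|x x1].
  have x1' : -1 <= - x <= 1 by lra.
  have y1' : -1 <= - y <= 1 by lra.
  have -> : symf f x - symf f y = 2^-1 * ((1 + x) * (f x - f y) + (1 - x) * (f (- x) - f (- y))
      + (x - y) * f y + (y - x) * f (- y)) by rewrite /symf; ring.
  have h1 := fl _ _ x1 y1; have h2 := fl _ _ x1' y1'.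
  have E1 : - x - - y = y - x by ring.
  rewrite E1 in h2.
  rewrite (distrC y x) in h2.
  have h3 := fC _ y1; have h4 := fC _ y1'.
  rewrite normrM ger0_norm ?invr_ge0//.
  have n1 : `|(1 + x) * (f x - f y)| <= (1 + x) * (K * `|x - y|).
    by rewrite normrM ger0_norm ?ler_wpM2l//; lra.
  have n2 : `|(1 - x) * (f (- x) - f (- y))| <= (1 - x) * (K * `|x - y|).
    by rewrite normrM ger0_norm ?ler_wpM2l//; lra.
  have n3 : `|(x - y) * f y| <= `|x - y| * C by rewrite normrM ler_wpM2l.
  have n4 : `|(y - x) * f (- y)| <= `|x - y| * C by rewrite normrM distrC ler_wpM2l.
  have := ler_normD ((1 + x) * (f x - f y) + (1 - x) * (f (- x) - f (- y)) + (x - y) * f y) ((y - x) * f (- y)).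
  have := ler_normD ((1 + x) * (f x - f y) + (1 - x) * (f (- x) - f (- y))) ((x - y) * f y).
  have := ler_normD ((1 + x) * (f x - f y)) ((1 - x) * (f (- x) - f (- y))).
  lra.
have x1' : -1 <= - x <= 1 by lra.
have h3 := fC _ x1; have h4 := fC _ x1'.
rewrite /symf normrM ger0_norm ?invr_ge0//.
have n1 : `|(1 + x) * f x| <= (1 + x) * C by rewrite normrM ger0_norm ?ler_wpM2l//; lra.
have n2 : `|(1 - x) * f (- x)| <= (1 - x) * C by rewrite normrM ger0_norm ?ler_wpM2l//; lra.
have := ler_normD ((1 + x) * f x) ((1 - x) * f (- x)).
lra.
Qed.

Lemma EV_sym K C f : lipk K C f -> EV f = EV (symf f).
Proof.
move=> hf; have [fl fC] := hf.
(* Adding the bound [C] makes the integrand nonnegative, as [sym_tanh] requires. *)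
have E h Kh Ch : lipk Kh Ch h -> EV (fun t => h t + C) = EV h + C.
  move=> hh; have := EV_lin 1 1 hh (lip_cst C); rewrite !mul1r EV_cst => <-.
  by congr EV; apply/funext => t; rewrite !mul1r.
apply/(addIr C); rewrite -(E _ _ _ hf) -(E _ _ _ (lip_symf hf)) /EV; congr fine.
have hfC := lipD hf (lip_cst C).
rewrite (sym_tanh (f := fun t => f t + C))//; last 2 first.
- exact: lip_measurable hfC.
- by move=> t t1; have := fC t ltac:(lra); rewrite ler_norml; lra.
by apply: eq_integral => v _; rewrite /symf; congr EFin; field.
Qed.

Section Rounding.
Variable N : nat.
Hypothesis N0 : (0 < N)%N.

Definition ridx (v : R) : nat := Num.truncn (`|tanhR v| * N%:R).
Definition rset (j : nat) : set R := [set v | ridx v = j].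
Definition rwt (j : nat) : R := fine (dV (rset j)).
(** Only the rounded absolute value is recorded, as a law on [0, 1]. [sE] restores the random sign
    through [symf], so the rounded law is symmetric by construction. *)
Definition tlaw : law R :=
  [seq (rwt (nat_of_ord j), (nat_of_ord j)%:R / N%:R) | j : 'I_N.+1 <- enum 'I_N.+1].

Lemma ridx_itv v : (ridx v)%:R <= `|tanhR v| * N%:R < (ridx v).+1%:R.
Proof. by apply: truncn_itv; rewrite mulr_ge0. Qed.

Lemma ridx_lt v : (ridx v < N.+1)%N.
Proof.
rewrite ltnS -(ler_nat R); have /andP[h _] := ridx_itv v; apply: le_trans h _.
by rewrite ler_piMl// ler_norml tanhR_bound_le.
Qed.

Lemma measurable_rset j : measurable (rset j).
Proof.
have mt : measurable_fun setT (fun v : R => `|tanhR v| * N%:R).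
  apply: measurable_funM => //; apply: measurableT_comp => //; exact: measurable_tanhR.
have mb : measurable_fun setT (fun v : R => (j%:R <= `|tanhR v| * N%:R) && (`|tanhR v| * N%:R < j.+1%:R)).
  by apply: measurable_and; [exact: measurable_fun_ler|exact: measurable_fun_ltr].
have -> : rset j = setT `&` (fun v : R => (j%:R <= `|tanhR v| * N%:R) && (`|tanhR v| * N%:R < j.+1%:R)) @^-1` [set true].
  rewrite setTI; apply/seteqP; split => v /=; rewrite /rset/=.
    by move=> <-; exact: ridx_itv.
  by move=> h; exact: truncn_def.
by apply: mb.
Qed.

Lemma step_int (c : 'I_N.+1 -> R) :
  (\int[dV]_v (\sum_(j < N.+1) c j * \1_(rset j) v)%:E = (\sum_(j < N.+1) rwt j * c j)%:E)%E.
Proof.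
have ii (j : 'I_N.+1) : dV.-integrable setT (fun v => (\1_(rset j) v : R)%:E).
  by apply: integrable_indic; exact: measurable_rset.
under eq_integral do rewrite -sumEFin.
rewrite integral_sum//=; last first.
  by move=> j; under eq_fun do rewrite EFinM; exact: integrableZl.
rewrite -sumEFin; apply: eq_bigr => j _.
under eq_integral do rewrite EFinM.
rewrite integralZl// integral_indic//; last exact: measurable_rset.
rewrite setIT -[X in (_ * X)%E]fineK; last exact: fin_num_measure (measurable_rset j).
by rewrite -EFinM mulrC.
Qed.

Lemma sum_rset v (c : 'I_N.+1 -> R) : \sum_(j < N.+1) c j * \1_(rset j) v = c (Ordinal (ridx_lt v)).
Proof.
rewrite (bigD1 (Ordinal (ridx_lt v)))//= [X in _ + X]big1 ?addr0.
  by rewrite indicE mem_set ?mulr1.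
move=> j hj; rewrite indicE memNset ?mulr0// /rset/= => e.
by move: hj; rewrite -val_eqE /= e eqxx.
Qed.

Lemma lawE_tlaw f : lawE tlaw f = \sum_(j < N.+1) rwt j * f (j%:R / N%:R).
Proof. by rewrite /lawE big_map big_enum. Qed.

Lemma is_law_tlaw : is_law tlaw.
Proof.
have n0 : 0 < N%:R :> R by rewrite ltr0n.
split.
  move=> m /mapP[j _ ->] /=; split; first exact: fine_ge0.
  have : 0 <= (j : nat)%:R / N%:R :> R by rewrite divr_ge0.
  have : (j : nat)%:R / N%:R <= 1 :> R.
    by rewrite ler_pdivrMr// mul1r ler_nat -ltnS.
  lra.
rewrite lawE_tlaw; have := step_int (fun=> 1).
under eq_integral do rewrite sum_rset.
rewrite integral_cst//= probability_setT mule1 => -[h].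
by rewrite [RHS]h.
Qed.

Definition sE (l : law R) (f : R -> R) : R := lawE l (symf f).

Lemma EV_tlaw K C f : lipk K C f -> `|EV f - sE tlaw f| <= (K + C) / N%:R.
Proof.
move=> hf; have hs := lip_symf hf; rewrite (EV_sym hf) /sE.
have n0 : 0 < N%:R :> R by rewrite ltr0n.
have [sl sC] := hs; set h := symf f in hs sl sC *.
have hN t : h (- t) = h t by rewrite /h /symf opprK; ring.
have hnorm t : h `|t| = h t by case: (ger0P t).
pose e := (K + C) / N%:R.
have KC0 : 0 <= K + C.
  have := sl 1 0 ltac:(lra) ltac:(lra); rewrite subr0 normr1 mulr1; exact: le_trans.
have near v : `|h (tanhR v) - h ((ridx v)%:R / N%:R)| <= e.
  have /andP[r1 r2] := ridx_itv v.
  have tb := tanhR_bound_le v; have nt : `|tanhR v| <= 1 by rewrite ler_norml.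
  have q0 : 0 <= (ridx v)%:R / N%:R :> R by rewrite divr_ge0.
  have q1 : (ridx v)%:R / N%:R <= `|tanhR v| by rewrite ler_pdivrMr.
  have q2 : `|tanhR v| <= (ridx v)%:R / N%:R + N%:R^-1.
    rewrite -[X in _ + X]mul1r -mulrDl ler_pdivlMr// natr1; exact: ltW.
  rewrite -hnorm; apply: le_trans (sl _ _ _ _) _; [lra|lra|].
  by rewrite /e ler_wpM2l// ger0_norm; lra.
have lE c : (lawE tlaw h + c)%:E = (\int[dV]_v (h ((ridx v)%:R / N%:R) + c)%:E)%E.
  have := step_int (fun j => h ((j : nat)%:R / N%:R) + c).
  under eq_integral do rewrite sum_rset.
  move=> /= ->; congr EFin; rewrite -[c in LHS](lawE_cst _ is_law_tlaw) -lawED lawE_tlaw.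
  by [].
have u1 : EV h <= lawE tlaw h + e.
  rewrite -lee_fin -(EV_int hs) lE; apply: le_integral_any => v.
  by rewrite lee_fin; have := near v; rewrite ler_norml; lra.
have u2 : lawE tlaw h + - e <= EV h.
  rewrite -lee_fin -(EV_int hs) lE; apply: le_integral_any => v.
  by rewrite lee_fin; have := near v; rewrite ler_norml; lra.
rewrite -/e ler_norml; lra.
Qed.

End Rounding.
End Even_reduction.

(** * Expectations over products of independent tanh V *)

Section Product_expectation.
Variables (R : realType) (dV : probability R R).
Implicit Types (f g : R -> R) (tl l : law R).

Fixpoint PV (k : nat) f : R :=
  if k is k'.+1 then EV dV (fun t => PV k' (fun x => f (t * x))) else f 1.

Lemma mul_itv1 (x y : R) : -1 <= x <= 1 -> -1 <= y <= 1 -> -1 <= x * y <= 1.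
Proof.
by move=> x1 y1; rewrite -ler_norml normrM mulr_ile1// ler_norml.
Qed.

Lemma lip_ge0 K C f : lipk K C f -> 0 <= K /\ 0 <= C.
Proof.
move=> [fl fC]; split.
  by have := fl 1 0 ltac:(lra) ltac:(lra); rewrite subr0 normr1 mulr1; exact: le_trans.
by have := fC 1 ltac:(lra); exact: le_trans.
Qed.

Lemma lip_scale K C f t : lipk K C f -> -1 <= t <= 1 -> lipk K C (fun x => f (t * x)).
Proof.
move=> hf t1; have [K0 _] := lip_ge0 hf; have [fl fC] := hf; split=> [x y x1 y1|x x1].
  apply: le_trans (fl _ _ (mul_itv1 t1 x1) (mul_itv1 t1 y1)) _.
  rewrite -mulrBr normrM ler_wpM2l// ler_piMl// ler_norml; lra.
exact/fC/mul_itv1.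
Qed.

(** Bound and contraction go together in the induction: [EV_near] asks for Lipschitz integrands, and
    the Lipschitz property of the inner expectation is the contraction statement one level below. *)
Lemma PV_near_bound k : forall K C f, lipk K C f ->
  (`|PV k f| <= C) /\
  (forall K' C' g e, lipk K' C' g -> (forall t, -1 <= t <= 1 -> `|f t - g t| <= e) ->
     `|PV k f - PV k g| <= e).
Proof.
elim: k => [|k IH] K C f hf /=.
  by split=> [|K' C' g e hg he]; [apply: hf.2; lra|apply: he; lra].
have L K0 C0 h : lipk K0 C0 h -> lipk K0 C0 (fun t => PV k (fun x => h (t * x))).
  move=> hh; have [K00 _] := lip_ge0 hh; split=> [x y x1 y1|x x1]; last exact: (IH _ _ _ (lip_scale hh x1)).1.
  apply: (IH _ _ _ (lip_scale hh x1)).2; first exact: lip_scale hh y1.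
  move=> t t1; apply: le_trans (hh.1 _ _ (mul_itv1 x1 t1) (mul_itv1 y1 t1)) _.
  by rewrite -mulrBl normrM ler_wpM2l// ler_piMr// ler_norml; lra.
split.
  have := EV_near dV (e := C) (L _ _ _ hf) (lip_cst 0); rewrite EV_cst subr0; apply.
  by move=> t t1; rewrite subr0; exact: (L _ _ _ hf).2.
move=> K' C' g e hg he; apply: (EV_near dV (L _ _ _ hf) (L _ _ _ hg)) => t t1.
by apply: (IH _ _ _ (lip_scale hf t1)).2 (lip_scale hg t1) _ => x x1; exact/he/mul_itv1.
Qed.

Lemma PV_bound k K C f : lipk K C f -> `|PV k f| <= C.
Proof. by move=> hf; exact: (PV_near_bound k hf).1. Qed.

Lemma PV_near k K C f K' C' g e : lipk K C f -> lipk K' C' g ->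
  (forall t, -1 <= t <= 1 -> `|f t - g t| <= e) -> `|PV k f - PV k g| <= e.
Proof. by move=> hf; exact: (PV_near_bound k hf).2. Qed.

Lemma PV_lip k K C f : lipk K C f -> lipk K C (fun t => PV k (fun x => f (t * x))).
Proof.
move=> hh; have [K00 _] := lip_ge0 hh; split=> [x y x1 y1|x x1]; last exact: PV_bound (lip_scale hh x1).
apply: (PV_near _ (lip_scale hh x1) (lip_scale hh y1)).
move=> t t1; apply: le_trans (hh.1 _ _ (mul_itv1 x1 t1) (mul_itv1 y1 t1)) _.
by rewrite -mulrBl normrM ler_wpM2l// ler_piMr// ler_norml; lra.
Qed.

Lemma eq_EV f g : (forall t, -1 < t < 1 -> f t = g t) -> EV dV f = EV dV g.
Proof.
by move=> fg; rewrite /EV; congr fine; apply: eq_integral => v _; rewrite fg// tanhR_bound.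
Qed.

Lemma eq_PV k f g : (forall t, -1 <= t <= 1 -> f t = g t) -> PV k f = PV k g.
Proof.
elim: k f g => [|k IH] f g fg /=; first by apply: fg; lra.
apply: eq_EV => t t1; apply: IH => x x1; apply/fg/mul_itv1 => //; lra.
Qed.

Lemma PV_le k K C f K' C' g : lipk K C f -> lipk K' C' g ->
  (forall t, -1 <= t <= 1 -> f t <= g t) -> PV k f <= PV k g.
Proof.
elim: k K C f K' C' g => [|k IH] K C f K' C' g hf hg fg /=; first by apply: fg; lra.
apply: (EV_le dV (PV_lip k hf) (PV_lip k hg)) => t t1.
by apply: IH (lip_scale hf t1) (lip_scale hg t1) _ => x x1; exact/fg/mul_itv1.
Qed.

Lemma PV_lin k K C f K' C' g a b : lipk K C f -> lipk K' C' g ->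
  PV k (fun t => a * f t + b * g t) = a * PV k f + b * PV k g.
Proof.
elim: k K C f K' C' g => [|k IH] K C f K' C' g hf hg //=.
rewrite -(EV_lin dV a b (PV_lip k hf) (PV_lip k hg)); apply: eq_EV => t t1.
have t1' : -1 <= t <= 1 by lra.
exact: IH (lip_scale hf t1') (lip_scale hg t1').
Qed.

Lemma PV_cst k c : PV k (fun=> c) = c.
Proof. by elim: k => //= k IH; rewrite -[RHS](EV_cst dV); apply: eq_EV => t _. Qed.

Lemma vint_PV k K C f : lipk K C f ->
  vint dV k (fun s => (f (prod_tanh s))%:E) = (PV k f)%:E.
Proof.
elim: k K C f => [|k IH] K C f hf /=; first by rewrite /prod_tanh big_nil.
rewrite -(EV_int dV (PV_lip k hf)); apply: eq_integral => v _.
rewrite -(IH K C (fun x => f (tanhR v * x))); last exact: lip_scale hf (tanhR_bound_le v).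
by congr vint; apply/funext => s; rewrite /prod_tanh big_cons.
Qed.

(** The empty product is 1, while a nonempty one lies strictly between -1 and 1. The value -1 never
    occurs, so later logarithms of 1 + u have a positive argument. *)
Lemma vint_le k K C (F : R -> \bar R) f : lipk K C f ->
  (forall u, -1 < u <= 1 -> (F u <= (f u)%:E)%E) ->
  (vint dV k (fun s => F (prod_tanh s)) <= (PV k f)%:E)%E.
Proof.
elim: k F f => [|k IH] F f hf Ff /=; first by rewrite /prod_tanh big_nil; apply: Ff; lra.
rewrite -(EV_int dV (PV_lip k hf)); apply: le_integral_any => v.
have tb := tanhR_bound v; have tb' := tanhR_bound_le v.
apply: le_trans (IH (fun u => F (tanhR v * u)) _ (lip_scale hf tb') _).
  by rewrite le_eqVlt; apply/orP; left; apply/eqP; congr vint; apply/funext => s; rewrite /prod_tanh big_cons.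
move=> u u1; apply: Ff; have : `|tanhR v * u| < 1.
  rewrite normrM; have : `|tanhR v| < 1 by rewrite ltr_norml.
  have : `|u| <= 1 by rewrite ler_norml; lra.
  have := normr_ge0 u; have := normr_ge0 (tanhR v); nra.
by rewrite ltr_norml; lra.
Qed.

Lemma symf1 f : symf f 1 = f 1.
Proof. by rewrite /symf subrr mul0r addr0 mulrA mulVf ?mul1r. Qed.

Lemma symf_mul (f : R -> R) t : forall x, symf (fun x => symf (fun t => f (t * x)) t) x = symf f (t * x).
Proof. by move=> x; rewrite /symf !mulNr !mulrN !opprK; field. Qed.

Lemma sE_mulL l l' f : sE (mulL l l') f = sE l (fun t => sE l' (fun x => f (t * x))).
Proof.
rewrite /sE lawE_mulL; apply: eq_lawE => t.
rewrite /symf -!lawEZ -lawED -lawEZ; apply: eq_lawE => x.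
by rewrite !mulNr !mulrN !opprK; field.
Qed.

(** Symmetric laws are closed under products: symmetrising in each factor is symmetrising in the
    product ([symf_mul]). *)
Lemma PV_sym k K C f : symmetric_law dV -> lipk K C f -> PV k f = PV k (symf f).
Proof.
move=> sym; elim: k K C f => [|k IH] K C f hf /=.
  by rewrite symf1.
rewrite (EV_sym sym (PV_lip k hf)); apply: eq_EV => t t1.
have t1' : -1 <= t <= 1 by lra.
have t2' : -1 <= - t <= 1 by lra.
have E : symf (fun t => PV k (fun x => f (t * x))) t =
    PV k (fun x => symf (fun t => f (t * x)) t).
  rewrite /symf mulrDr !mulrA -(PV_lin k _ _ (lip_scale hf t1') (lip_scale hf t2')).
  by apply: eq_PV => x x1; ring.
have hl : lipk (`|2^-1 * (1 + t)| * K + `|2^-1 * (1 - t)| * K) (`|2^-1 * (1 + t)| * C + `|2^-1 * (1 - t)| * C) (fun x => symf (fun t => f (t * x)) t).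
  have := lip_scale hf t1'; have := lip_scale hf t2' => -[l2 c2] [l1 c1].
  set a := 2^-1 * (1 + t); set b := 2^-1 * (1 - t).
  have E2 x : symf (fun t => f (t * x)) t = a * f (t * x) + b * f (- t * x).
    by rewrite /symf /a /b; ring.
  split=> [x y x1 y1|x x1]; rewrite !E2.
    have -> : a * f (t * x) + b * f (- t * x) - (a * f (t * y) + b * f (- t * y)) =
      a * (f (t * x) - f (t * y)) + b * (f (- t * x) - f (- t * y)) by ring.
    apply: le_trans (ler_normD _ _) _; rewrite !normrM mulrDl; apply: lerD.
      by rewrite -[leRHS]mulrA ler_wpM2l ?l1.
    by rewrite -[leRHS]mulrA ler_wpM2l ?l2.
  apply: le_trans (ler_normD _ _) _; rewrite !normrM; apply: lerD.
    by rewrite ler_wpM2l ?c1.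
  by rewrite ler_wpM2l ?c2.
by rewrite E (IH _ _ _ hl); apply: eq_PV => x x1; rewrite symf_mul.
Qed.

Lemma sE_near tl f g e : is_law tl -> (forall t, -1 <= t <= 1 -> `|f t - g t| <= e) ->
  `|sE tl f - sE tl g| <= e.
Proof.
move=> hl fg.
have S x : -1 <= x <= 1 -> symf g x - e <= symf f x <= symf g x + e.
  move=> x1; have /andP[h1 h2] : - e <= f x - g x <= e by rewrite -ler_norml fg.
  have /andP[h3 h4] : - e <= f (- x) - g (- x) <= e by rewrite -ler_norml fg//; lra.
  rewrite /symf; apply/andP; split; nra.
have u : sE tl f <= sE tl g + e.
  rewrite /sE -[e](lawE_cst _ hl) -lawED; apply: lawE_le => // x x1.
  by case/andP: (S x x1).
have v : sE tl g <= sE tl f + e.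
  rewrite /sE -[e](lawE_cst _ hl) -lawED; apply: lawE_le => // x x1.
  by case/andP: (S x x1); lra.
by rewrite ler_norml; lra.
Qed.

Lemma sE_cst tl c : is_law tl -> sE tl (fun=> c) = c.
Proof.
move=> hl; rewrite /sE -[RHS](lawE_cst c hl); apply: eq_lawE => u; by rewrite /symf; field.
Qed.

Lemma sE_lip tl K C f : is_law tl -> lipk K C f -> lipk K C (fun t => sE tl (fun x => f (t * x))).
Proof.
move=> hl hh; have [K00 _] := lip_ge0 hh; split=> [x y x1 y1|x x1].
  apply: sE_near => // t t1; apply: le_trans (hh.1 _ _ (mul_itv1 x1 t1) (mul_itv1 y1 t1)) _.
  by rewrite -mulrBl normrM ler_wpM2l// ler_piMr// ler_norml; lra.
have := @sE_near tl (fun t => f (x * t)) (fun=> 0) C hl; rewrite sE_cst// subr0; apply.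
by move=> t t1; rewrite subr0; exact/hh.2/mul_itv1.
Qed.

Lemma PV_tlaw N k K C f : symmetric_law dV -> (0 < N)%N -> lipk K C f ->
  `|PV k f - sE (pw (tlaw dV N) k) f| <= k%:R * ((K + C) / N%:R).
Proof.
move=> sym N0; have hl := is_law_tlaw dV N0.
elim: k f => [|k IH] f hf.
  by rewrite /= /sE lawE_hard symf1 subrr normr0 mul0r.
rewrite [pw _ _]/= sE_mulL [PV _ _]/= -natr1 mulrDl mul1r.
have hp := is_law_pw k hl.
set A := EV _ _; set B := EV dV (fun t => sE (pw (tlaw dV N) k) (fun x => f (t * x))).
apply: (@le_trans _ _ (`|A - B| + `|B - sE (tlaw dV N) (fun t => sE (pw (tlaw dV N) k) (fun x => f (t * x)))|)).
  by apply: le_trans (ler_normD _ _); rewrite addrA subrK.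
apply: lerD; last exact: EV_tlaw N0 _ _ _ (sE_lip hp hf).
by apply: (EV_near dV (PV_lip k hf) (sE_lip hp hf)) => t t1; exact/IH/lip_scale.
Qed.

End Product_expectation.

(** * Expectations over the incoming check messages of one variable *)

Section Iterated_expectation.
Variables (R : realType).
Variables (g : R -> R -> R) (L : R).
Hypothesis g_lip : forall a b a' b', 0 <= a -> 0 <= b -> 0 <= a' -> 0 <= b' ->
  `|g a b - g a' b'| <= L * (`|a - a'| + `|b - b'|).

(** What the true law of tanh U ([UV]) and its finite approximation ([sE] of a law) have in common;
    it suffices to compare their iterates. *)
Definition averaging (U : (R -> R) -> R) : Prop :=
  (forall c, U (fun=> c) = c) /\
  (forall K C f K' C' h e, lipk K C f -> lipk K' C' h ->
    (forall t, -1 <= t <= 1 -> `|f t - h t| <= e) -> `|U f - U h| <= e).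

Fixpoint iter_avg (U : (R -> R) -> R) (d : nat) (a b : R) : R :=
  if d is d'.+1 then U (fun u => iter_avg U d' (a * (1 + u)) (b * (1 - u))) else g a b.

Let L0 : 0 <= L.
Proof.
have := @g_lip 1 0 0 0 ltac:(lra) ltac:(lra) ltac:(lra) ltac:(lra).
by rewrite subr0 subrr normr1 normr0 addr0 mulr1; exact: le_trans.
Qed.

Lemma iter_avg00 U d : averaging U -> iter_avg U d 0 0 = g 0 0.
Proof.
move=> [Uc _]; elim: d => //= d IH; rewrite -[RHS]Uc; congr U; apply/funext => u.
by rewrite !mul0r.
Qed.

(** Each level at most doubles the Lipschitz constant, since 1 + u and 1 - u are at most 2. *)
Lemma iter_avg_lip U d : averaging U ->
  (forall a b a' b', 0 <= a -> 0 <= b -> 0 <= a' -> 0 <= b' ->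
    `|iter_avg U d a b - iter_avg U d a' b'| <= 2 ^+ d * L * (`|a - a'| + `|b - b'|)) /\
  (forall a b, 0 <= a -> 0 <= b ->
    lipk (2 ^+ d * L * (a + b)) (`|g 0 0| + 2 ^+ d * L * (2 * (a + b)))
      (fun u => iter_avg U d (a * (1 + u)) (b * (1 - u)))).
Proof.
move=> hU; have Lip d' : (forall a b a' b', 0 <= a -> 0 <= b -> 0 <= a' -> 0 <= b' ->
    `|iter_avg U d' a b - iter_avg U d' a' b'| <= 2 ^+ d' * L * (`|a - a'| + `|b - b'|)) ->
  forall a b, 0 <= a -> 0 <= b ->
    lipk (2 ^+ d' * L * (a + b)) (`|g 0 0| + 2 ^+ d' * L * (2 * (a + b)))
      (fun u => iter_avg U d' (a * (1 + u)) (b * (1 - u))).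
  move=> H a b a0 b0; have P0 : 0 <= 2 ^+ d' * L by rewrite mulr_ge0// exprn_ge0.
  split=> [x y x1 y1|x x1].
    apply: le_trans (H _ _ _ _ _ _ _ _) _; try by rewrite mulr_ge0//; lra.
    rewrite -[leRHS]mulrA ler_wpM2l// -!mulrBr !normrM (ger0_norm a0) (ger0_norm b0) mulrDl.
    have -> : 1 + x - (1 + y) = x - y by ring.
    have -> : 1 - x - (1 - y) = - (x - y) by ring.
    by rewrite normrN.
  have a0' : 0 <= a * (1 + x) by rewrite mulr_ge0//; lra.
  have b0' : 0 <= b * (1 - x) by rewrite mulr_ge0//; lra.
  have := H _ _ 0 0 a0' b0' (lexx _) (lexx _).
  rewrite iter_avg00// !subr0 (ger0_norm a0') (ger0_norm b0') => h.
  have h2 := ler_normD (iter_avg U d' (a * (1 + x)) (b * (1 - x)) - g 0 0) (g 0 0).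
  rewrite subrK in h2.
  have : 2 ^+ d' * L * (a * (1 + x) + b * (1 - x)) <= 2 ^+ d' * L * (2 * (a + b)).
    by rewrite ler_wpM2l//; nra.
  lra.
suff H : forall a b a' b', 0 <= a -> 0 <= b -> 0 <= a' -> 0 <= b' ->
    `|iter_avg U d a b - iter_avg U d a' b'| <= 2 ^+ d * L * (`|a - a'| + `|b - b'|).
  by split => //; exact: Lip.
elim: d => [|d IH] a b a' b' a0 b0 a0' b0' /=; first by rewrite expr0 mul1r; exact: g_lip.
apply: (hU.2 _ _ _ _ _ _ _ (Lip _ IH _ _ a0 b0) (Lip _ IH _ _ a0' b0')) => t t1.
apply: le_trans (IH _ _ _ _ _ _ _ _) _; try by rewrite mulr_ge0//; lra.
have P0 : 0 <= 2 ^+ d * L by rewrite mulr_ge0// exprn_ge0.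
have -> : 2 ^+ d.+1 * L * (`|a - a'| + `|b - b'|) = 2 ^+ d * L * (2 * (`|a - a'| + `|b - b'|)).
  by rewrite exprS; ring.
rewrite ler_wpM2l//.
rewrite -!mulrBl !normrM (ger0_norm (x := 1 + t)) ?(ger0_norm (x := 1 - t)); [|lra|lra].
have := normr_ge0 (a - a'); have := normr_ge0 (b - b'); nra.
Qed.

(** Replacing the outermost average costs the two constants [iter_avg_lip] gives for the inner
    function. The remaining levels start from a total that is at most 2S. *)
Fixpoint iter_err (d : nat) (S : R) : R :=
  if d is d'.+1 then 2 ^+ d' * L * S + (`|g 0 0| + 2 ^+ d' * L * (2 * S)) + iter_err d' (2 * S)
  else 0.

Lemma iter_err_mono d S S' : S <= S' -> iter_err d S <= iter_err d S'.
Proof.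
elim: d S S' => //= d IH S S' SS; have P0 : 0 <= 2 ^+ d * L by rewrite mulr_ge0// exprn_ge0.
have SS2 : 2 * S <= 2 * S' by lra.
by rewrite !lerD//; [rewrite ler_wpM2l|rewrite ler_wpM2l|exact: IH].
Qed.

Lemma iter_avg_near U U' c d a b : averaging U -> averaging U' -> 0 <= c ->
  (forall K C f, lipk K C f -> `|U f - U' f| <= c * (K + C)) -> 0 <= a -> 0 <= b ->
  `|iter_avg U d a b - iter_avg U' d a b| <= c * iter_err d (a + b).
Proof.
move=> hU hU' c0 UU; elim: d a b => [|d IH] a b a0 b0 /=; first by rewrite subrr normr0 mulr0.
have l1 := (iter_avg_lip d hU).2 _ _ a0 b0; have l2 := (iter_avg_lip d hU').2 _ _ a0 b0.
set A := U _; set B := U' (fun u => iter_avg U d (a * (1 + u)) (b * (1 - u))); set D := U' _.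
apply: (@le_trans _ _ (`|A - B| + `|B - D|)).
  by apply: le_trans (ler_normD _ _); rewrite addrA subrK.
rewrite mulrDr; apply: lerD; first exact: UU l1.
apply: (hU'.2 _ _ _ _ _ _ _ l1 l2) => t t1.
have a1 : 0 <= a * (1 + t) by rewrite mulr_ge0//; lra.
have b1 : 0 <= b * (1 - t) by rewrite mulr_ge0//; lra.
apply: le_trans (IH _ _ a1 b1) _; rewrite ler_wpM2l//; apply: iter_err_mono; nra.
Qed.

Lemma averaging_sE tl : is_law tl -> averaging (sE tl).
Proof.
by move=> hl; split=> [c|K C f K' C' h e _ _]; [exact: sE_cst|exact: sE_near].
Qed.

(* Nishimori identity: the posterior weights are redistributed by the tilted
   law [(1 + u) / 2], so a function of the total mass averages like [sE]. *)
Lemma EE_iter_avg r d (w : bool -> R) :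
  EE (nseq d (r, @sgb R)) w (fun w => w false * g (w false) (w true) + w true * g (w true) (w false)) =
  w false * iter_avg (sE r) d (w false) (w true) + w true * iter_avg (sE r) d (w true) (w false).
Proof.
elim: d w => [|d IH] w //=.
rewrite /Ob /= /sE -!lawEZ -lawED; apply: eq_lawE => u.
rewrite !IH /upd /sgb /symf /=.
have -> : 1 + u * -1 = 1 - u by ring.
have -> : 1 + - u * -1 = 1 + u by ring.
by rewrite !mulr1 opprK; field.
Qed.

End Iterated_expectation.

Section Check_messages.
Variables (R : realType) (dV : probability R R) (P : seq R).
Hypothesis dP : deg_dist P.
Hypothesis P1gt0 : 0 < dpoly1 P.

Lemma ge0_rho k : 0 <= rho P k.
Proof. by rewrite /rho !mulr_ge0 ?dP.1// invr_ge0 ltW. Qed.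

Lemma sum_rho : \sum_(k < size P) rho P k = 1.
Proof. by rewrite -mulr_suml divff// gt_eqF. Qed.

Lemma rho_mean_near (F G : nat -> R) e : (forall k, (k < size P)%N -> `|F k - G k| <= e) ->
  `|\sum_(k < size P) rho P k * F k - \sum_(k < size P) rho P k * G k| <= e.
Proof.
move=> FG; rewrite -sumrB -[e]mul1r -sum_rho mulr_suml.
apply: le_trans (ler_norm_sum _ _ _) _; apply: ler_sum => k _.
by rewrite -mulrBr normrM ger0_norm ?ge0_rho// ler_wpM2l ?ge0_rho ?FG.
Qed.

Definition UV (f : R -> R) : R := \sum_(k < size P) rho P k * PV dV k.-1 f.

Lemma averaging_UV : averaging UV.
Proof.
split=> [c|K C f K' C' h e hf hh fh].
  rewrite /UV; under eq_bigr do rewrite PV_cst.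
  by rewrite -mulr_suml sum_rho mul1r.
by apply: (@rho_mean_near (fun k => PV dV k.-1 f) (fun k => PV dV k.-1 h)) => k _; exact: PV_near hf hh fh.
Qed.

Lemma EtanhU_le K C (F : R -> \bar R) f : lipk K C f ->
  (forall u, -1 < u <= 1 -> (F u <= (f u)%:E)%E) ->
  (EtanhU dV P F <= (UV f)%:E)%E.
Proof.
move=> hf Ff; rewrite /EtanhU /UV -sumEFin; apply: lee_sum => k _.
rewrite [(rho P k * _)%:E]EFinM; apply: lee_wpmul2l; first by rewrite lee_fin ge0_rho.
exact: vint_le hf Ff.
Qed.

Definition rmix (tl : law R) : law R :=
  mixL [seq (rho P k, k) | k <- iota 0 (size P)] (fun k => pw tl k.-1).

Lemma lawE_rmix tl f : lawE (rmix tl) f = \sum_(k < size P) rho P k * lawE (pw tl k.-1) f.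
Proof. by rewrite /rmix lawE_mixL big_map -[in iota _ _](subn0 (size P)) big_mkord. Qed.

Lemma is_law_rmix tl : is_law tl -> is_law (rmix tl).
Proof.
move=> hl; apply: is_law_mixL.
  by move=> _ /mapP[k _ ->] /=; split; [exact: ge0_rho|exact: is_law_pw].
by rewrite big_map -[in iota _ _](subn0 (size P)) big_mkord /= sum_rho.
Qed.

Lemma UV_tlaw N K C f : symmetric_law dV -> (0 < N)%N -> lipk K C f ->
  `|UV f - sE (rmix (tlaw dV N)) f| <= (size P)%:R / N%:R * (K + C).
Proof.
move=> sym N0 hf; rewrite /sE lawE_rmix.
apply: (@rho_mean_near (fun k => PV dV k.-1 f) (fun k => sE (pw (tlaw dV N) k.-1) f)) => k kP.
apply: le_trans (PV_tlaw _ sym N0 hf) _.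
have [K0 C0] := lip_ge0 hf.
rewrite mulrA mulrAC ler_wpM2r ?addr_ge0// ler_wpM2r// ?invr_ge0// ler_nat.
by apply: leq_trans (ltnW kP); exact: leq_pred.
Qed.

Lemma EtanhUs_le (g : R -> R -> R) L d a b c (G : seq R -> \bar R) :
  (forall a b a' b' : R, 0 <= a -> 0 <= b -> 0 <= a' -> 0 <= b' ->
    `|g a b - g a' b'| <= L * (`|a - a'| + `|b - b'|)) ->
  0 <= a -> 0 <= b ->
  (forall s, (forall u, u \in s -> -1 < u <= 1) ->
     (G s <= (g (a * \prod_(u <- s) (1 + u)) (b * \prod_(u <- s) (1 - u)) + c)%:E)%E) ->
  (EtanhUs dV P d G <= (iter_avg g UV d a b + c)%:E)%E.
Proof.
move=> gl; elim: d a b G => [|d IH] a b G a0 b0 hG /=.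
  by have := hG [::]; rewrite !big_nil !mulr1; apply.
have [Uc Un] := averaging_UV.
have hl := (iter_avg_lip gl d averaging_UV).2 _ _ a0 b0.
have -> : UV (fun u => iter_avg g UV d (a * (1 + u)) (b * (1 - u))) + c =
    UV (fun u => iter_avg g UV d (a * (1 + u)) (b * (1 - u)) + c).
  rewrite /UV -[c in LHS]Uc /UV -big_split; apply: eq_bigr => k _ /=.
  rewrite -mulrDr; congr (_ * _).
  have := PV_lin dV k.-1 1 1 hl (lip_cst c); rewrite !mul1r => <-.
  by congr PV; apply/funext => u; rewrite !mul1r.
apply: (EtanhU_le (lipD hl (lip_cst c))) => u u1.
apply: IH => [||s hs]; [by rewrite mulr_ge0//; lra|by rewrite mulr_ge0//; lra|].
apply: le_trans (hG (u :: s) _) _.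
  by move=> x; rewrite inE => /predU1P[->|/hs].
by rewrite !big_cons !mulrA.
Qed.

End Check_messages.

Section Smoothed_entropy.
Variables (R : realType) (h : R).
Hypothesis h_gt0 : 0 < h.

(** The shift [h] makes the logarithm Lipschitz on nonnegative arguments. It only increases the
    logarithm, so an upper bound on the replica-symmetric term survives, and [lnsum_le_eta] limits
    its cost to [h]. *)
Definition lnsum (a b : R) : R := ln (a + b + h).

Lemma ln_shift_lip (x y : R) : 0 <= x -> 0 <= y -> `|ln (x + h) - ln (y + h)| <= h^-1 * `|x - y|.
Proof.
have S (x' y' : R) : 0 <= y' -> y' <= x' -> 0 <= ln (x' + h) - ln (y' + h) <= h^-1 * (x' - y').
  move=> y0 yx; have Y0 : 0 < y' + h by move: h_gt0; lra.
  have X0 : 0 < x' + h by move: h_gt0; lra.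
  rewrite subr_ge0 ler_ln ?posrE// lerD2r yx/= -ln_div ?posrE//.
  apply: le_trans (ln_le_sub1 _) _; first by rewrite divr_gt0.
  have -> : (x' + h) / (y' + h) - 1 = (y' + h)^-1 * (x' - y') by field; rewrite gt_eqF.
  by apply: ler_wpM2r; [lra|rewrite lef_pV2 ?posrE//; lra].
move=> x0 y0; have [xy|yx] := leP y x.
  by have /andP[q1 q2] := S _ _ y0 xy; rewrite !ger0_norm// subr_ge0.
have /andP[q1 q2] := S _ _ x0 (ltW yx).
by rewrite distrC (distrC x) !ger0_norm// subr_ge0 ltW.
Qed.

Lemma lnsum_lip (a b a' b' : R) : 0 <= a -> 0 <= b -> 0 <= a' -> 0 <= b' ->
  `|lnsum a b - lnsum a' b'| <= h^-1 * (`|a - a'| + `|b - b'|).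
Proof.
move=> a0 b0 a0' b0'; apply: le_trans (ln_shift_lip _ _) _; try by rewrite addr_ge0.
rewrite ler_wpM2l ?invr_ge0 ?(ltW h_gt0)//.
have -> : a + b - (a' + b') = (a - a') + (b - b') by ring.
exact: ler_normD.
Qed.

Lemma lnsum_le_eta (m : R) : 0 <= m -> m * ln (m + h) <= eta m + h.
Proof.
rewrite le_eqVlt => /predU1P[<-|m0]; first by rewrite mul0r eta0 add0r ltW.
have -> : m + h = m * (1 + h / m) by field; rewrite gt_eqF.
have u0 : 0 < 1 + h / m by rewrite addr_gt0// divr_gt0.
rewrite lnM ?posrE// mulrDr lerD2l.
have := ler_wpM2l (ltW m0) (ln_le_sub1 u0).
by have -> : m * (1 + h / m - 1) = h by field; rewrite gt_eqF.
Qed.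

Lemma EE_cst (X : finType) (Ls : seq (law R * (X -> R))) w c : valid Ls -> EE Ls w (fun=> c) = c.
Proof.
elim: Ls w => [|o Ls IH] w //= [[ol os] vL].
rewrite /Ob -[RHS](lawE_cst _ ol); apply: eq_lawE => u; rewrite !IH//; lra.
Qed.

Lemma smoothed_phi1 ch r d : is_law ch -> is_law r ->
  sE ch (fun t => iter_avg lnsum (sE r) d ((1 + t) / 2) ((1 - t) / 2)) <=
  phi1 (ch :: nseq d r) + h.
Proof.
move=> hc hr; set w := (fun _ : bool => 2^-1 : R).
have vL : valid [seq (l, @sgb R) | l <- ch :: nseq d r].
  apply: valid_map => l /=; rewrite inE mem_nseq => /predU1P[->|/andP[_ /eqP->]];
    split => //; exact: sgb_spin.
rewrite /phi1 -(EE_cst (X := bool) w h vL) -EE_D.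
have -> : sE ch (fun t => iter_avg lnsum (sE r) d ((1 + t) / 2) ((1 - t) / 2)) =
   EE [seq (l, @sgb R) | l <- ch :: nseq d r] w
    (fun w => w false * lnsum (w false) (w true) + w true * lnsum (w true) (w false)).
  rewrite [map _ _]/= map_nseq [RHS]/= /Ob /= /sE; apply: eq_lawE => u.
  rewrite !EE_iter_avg /upd /sgb /symf /w /=.
  have -> : 2^-1 * (1 + u * 1) = (1 + u) / 2 by lra.
  have -> : 2^-1 * (1 + u * -1) = (1 - u) / 2 by lra.
  have -> : 2^-1 * (1 + - u * 1) = (1 - u) / 2 by lra.
  have -> : 2^-1 * (1 + - u * -1) = (1 + u) / 2 by lra.
  have -> : (1 + - u) / 2 = (1 - u) / 2 by [].
  have -> : (1 - - u) / 2 = (1 + u) / 2 by lra.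
  lra.
apply: EE_le => // [x|w' w0]; first by rewrite /w; lra.
have -> : w' false * lnsum (w' false) (w' true) + w' true * lnsum (w' true) (w' false) =
    mass w' * ln (mass w' + h).
  rewrite mass_bool /lnsum (addrC (w' true) (w' false)); lra.
by apply: lnsum_le_eta; apply: sumr_ge0.
Qed.

End Smoothed_entropy.

Lemma div_small (R : realType) (M e : R) : 0 < e ->
  exists N0, (0 < N0)%N /\ forall N, (N0 <= N)%N -> M / N%:R <= e.
Proof.
move=> e0; exists (Num.bound `|M / e|).+1; split => // N hN.
have N0 : 0 < N%:R :> R by rewrite ltr0n (leq_trans _ hN).
rewrite ler_pdivrMr// mulrC -ler_pdivrMr//; apply: le_trans (ler_norm _) _.
apply: le_trans (ltW (archi_boundP (normr_ge0 _))) _.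
by rewrite ler_nat ltnW.
Qed.

Section Channel_term.
Variable R : realType.

(** Upwards, [eta] grows at most with slope 1 on [0, 1]. Downwards, [eta] is superadditive, and
    ln(e/k) <= e/k - 1 with k = x - y bounds minus [eta k]. *)
Lemma eta_modulus (x y e : R) : 0 <= x <= 1 -> 0 <= y <= 1 -> 0 < e ->
  eta y <= eta x + `|x - y| * (1 + `|ln e|) + e.
Proof.
move=> /andP[x0 x1] /andP[y0 y1] e0; have n0 := normr_ge0 (ln e).
have h0 := normr_ge0 (x - y).
have [xy|yx] := leP x y.
  suff : eta y - eta x <= y - x.
    rewrite distrC ger0_norm ?subr_ge0//; have : 0 <= y - x by rewrite subr_ge0.
    nra.
  move: x0; rewrite le_eqVlt => /predU1P[x0|x0].
    rewrite -x0 eta0 !subr0 /eta; have [->|yn0] := eqVneq y 0; first by rewrite mul0r.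
    apply: (@le_trans _ _ 0) => //; rewrite mulr_ge0_le0// ln_le0//.
  have Y0 : 0 < y by apply: lt_le_trans xy.
  have l1 := ln_le_sub1 (divr_gt0 Y0 x0); rewrite ln_div ?posrE// in l1.
  have l2 : ln y <= 0 by exact: ln_le0.
  have l3 := ler_wpM2l (ltW x0) l1.
  have l4 : x * (y / x - 1) = y - x by field; rewrite gt_eqF.
  have : (y - x) * ln y <= 0 by rewrite mulr_ge0_le0// subr_ge0.
  rewrite /eta; lra.
rewrite gtr0_norm ?subr_gt0//; set k := x - y.
have k0 : 0 < k by rewrite subr_gt0.
have X0 : 0 < x by apply: le_lt_trans yx.
have l1 : eta y + eta k <= eta x.
  have -> : eta x = y * ln x + k * ln x by rewrite /eta /k; ring.
  apply: lerD; last by rewrite ler_wpM2l ?(ltW k0)// ler_ln ?posrE//; rewrite /k; lra.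
  move: y0; rewrite le_eqVlt => /predU1P[<-|y0]; first by rewrite eta0 mul0r.
  by rewrite ler_wpM2l ?(ltW y0)// ler_ln ?posrE//; exact: ltW.
have l2 := ler_wpM2l (ltW k0) (ln_le_sub1 (divr_gt0 e0 k0)).
rewrite ln_div ?posrE// in l2.
have l4 : k * (e / k - 1) = e - k by field; rewrite gt_eqF.
have l5 : k * - ln e <= k * `|ln e|.
  by rewrite ler_wpM2l ?(ltW k0)// -normrN ler_norm.
have : eta k = k * ln k by [].
lra.
Qed.

Context (disp : measure_display) (Y : measurableType disp) (mu : {measure set Y -> \bar R})
  (p : bool -> Y -> R).
Hypothesis bms : bms_channel mu p.
Variables (dV : probability R R) (P : seq R).
Hypothesis sym : symmetric_law dV.
Hypothesis dP : deg_dist P.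
Hypothesis P1gt0 : 0 < dpoly1 P.

Let p0 : forall x y, 0 <= p x y. Proof. by case: bms. Qed.

Lemma term1_upper (N : nat) d (e h : R) : (0 < N)%N -> 0 < e -> 0 < h ->
  (\int[mu]_y ((p false y)%:E * EtanhUs dV P d (fun s =>
      (ln (\prod_(u <- s) (1 + u) + p true y / p false y * \prod_(u <- s) (1 - u)))%:E)) <=
   (ln 2 - lawE (chlaw mu p N) (@gfun R) +
    sE (chlaw mu p N) (fun t => iter_avg (lnsum h) (UV dV P) d ((1 + t) / 2) ((1 - t) / 2)) +
    (2 * e + (2 * (3 * (2 ^+ d * h^-1) + `|lnsum h 0 0|) + 2 * (1 + `|ln e|)) / N%:R))%:E)%E.
Proof.
move=> N0 e0 h0; set Lh := 2 ^+ d * h^-1.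
pose B t := iter_avg (lnsum h) (UV dV P) d ((1 + t) / 2) ((1 - t) / 2).
(* By [p_half], [half y * kappa t] is p(y|0) times B(t) - ln((1+t)/2), where the logarithm comes
   from dividing both likelihoods by that of 0. In this form nothing diverges at t = -1. *)
pose kappa (t : R) := (1 + t) * B t - 2 * eta ((1 + t) / 2).
have hU := averaging_UV dV dP P1gt0.
have gl := lnsum_lip h0.
have Blip (t g : R) : -1 <= t <= 1 -> -1 <= g <= 1 -> `|B t - B g| <= Lh * `|t - g|.
  move=> t1 g1; apply: le_trans ((iter_avg_lip gl d hU).1 _ _ _ _ _ _ _ _) _; try lra.
  have -> : (1 + t) / 2 - (1 + g) / 2 = 2^-1 * (t - g) by lra.
  have -> : (1 - t) / 2 - (1 - g) / 2 = - (2^-1 * (t - g)) by lra.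
  rewrite normrN normrM ger0_norm ?invr_ge0//.
  have -> : 2^-1 * `|t - g| + 2^-1 * `|t - g| = `|t - g| by lra.
  by [].
have Bbd (t : R) : -1 <= t <= 1 -> `|B t| <= Lh + `|lnsum h 0 0|.
  move=> t1; have h1 : 0 <= (1 + t) / 2 by lra.
  have h2 : 0 <= (1 - t) / 2 by lra.
  have := (iter_avg_lip gl d hU).1 _ _ 0 0 h1 h2 (lexx _) (lexx _).
  rewrite iter_avg00// !subr0 (ger0_norm h1) (ger0_norm h2).
  have -> : (1 + t) / 2 + (1 - t) / 2 = 1 by lra.
  rewrite mulr1 -/(B t) => h3; have := ler_normD (B t - lnsum h 0 0) (lnsum h 0 0).
  rewrite subrK; rewrite /Lh; lra.
have n0 : 0 < N%:R :> R by rewrite ltr0n.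
have Lh0 : 0 <= Lh by rewrite mulr_ge0 ?exprn_ge0// invr_ge0 ltW.
have := grid_upper bms N0 (kappa := kappa) (c0 :=
  2 * e + (2 * (3 * Lh + `|lnsum h 0 0|) + 2 * (1 + `|ln e|)) / N%:R) (f :=
  fun y => ((p false y)%:E * EtanhUs dV P d (fun s =>
      (ln (\prod_(u <- s) (1 + u) + p true y / p false y * \prod_(u <- s) (1 - u)))%:E))%E).
have -> : lawE (chlaw mu p N) (fun u => 2^-1 * (kappa u + kappa (- u))) =
    ln 2 - lawE (chlaw mu p N) (@gfun R) + sE (chlaw mu p N) B.
  have lc := is_law_chlaw bms N0.
  rewrite -[ln 2](lawE_cst _ lc) -mulN1r -lawEZ /sE -!lawED.
  rewrite /lawE big_seq [RHS]big_seq; apply: eq_bigr => m hm; congr (_ * _).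
  have [m0 m1] := lc.1 _ hm; set u := m.2 in m1 *.
  have E a : 0 <= a -> 2 * eta (a / 2) = eta a - a * ln 2.
    rewrite le_eqVlt => /predU1P[<-|a0]; first by rewrite mul0r eta0 mul0r; lra.
    by rewrite /eta ln_div ?posrE//; field.
  have Eu : eta (1 - u) = eta (1 + - u) by [].
  have a1 : 0 <= 1 + u by lra.
  have a2 : 0 <= 1 + - u by lra.
  rewrite /kappa /symf /gfun !E// Eu; lra.
apply.
- move=> t g t1 g1 tg.
  have h1 : - eta ((1 + t) / 2) <= - eta ((1 + g) / 2) + `|(1 + t) / 2 - (1 + g) / 2| * (1 + `|ln e|) + e.
    by have := @eta_modulus ((1 + t) / 2) ((1 + g) / 2) e ltac:(lra) ltac:(lra) e0; lra.
  have h2 : `|(1 + t) / 2 - (1 + g) / 2| <= N%:R^-1.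
    have -> : (1 + t) / 2 - (1 + g) / 2 = 2^-1 * (t - g) by lra.
    rewrite normrM ger0_norm ?invr_ge0//; lra.
  have h3 : (1 + t) * B t <= (1 + g) * B g + (2 * (3 * Lh + `|lnsum h 0 0|)) / N%:R.
    have := Blip _ _ t1 g1; have := Bbd _ g1; rewrite !ler_norml => /andP[b1 b2] /andP[b3 b4].
    have z0 := normr_ge0 (t - g); have z1 := ler_norm (t - g); have z2 := normr_ge0 (lnsum h 0 0).
    have z3 := ler_norm (g - t); rewrite distrC in z3.
    have q1 : (1 + t) * (B t - B g) <= 2 * (Lh * `|t - g|).
      apply: (@le_trans _ _ ((1 + t) * (Lh * `|t - g|))); first by rewrite ler_wpM2l//; lra.
      by rewrite ler_wpM2r ?(mulr_ge0 Lh0)//; lra.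
    have q2 : (t - g) * B g <= `|t - g| * (Lh + `|lnsum h 0 0|).
      apply: le_trans (ler_norm _) _; rewrite normrM ler_wpM2l//; exact: Bbd.
    have q3 : `|t - g| * (3 * Lh + `|lnsum h 0 0|) <= (2 / N%:R) * (3 * Lh + `|lnsum h 0 0|).
      by rewrite ler_wpM2r//; lra.
    have q4 : (2 / N%:R) * (3 * Lh + `|lnsum h 0 0|) = (2 * (3 * Lh + `|lnsum h 0 0|)) / N%:R by ring.
    lra.
  have h4 : `|(1 + t) / 2 - (1 + g) / 2| * (1 + `|ln e|) <= N%:R^-1 * (1 + `|ln e|).
    by rewrite ler_wpM2r// addr_ge0.
  have -> : (2 * (3 * Lh + `|lnsum h 0 0|) + 2 * (1 + `|ln e|)) / N%:R =
      2 * (3 * Lh + `|lnsum h 0 0|) / N%:R + 2 * (N%:R^-1 * (1 + `|ln e|)) by ring.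
  rewrite /kappa.
  lra.
- move=> y; have ty := tv_bound bms y.
  have [pe|pn] := eqVneq (p false y) 0.
    have := p_half bms false y; rewrite pe /sgb mulr1 mul0e /kappa => pz.
    rewrite lee_fin; have /esym/eqP := pz; rewrite mulf_eq0 => /orP[/eqP->|/eqP z].
      by rewrite mul0r.
    by rewrite z !mul0r eta0 mulr0 subrr mulr0.
  have pg : 0 < p false y by rewrite lt_neqAle eq_sym pn p0.
  have p1 := p_half bms false y; have p2 := p_half bms true y.
  rewrite /sgb mulr1 in p1; rewrite /sgb mulrN1 in p2.
  set t := tv p y in ty p1 p2 *; set hy := half p y in p1 p2 *.
  have hy0 : 0 < hy.
    by rewrite lt_neqAle (ge0_half bms) andbT eq_sym; apply/eqP => z; move: pn; rewrite p1 z mul0r eqxx.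
  have t0 : 0 < 1 + t by move: pg; rewrite p1 pmulr_rgt0.
  have r : p true y / p false y = (1 - t) / (1 + t).
    by rewrite p1 p2 -mulf_div divff ?mul1r// gt_eqF.
  have -> : hy * kappa t = p false y * (B t + - ln ((1 + t) / 2)).
    by rewrite p1 /kappa /eta; field.
  rewrite EFinM; apply: lee_wpmul2l; first by rewrite lee_fin.
  have := (@EtanhUs_le _ dV _ dP P1gt0 _ _ d ((1+t)/2) ((1-t)/2) (- ln ((1 + t) / 2)) (fun s => (ln (\prod_(u <- s) (1 + u) + p true y / p false y * \prod_(u <- s) (1 - u)))%:E) gl); apply;
    [lra|lra|move=> s hs].
  have A0 : 0 < \prod_(u <- s) (1 + u).
    by rewrite big_seq; apply: prodr_gt0 => u /hs; lra.
  have A1 : 0 <= \prod_(u <- s) (1 - u).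
    by rewrite big_seq; apply: prodr_ge0 => u /hs; lra.
  rewrite lee_fin r /lnsum; set a := \prod_(u <- s) (1 + u) in A0 *; set b := \prod_(u <- s) (1 - u) in A1 *.
  have -> : a + (1 - t) / (1 + t) * b = ((1 + t) / 2 * a + (1 - t) / 2 * b) / ((1 + t) / 2).
    by field; rewrite gt_eqF.
  have q1 : 0 < (1 + t) / 2 * a by rewrite mulr_gt0// divr_gt0.
  have q2 : 0 <= (1 - t) / 2 * b by rewrite mulr_ge0//; lra.
  have q3 : 0 < (1 + t) / 2 by rewrite divr_gt0.
  rewrite ln_div ?posrE//; last by lra.
  by rewrite lerD2r ler_ln ?posrE//; move: h0; lra.
Qed.

Lemma term1_le (d : nat) (eps : R) : 0 < eps ->
  exists Ng Nt, (0 < Ng)%N /\ (0 < Nt)%N /\ forall N N', (Ng <= N)%N -> (Nt <= N')%N ->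
  (\int[mu]_y ((p false y)%:E * EtanhUs dV P d (fun s =>
      (ln (\prod_(u <- s) (1 + u) + p true y / p false y * \prod_(u <- s) (1 - u)))%:E)) <=
   (ln 2 - lawE (chlaw mu p N) (@gfun R) +
    phi1 (chlaw mu p N :: nseq d (rmix P (tlaw dV N'))) + eps)%:E)%E.
Proof.
(* Four equal shares of [eps]: [2 * e], the smoothing [h], the channel grid and the rounding of the
   trial law. *)
move=> eps0; pose e := eps / 8; pose h := eps / 4.
have e0 : 0 < e by rewrite divr_gt0.
have h0 : 0 < h by rewrite divr_gt0.
have q0 : 0 < eps / 4 by rewrite divr_gt0.
set Lh := 2 ^+ d * h^-1.
have [Ng [Ng0 hNg]] := div_small (2 * (3 * Lh + `|lnsum h 0 0|) + 2 * (1 + `|ln e|)) q0.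
have [Nt [Nt0 hNt]] := div_small ((size P)%:R * iter_err (lnsum h) h^-1 d 1) q0.
exists Ng, Nt; split => //; split => // N N' hN hN'.
have N0 : (0 < N)%N by apply: leq_trans hN.
have N0' : (0 < N')%N by apply: leq_trans hN'.
apply: le_trans (term1_upper d N0 e0 h0) _; rewrite lee_fin -/Lh.
have lc := is_law_chlaw bms N0; have lt := is_law_tlaw dV N0'.
have lr := is_law_rmix dP P1gt0 lt.
have s1 := smoothed_phi1 h0 d lc lr.
have c0 : 0 <= (size P)%:R / N'%:R :> R by rewrite divr_ge0.
have s2 : `|sE (chlaw mu p N) (fun t => iter_avg (lnsum h) (UV dV P) d ((1 + t) / 2) ((1 - t) / 2)) -
   sE (chlaw mu p N) (fun t => iter_avg (lnsum h) (sE (rmix P (tlaw dV N'))) d ((1 + t) / 2) ((1 - t) / 2))|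
   <= (size P)%:R / N'%:R * iter_err (lnsum h) h^-1 d 1.
  apply: sE_near => // t t1.
  have := @iter_avg_near R (lnsum h) h^-1 (lnsum_lip h0) (UV dV P)
     (sE (rmix P (tlaw dV N'))) ((size P)%:R / N'%:R) d ((1 + t) / 2) ((1 - t) / 2)
     (averaging_UV dV dP P1gt0) (averaging_sE lr) c0
     (fun K C f hf => UV_tlaw dP P1gt0 sym N0' hf) ltac:(lra) ltac:(lra).
  by have -> : (1 + t) / 2 + (1 - t) / 2 = 1 by lra.
have := ler_norm (sE (chlaw mu p N) (fun t => iter_avg (lnsum h) (UV dV P) d ((1 + t) / 2) ((1 - t) / 2)) -
   sE (chlaw mu p N) (fun t => iter_avg (lnsum h) (sE (rmix P (tlaw dV N'))) d ((1 + t) / 2) ((1 - t) / 2))).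
have := hNg _ hN; have := hNt _ hN'.
have -> : (size P)%:R * iter_err (lnsum h) h^-1 d 1 / N'%:R = (size P)%:R / N'%:R * iter_err (lnsum h) h^-1 d 1 by ring.
rewrite /e /h in s1 s2 *; lra.
Qed.

End Channel_term.

(** * The two terms with ln(1 + product of tanh) *)

Section Log_terms.
Variables (R : realType) (dV : probability R R).
Hypothesis sym : symmetric_law dV.

Lemma ln_lip (m a b : R) : 0 < m -> m <= a -> m <= b -> `|ln a - ln b| <= m^-1 * `|a - b|.
Proof.
move=> m0 ma mb; have := @ln_shift_lip R m m0 (a - m) (b - m).
rewrite !subrK !subr_ge0 => /(_ ma mb); congr (_ <= _ * `| _ |); ring.
Qed.

Lemma norm_mul_le1 (c x : R) : -1 <= x <= 1 -> `|c * x| <= `|c|.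
Proof. by move=> x1; rewrite normrM ler_piMr// ler_norml. Qed.

Lemma ln1_lip (c : R) : `|c| < 1 ->
  lipk (1 - `|c|)^-1 (1 - `|c|)^-1 (fun x => ln (1 + c * x)).
Proof.
move=> c1; have m0 : 0 < 1 - `|c| by rewrite subr_gt0.
have lo x : -1 <= x <= 1 -> 1 - `|c| <= 1 + c * x.
  by move=> /(norm_mul_le1 c); rewrite ler_norml; lra.
have i0 : 0 <= (1 - `|c|)^-1 by rewrite invr_ge0 ltW.
split=> [x y x1 y1|x x1].
  apply: le_trans (ln_lip m0 (lo _ x1) (lo _ y1)) _; rewrite ler_wpM2l//.
  have -> : 1 + c * x - (1 + c * y) = c * (x - y) by ring.
  by rewrite normrM ler_piMl// ltW.
have l1 : 1 - `|c| <= 1 by rewrite gerBl.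
have := ln_lip m0 (lo _ x1) l1; rewrite ln1 subr0 => h; apply: le_trans h _.
have -> : 1 + c * x - 1 = c * x by ring.
by rewrite ler_piMr//; have := norm_mul_le1 c x1; lra.
Qed.

(** ln(1 + cx) is Lipschitz on [-1, 1] for |c| < 1, but not uniformly in [c]. Hence one tanh factor
    is kept outside as [c] and integrated separately. *)
Definition fk (k : nat) (c : R) : R := PV dV k (fun x => ln (1 + c * x)).

(** Pointwise limit along factors [r n] increasing to 1: shrinking the argument gives a Lipschitz
    constant uniform in [v], so each approximant falls under [lip_measurable]. *)
Lemma measurable_fk k : measurable_fun setT (fun v : R => fk k (tanhR v)).
Proof.
pose r n : R := 1 - n.+1%:R^-1.
have r01 n : 0 <= r n < 1.
  have i0 : 0 < n.+1%:R^-1 :> R by rewrite invr_gt0.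
  have i1 : n.+1%:R^-1 <= 1 :> R by rewrite invf_le1// ler1n.
  rewrite /r; move: i0 i1; set z := _^-1 => i0 i1; lra.
have r1 n : `|r n| < 1 by have := r01 n => /andP[q0 q1]; rewrite ger0_norm.
apply: (measurable_fun_cvg (h := fun (n : nat) (v : R) => PV dV k (fun x => ln (1 + r n * (tanhR v * x))))).
- by move=> n; exact: lip_measurable (PV_lip dV k (ln1_lip (r1 n))).
- move=> v _; set t := tanhR v.
  have t1 : `|t| < 1 by rewrite ltr_norml tanhR_bound.
  have m0 : 0 < 1 - `|t| by rewrite subr_gt0.
  apply/cvgrPdist_le => /= e e0.
  have [N0 [_ hN]] := @div_small R (1 - `|t|)^-1 e e0.
  exists N0 => // n /= nN.
  apply: le_trans (hN n.+1 (leq_trans nN (leqnSn _))).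
  have nt1 : `|r n * t| < 1 by rewrite normrM mulr_ilt1.
  have lr := ln1_lip nt1.
  have -> : PV dV k (fun x => ln (1 + r n * (t * x))) = PV dV k (fun x => ln (1 + r n * t * x)).
    by congr PV; apply/funext => x; rewrite mulrA.
  apply: (PV_near dV k (ln1_lip t1) lr) => x x1.
  have lo : 1 - `|t| <= 1 + t * x by have := norm_mul_le1 t x1; rewrite ler_norml; lra.
  have lo2 : 1 - `|t| <= 1 + r n * t * x.
    have := norm_mul_le1 (r n * t) x1; rewrite (normrM (r n) t).
    have : `|r n| * `|t| <= `|t| by rewrite ler_piMl// ltW.
    by rewrite ler_norml; lra.
  apply: le_trans (ln_lip m0 lo lo2) _; rewrite ler_wpM2l ?invr_ge0 ?(ltW m0)//.
  have -> : 1 + t * x - (1 + r n * t * x) = n.+1%:R^-1 * (t * x) by rewrite /r; ring.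
  rewrite normrM ger0_norm ?invr_ge0// ler_piMr ?invr_ge0//.
  by have := norm_mul_le1 t x1; lra.
Qed.

Lemma gpoly_lipk N : lipk (glip R N) (ln 2) (gpoly N).
Proof.
split=> [x y x1 y1|x x1]; first by apply: gpoly_lip; rewrite ler_norml.
by rewrite ger0_norm ?ge0_gpoly//; apply: le_trans (gpoly_le_gfun N x1) (gfun_le_ln2 x1).
Qed.

Lemma symf_fk k c N e : `|c| < 1 ->
  (forall x : R, -1 <= x <= 1 -> gpoly N x <= gfun x <= gpoly N x + e) ->
  PV dV k (fun x => gpoly N (c * x)) <= symf (fk k) c <= PV dV k (fun x => gpoly N (c * x)) + e.
Proof.
move=> c1 ap; have c1' : `|- c| < 1 by rewrite normrN.
have cb : -1 <= c <= 1 by rewrite -ler_norml ltW.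
have l1 := ln1_lip c1; have l2 := ln1_lip c1'.
pose a := 2^-1 * (1 + c); pose b := 2^-1 * (1 - c).
pose phi x := a * ln (1 + c * x) + b * ln (1 + - c * x).
have lphi : lipk ((`|a| + `|b|) * (1 - `|c|)^-1) ((`|a| + `|b|) * (1 - `|c|)^-1) phi.
  rewrite normrN in l2; case: l1 l2 => [l1 b1] [l2 b2].
  split=> [x y x1 y1|x x1]; rewrite /phi.
    have -> : a * ln (1 + c * x) + b * ln (1 + - c * x) - (a * ln (1 + c * y) + b * ln (1 + - c * y))
      = a * (ln (1 + c * x) - ln (1 + c * y)) + b * (ln (1 + - c * x) - ln (1 + - c * y)) by ring.
    apply: le_trans (ler_normD _ _) _; rewrite !normrM !mulrDl; apply: lerD.
      by rewrite -[leRHS]mulrA ler_wpM2l ?l1.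
    by rewrite -[leRHS]mulrA ler_wpM2l ?l2.
  apply: le_trans (ler_normD _ _) _; rewrite !normrM mulrDl; apply: lerD.
    by rewrite ler_wpM2l ?b1.
  by rewrite ler_wpM2l ?b2.
have -> : symf (fk k) c = PV dV k phi.
  by rewrite (PV_lin dV k a b l1 l2) /symf /fk /a /b; ring.
have sphi x : -1 <= x <= 1 -> symf phi x = gfun (c * x).
  by move=> x1; rewrite /symf /phi /gfun /eta /a /b !mulrN !mulNr !opprK; field.
rewrite (PV_sym k sym lphi).
have lg := lip_scale (gpoly_lipk N) cb.
have cx x : -1 <= x <= 1 -> -1 <= c * x <= 1 by exact: mul_itv1.
apply/andP; split.
  apply: (PV_le dV k lg (lip_symf lphi)) => x x1; rewrite sphi//.
  by case/andP: (ap _ (cx _ x1)).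
have := PV_lin dV k 1 1 lg (lip_cst e); rewrite !mul1r PV_cst => <-.
apply: (PV_le dV k (lip_symf lphi) _ (K' := glip R N + 0) (C' := ln 2 + `|e|)) => [|x x1].
  by under eq_fun do rewrite !mul1r; exact: lipD lg (lip_cst e).
by rewrite sphi// !mul1r; case/andP: (ap _ (cx _ x1)).
Qed.

Lemma fk_le_ln2 k c : `|c| < 1 -> fk k c <= ln 2.
Proof.
move=> c1; rewrite -[leRHS](PV_cst dV k).
apply: (PV_le dV k (ln1_lip c1) (lip_cst _)) => x x1.
have := norm_mul_le1 c x1; rewrite ler_norml => h.
by rewrite ler_ln ?posrE//; lra.
Qed.

Definition Aval (k : nat) : R :=
  if k is k'.+1 then fine (\int[dV]_v (fk k' (tanhR v))%:E)%E else ln 2.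

(** [sym_tanh] is applied to the nonnegative function [q], equal to [ln 2] minus [fk k]. The upper
    bound on its integral yields integrability as well. *)
Lemma Aval_spec k N e :
  (forall x : R, -1 <= x <= 1 -> gpoly N x <= gfun x <= gpoly N x + e) ->
  [/\ dV.-integrable setT (fun v => (fk k (tanhR v))%:E),
      (\int[dV]_v (fk k (tanhR v))%:E = (Aval k.+1)%:E)%E &
      PV dV k.+1 (gpoly N) <= Aval k.+1 <= PV dV k.+1 (gpoly N) + e].
Proof.
move=> ap; have tb v : `|tanhR v| < 1 :> R by rewrite ltr_norml tanhR_bound.
pose q t := ln 2 - fk k t.
have mq : measurable_fun setT (fun v => q (tanhR v)).
  by apply: measurable_funB => //; exact: measurable_fk.
have q0 t : -1 < t < 1 -> 0 <= q t.
  by move=> t1; rewrite subr_ge0 fk_le_ln2// ltr_norml.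
pose G t := PV dV k (fun x => gpoly N (t * x)).
have lG := PV_lip dV k (gpoly_lipk N) : lipk _ _ G.
have sq t : symf q t = ln 2 - symf (fk k) t by rewrite /symf /q; field.
have eq := sym_tanh sym mq q0.
have EG c : (\int[dV]_v (- G (tanhR v) + c)%:E = (- PV dV k.+1 (gpoly N) + c)%:E)%E.
  have l1 : lipk (glip R N + 0) (ln 2 + `|c|) (fun t => - G t + c).
    apply: lipD (lip_cst c); split=> [x y x1 y1|x x1]; last by rewrite normrN; exact: lG.2.
    by rewrite -opprD normrN; exact: lG.1.
  rewrite (EV_int dV l1); congr EFin.
  have := EV_lin dV (-1) 1 lG (lip_cst c); rewrite EV_cst mul1r mulN1r => <-.
  by congr EV; apply/funext => t; ring.
have u1 : (\int[dV]_v (q (tanhR v))%:E <= (- PV dV k.+1 (gpoly N) + ln 2)%:E)%E.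
  rewrite eq -EG; apply: le_integral_any => v; rewrite lee_fin sq.
  by have /andP[] := symf_fk k (tb v) ap; rewrite -/(G _); lra.
have u2 : ((- PV dV k.+1 (gpoly N) + (ln 2 - e))%:E <= \int[dV]_v (q (tanhR v))%:E)%E.
  rewrite eq -EG; apply: le_integral_any => v; rewrite lee_fin sq.
  by have /andP[] := symf_fk k (tb v) ap; rewrite -/(G _); lra.
have iq : dV.-integrable setT (fun v => (q (tanhR v))%:E).
  apply/integrableP; split; first exact/measurable_EFinP.
  under eq_integral => v _ do rewrite /= ger0_norm ?q0 ?tanhR_bound//.
  by apply: le_lt_trans u1 _; rewrite ltry.
have ic : dV.-integrable setT (fun=> (ln 2 : R)%:E).
  by apply: finite_measure_integrable_cst.
have fE v : ((fk k (tanhR v))%:E = (ln 2)%:E - (q (tanhR v))%:E)%E.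
  by rewrite -EFinB /q; congr EFin; ring.
have ifk : dV.-integrable setT (fun v => (fk k (tanhR v))%:E).
  by under eq_fun do rewrite fE; exact: integrableB.
have E : (\int[dV]_v (fk k (tanhR v))%:E = (Aval k.+1)%:E)%E.
  by rewrite /= fineK//; exact: integrable_fin_num.
split => //; move: E; under eq_integral do rewrite fE.
rewrite integralB// integral_cst//= probability_setT mule1.
have /fineK <- := integrable_fin_num measurableT iq.
rewrite -(fineK (integrable_fin_num measurableT iq)) in u1 u2.
move: u1 u2; rewrite !lee_fin; set z := fine _ => u1 u2 [<-].
by move: u1 u2; rewrite [PV _ _.+1 _]/=; lra.
Qed.

Lemma vint_ln k : vint dV k (fun s => (ln (1 + prod_tanh s))%:E) = (Aval k)%:E.
Proof.
case: k => [|k] /=; first by rewrite /prod_tanh big_nil.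
have [N ap] := @gfun_approx R 1 ltr01; have [_ <- _] := Aval_spec k ap.
apply: eq_integral => v _; have tb : `|tanhR v| < 1 :> R by rewrite ltr_norml tanhR_bound.
rewrite -(vint_PV dV k (ln1_lip tb)).
by congr vint; apply/funext => s; rewrite /prod_tanh big_cons.
Qed.

Lemma int_EtanhU_ln P : (\int[dV]_v EtanhU dV P (fun u => (ln (1 + tanhR v * u))%:E) =
  (\sum_(k < size P) rho P k * Aval k.-1.+1)%:E)%E.
Proof.
have [N ap] := @gfun_approx R 1 ltr01.
transitivity (\int[dV]_v (\sum_(k < size P) (rho P k)%:E * (fk k.-1 (tanhR v))%:E))%E.
  apply: eq_integral => v _; apply: eq_bigr => k _; congr (_ * _)%E.
  have tb : `|tanhR v| < 1 :> R by rewrite ltr_norml tanhR_bound.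
  by rewrite (vint_PV dV k.-1 (ln1_lip tb)).
rewrite integral_sum//=; last first.
  by move=> k; apply: integrableZl => //; have [] := Aval_spec k.-1 ap.
rewrite -sumEFin; apply: eq_bigr => k _; have [i1 i2 _] := Aval_spec k.-1 ap.
by rewrite integralZl// i2 -EFinM.
Qed.

Lemma Aval_tlaw k eps : 0 < eps -> exists N0, (0 < N0)%N /\ forall N, (N0 <= N)%N ->
  `|Aval k - lawE (pw (tlaw dV N) k) (@gfun R)| <= eps.
Proof.
move=> e0; case: k => [|k].
  by exists 1%N; split => // N _; rewrite /= lawE_hard gfun1 subrr normr0 ltW.
have e3 : 0 < eps / 3 by rewrite divr_gt0.
have [K ap] := gfun_approx e3; have [_ _ /andP[h1 h2]] := Aval_spec k ap.
have [N0 [N00 hN]] := @div_small R (k.+1%:R * (glip R K + ln 2)) _ e3.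
exists N0; split => // N NN; have Np : (0 < N)%N by exact: leq_trans NN.
have := PV_tlaw k.+1 sym Np (gpoly_lipk K); set l := pw _ _.
have hl : is_law l by apply: is_law_pw; exact: is_law_tlaw.
have -> : sE l (gpoly K) = lawE l (gpoly K).
  by apply: eq_lawE => u; rewrite /symf gpolyN; field.
have := hN _ NN; rewrite -[k.+1%:R * _ / _]mulrA => h3 h4.
have h5 : lawE l (gpoly K) <= lawE l (@gfun R).
  by apply: lawE_le => // x /ap/andP[].
have h6 : lawE l (@gfun R) <= lawE l (gpoly K) + eps / 3.
  by rewrite -[X in _ + X](lawE_cst _ hl) -lawED; apply: lawE_le => // x /ap/andP[].
have := le_trans h4 h3; rewrite !ler_norml; lra.
Qed.

End Log_terms.

(** * The replica-symmetric functional for the approximating laws *)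

Section Finite_bound.
Variable R : realType.

(** Common target of both halves: [hRS] is bounded above by it, the entropy below. The quantity
    [ln 2 - lawE ch gfun] is the mean of -ln((1+t)/2) given X = 0, produced by the normalisation of
    the first term. *)
Definition Efin (Lam P : seq R) (ch tl : law R) : R :=
  \sum_(d < size Lam) Lam`_d *
     (ln 2 - lawE ch (@gfun R) + phi1 (ch :: nseq d (rmix P tl)))
  + dpoly1 Lam / dpoly1 P * (\sum_(k < size P) P`_k * ((1 - k%:R) * lawE (pw tl k) (@gfun R)))
  - dpoly1 Lam / dpoly1 P * ln 2.

Lemma eventually_forall_lt (Q : nat -> nat -> Prop) :
  (forall d, exists N0, forall N, (N0 <= N)%N -> Q d N) ->
  forall m, exists N0, forall N, (N0 <= N)%N -> forall d, (d < m)%N -> Q d N.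
Proof.
move=> h; elim=> [|m [N0 IH]]; first by exists 0%N.
have [N1 h1] := h m; exists (maxn N0 N1) => N; rewrite geq_max => /andP[a b] d.
by rewrite ltnS leq_eqVlt => /predU1P[->|dm]; [exact: h1|exact: IH].
Qed.

Lemma ge0_dpoly1 (L : seq R) : deg_dist L -> 0 <= dpoly1 L.
Proof. by move=> dL; apply: sumr_ge0 => d _; rewrite mulr_ge0// dL.1. Qed.

Context (disp : measure_display) (Y : measurableType disp) (mu : {measure set Y -> \bar R})
  (p : bool -> Y -> R).
Hypothesis bms : bms_channel mu p.
Variables (dV : probability R R) (Lam P : seq R).
Hypothesis sym : symmetric_law dV.
Hypothesis dLam : deg_dist Lam.
Hypothesis dP : deg_dist P.
Hypothesis P1gt0 : 0 < dpoly1 P.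

(** A message entering a check of degree k times the check's output to that edge is the product of
    all k values. Since P'(1) rho_k = k P_k, the third term merges with the second and gives the
    factor 1 - k. *)
Lemma hRS_E : (hRS mu p dV Lam P = hRS_term1 mu p dV Lam P +
   (dpoly1 Lam / dpoly1 P * (\sum_(k < size P) P`_k * ((1 - k%:R) * Aval dV k))
    - dpoly1 Lam / dpoly1 P * ln 2)%:E)%E.
Proof.
rewrite /hRS (int_EtanhU_ln sym).
under eq_bigr do rewrite (vint_ln sym) -EFinM.
rewrite sumEFin -!EFinM -addeA -addeA; congr (_ + _)%E.
rewrite -!EFinN -!EFinD; congr EFin.
suff -> : dpoly1 Lam * (\sum_(k < size P) rho P k * Aval dV k.-1.+1) =
    dpoly1 Lam / dpoly1 P * (\sum_(k < size P) P`_k * (k%:R * Aval dV k)).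
  rewrite addrA -mulrBr -sumrB; congr (_ * _ - _); apply: eq_bigr => k _; ring.
rewrite -mulrA; congr (_ * _); rewrite big_distrr; apply: eq_bigr => -[[|k] hk] _ /=.
  by rewrite /rho !mul0r !mulr0.
rewrite /rho; ring.
Qed.

Lemma hRS_le (eps : R) : 0 < eps ->
  exists N, (0 < N)%N /\ (hRS mu p dV Lam P <= (Efin Lam P (chlaw mu p N) (tlaw dV N) + eps)%:E)%E.
Proof.
move=> e0; pose c := dpoly1 Lam / dpoly1 P.
have c0 : 0 <= c by rewrite divr_ge0 ?ge0_dpoly1.
pose S := \sum_(k < size P) P`_k * `|1 - k%:R|.
have S0 : 0 <= S by apply: sumr_ge0 => k _; rewrite mulr_ge0 ?dP.1.
pose e1 := eps / 2; have e10 : 0 < e1 by rewrite divr_gt0.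
(* Chosen so that c S e2 <= eps/2; the summand 1 covers the case c S = 0. *)
pose e2 := eps / (2 * (c * S + 1)).
have cS : 0 < c * S + 1 by rewrite ltr_wpDl// mulr_ge0.
have e20 : 0 < e2 by rewrite divr_gt0// mulr_gt0.
have [N1 h1] : exists N0, forall N, (N0 <= N)%N -> forall d, (d < size Lam)%N ->
  (\int[mu]_y ((p false y)%:E * EtanhUs dV P d (fun s =>
      (ln (\prod_(u <- s) (1 + u) + p true y / p false y * \prod_(u <- s) (1 - u)))%:E)) <=
   (ln 2 - lawE (chlaw mu p N) (@gfun R) +
    phi1 (chlaw mu p N :: nseq d (rmix P (tlaw dV N))) + e1)%:E)%E.
  apply: eventually_forall_lt => d.
  have [Ng [Nt [_ [_ h]]]] := term1_le bms sym dP P1gt0 d e10.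
  by exists (maxn Ng Nt) => N; rewrite geq_max => /andP[a b]; exact: h.
have [N2 h2] : exists N0, forall N, (N0 <= N)%N -> forall k, (k < size P)%N ->
    `|Aval dV k - lawE (pw (tlaw dV N) k) (@gfun R)| <= e2.
  apply: eventually_forall_lt => k; have [N0 [_ h]] := Aval_tlaw sym k e20.
  by exists N0.
exists (maxn N1 N2).+1; split => //; set N := _.+1.
have g1 : (N1 <= N)%N by rewrite ltnW// ltnS leq_maxl.
have g2 : (N2 <= N)%N by rewrite ltnW// ltnS leq_maxr.
have T1 : (hRS_term1 mu p dV Lam P <= (\sum_(d < size Lam) Lam`_d *
     (ln 2 - lawE (chlaw mu p N) (@gfun R) + phi1 (chlaw mu p N :: nseq d (rmix P (tlaw dV N)))) + e1)%:E)%E.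
  have -> : \sum_(d < size Lam) Lam`_d *
     (ln 2 - lawE (chlaw mu p N) (@gfun R) + phi1 (chlaw mu p N :: nseq d (rmix P (tlaw dV N)))) + e1 =
    \sum_(d < size Lam) Lam`_d *
     (ln 2 - lawE (chlaw mu p N) (@gfun R) + phi1 (chlaw mu p N :: nseq d (rmix P (tlaw dV N))) + e1).
    rewrite -[e1 in LHS]mul1r -dLam.2 mulr_suml -big_split; apply: eq_bigr => d _ /=; ring.
  rewrite -sumEFin; apply: lee_sum => d _; rewrite [(Lam`_d * _)%:E]EFinM.
  by apply: lee_wpmul2l; [rewrite lee_fin dLam.1|exact: h1].
rewrite hRS_E; apply: le_trans (leeD2r _ T1) _; rewrite -EFinD lee_fin /Efin -/c.
have T2 : \sum_(k < size P) P`_k * ((1 - k%:R) * Aval dV k) <=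
    \sum_(k < size P) P`_k * ((1 - k%:R) * lawE (pw (tlaw dV N) k) (@gfun R)) + S * e2.
  rewrite mulr_suml -big_split; apply: ler_sum => k _ /=.
  have := h2 N g2 k (ltn_ord k) => h.
  have q : (1 - k%:R) * (Aval dV k - lawE (pw (tlaw dV N) k) (@gfun R)) <= `|1 - k%:R : R| * e2.
    by apply: le_trans (ler_norm _) _; rewrite normrM ler_wpM2l.
  have := ler_wpM2l (dP.1 k) q; lra.
have T3 := ler_wpM2l c0 T2.
have T4 : c * (S * e2) <= eps / 2.
  rewrite /e2 mulrA.
  have -> : c * S * (eps / (2 * (c * S + 1))) = (c * S) / (c * S + 1) * (eps / 2).
    by field; rewrite gt_eqF.
  by apply: ler_piMl; [exact: ltW|rewrite ler_pdivrMr// mul1r lerDl].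
rewrite mulrDr in T3; rewrite /e1; lra.
Qed.

End Finite_bound.

(** * Degree sequences of the ensemble and its sockets *)

Section Sockets.

Lemma size_sockets degs : size (sockets degs) = sumn degs.
Proof.
rewrite /sockets size_flatten /shape -map_comp.
have -> : [seq (size \o (fun i => nseq (nth 0%N degs i) i)) i | i <- iota 0 (size degs)] =
    [seq nth 0%N degs i | i <- iota 0 (size degs)].
  by apply: eq_map => i /=; rewrite size_nseq.
by rewrite -/(mkseq _ _) mkseq_nth.
Qed.

Lemma count_sockets degs i : count_mem i (sockets degs) = nth 0%N degs i.
Proof.
rewrite /sockets count_flatten -map_comp sumnE big_map.
under eq_bigr => j _ do rewrite /= count_nseq /=.
have [il|il] := ltnP i (size degs); last first.
  rewrite nth_default// big_seq big1// => j; rewrite mem_iota add0n => /= jl.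
  by case: eqP => // e; move: jl; rewrite e ltnNge il.
rewrite (bigD1_seq i)/= ?mem_iota ?iota_uniq//= eqxx mul1n big1 ?addn0// => j /negbTE.
by move=> ->.
Qed.

Lemma sockets_lt degs i : i \in sockets degs -> (i < size degs)%N.
Proof.
move=> /flattenP[s /mapP[j jl ->]]; rewrite mem_nseq => /andP[_ /eqP->].
by move: jl; rewrite mem_iota.
Qed.

Lemma big_nth_degs (R : realType) degs (F : nat -> R) :
  \sum_(i < size degs) F (nth 0%N degs i) = \sum_(x <- degs) F x.
Proof. by rewrite (big_nth 0%N) big_mkord. Qed.

Lemma big_degs (R : realType) (c : nat -> nat) m (F : nat -> R) :
  \sum_(x <- flatten [seq nseq (c d) d | d <- iota 0 m]) F x = \sum_(d < m) (c d)%:R * F d.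
Proof.
rewrite big_flatten big_map -[in iota _ _](subn0 m) big_mkord.
apply: eq_bigr => d _; rewrite big_nseq iter_addr_0; by rewrite mulr_natl.
Qed.

Lemma count_ord_nth N (s : seq nat) (i : nat) : size s = N ->
  size [seq a : 'I_N <- enum 'I_N | nth 0%N s (nat_of_ord a) == i] = count_mem i s.
Proof.
move=> sN; rewrite size_filter -[X in _ = count _ X](mkseq_nth 0%N s) /mkseq [RHS]count_map sN.
by rewrite -val_enum_ord [RHS]count_map; exact: eq_count.
Qed.

End Sockets.

Section Degree_counts.
Variables (R : realType) (Lam P : seq R) (n : nat).
Hypothesis dLam : deg_dist Lam.
Hypothesis dP : deg_dist P.
Hypothesis P1gt0 : 0 < dpoly1 P.
Hypothesis adm : admissible Lam P n.

Lemma nV_E d : (nV Lam n d)%:R = n%:R * Lam`_d.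
Proof. by rewrite /nV; have [k ->] := adm.1 d; rewrite truncnK. Qed.

Lemma nC_E k : (nC Lam P n k)%:R = nchecksR Lam P n * P`_k.
Proof. by rewrite /nC; have [j ->] := adm.2 k; rewrite truncnK. Qed.

Lemma sum_vdeg (F : nat -> R) :
  \sum_(x <- vdeg Lam n) F x = n%:R * \sum_(d < size Lam) Lam`_d * F d.
Proof. by rewrite big_degs big_distrr; apply: eq_bigr => d _ /=; rewrite nV_E mulrA. Qed.

Lemma sum_cdeg (F : nat -> R) :
  \sum_(x <- cdeg Lam P n) F x = nchecksR Lam P n * \sum_(k < size P) P`_k * F k.
Proof. by rewrite big_degs big_distrr; apply: eq_bigr => d _ /=; rewrite nC_E mulrA. Qed.

Lemma size_sum (s : seq nat) : (size s)%:R = \sum_(x <- s) (1 : R).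
Proof. by rewrite big_const_seq count_predT iter_addr_0. Qed.

Lemma sumn_sum (s : seq nat) : (sumn s)%:R = \sum_(x <- s) (x%:R : R).
Proof. by rewrite sumnE natr_sum. Qed.

Lemma size_vdeg : size (vdeg Lam n) = n.
Proof.
apply/eqP; rewrite -(eqr_nat R) size_sum sum_vdeg.
by under eq_bigr do rewrite mulr1; rewrite dLam.2 mulr1.
Qed.

Lemma size_cdeg : size (cdeg Lam P n) = mC Lam P n.
Proof.
rewrite /cdeg size_flatten /shape -map_comp sumnE big_map /mC -[in iota _ _](subn0 (size P)) big_mkord.
by apply: eq_bigr => k _ /=; rewrite size_nseq.
Qed.

Lemma mC_E : (mC Lam P n)%:R = nchecksR Lam P n.
Proof.
rewrite -size_cdeg size_sum sum_cdeg.
by under eq_bigr do rewrite mulr1; rewrite dP.2 mulr1.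
Qed.

Lemma nedges_E : (nedges Lam n)%:R = n%:R * dpoly1 Lam.
Proof.
rewrite /nedges /vsock size_sockets sumn_sum sum_vdeg; congr (_ * _).
by apply: eq_bigr => d _; rewrite mulrC.
Qed.

Lemma size_csock : size (csock Lam P n) = nedges Lam n.
Proof.
apply/eqP; rewrite -(eqr_nat R) nedges_E /csock size_sockets sumn_sum sum_cdeg.
rewrite /nchecksR; under eq_bigr do rewrite mulrC.
by rewrite -/(dpoly1 P) divfK// gt_eqF.
Qed.

(** Closed by [Defined], as later proofs identify the value of this ordinal with the entry of
    [vsock] by conversion. *)
Definition vnode (a : 'I_(nedges Lam n)) : 'I_n.
Proof.
by apply: (@Ordinal n (nth 0%N (vsock Lam n) a)); rewrite -[X in (_ < X)%N]size_vdeg; apply: sockets_lt;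
  exact: mem_nth.
Defined.

Definition cnode (a : 'I_(nedges Lam n)) : 'I_(mC Lam P n).
Proof.
by apply: (@Ordinal (mC Lam P n) (nth 0%N (csock Lam P n) a)); rewrite -size_cdeg; apply: sockets_lt;
  apply: mem_nth; rewrite size_csock.
Defined.

Lemma kdeg_cnode c : kdeg cnode c = nth 0%N (cdeg Lam P n) c.
Proof. by rewrite -count_sockets -/(csock _ _ _) -(count_ord_nth _ size_csock). Qed.

Lemma size_socks i : size (socks vnode i) = nth 0%N (vdeg Lam n) i.
Proof. by rewrite -count_sockets -/(vsock _ _) -(@count_ord_nth (nedges Lam n)). Qed.

Lemma sum_checks (F : nat -> R) :
  \sum_(c : 'I_(mC Lam P n)) F (kdeg cnode c) = nchecksR Lam P n * \sum_(k < size P) P`_k * F k.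
Proof.
rewrite -sum_cdeg -big_nth_degs size_cdeg.
by apply: eq_bigr => c _; rewrite kdeg_cnode.
Qed.

Lemma sum_vars (F : nat -> R) :
  \sum_(i < n) F (size (socks vnode i)) = n%:R * \sum_(d < size Lam) Lam`_d * F d.
Proof.
rewrite -sum_vdeg -big_nth_degs size_vdeg.
by apply: eq_bigr => i _; rewrite size_socks.
Qed.

Lemma kdeg_lt c : (kdeg cnode c < size P)%N.
Proof.
have : nth 0%N (cdeg Lam P n) c \in cdeg Lam P n by rewrite mem_nth// size_cdeg.
rewrite kdeg_cnode => /flattenP[s /mapP[k kl ->]]; rewrite mem_nseq => /andP[_ /eqP->].
by move: kl; rewrite mem_iota.
Qed.

(** A uniform check socket belongs to a check of degree k with the edge-perspective probability
    [rho P k]. *)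
Lemma lawE_mix_rmix tl f : 0 < n%:R * dpoly1 Lam ->
  lawE (mix cnode tl) f = lawE (rmix P tl) f.
Proof.
move=> L0; rewrite lawE_mix lawE_rmix card_ord nedges_E.
have -> : \sum_(a : 'I_(nedges Lam n)) lawE (lwk cnode tl (cnode a)) f =
    \sum_(c : 'I_(mC Lam P n)) (fun k => k%:R * lawE (pw tl k.-1) f) (kdeg cnode c).
  rewrite (partition_big cnode predT)//=; apply: eq_bigr => c _.
  rewrite (eq_bigr (fun=> lawE (lwk cnode tl c) f)); last by move=> a /eqP->.
  rewrite sumr_const /lwk -[LHS]mulr_natl; congr (_ * _).
  by rewrite -sum1_card /kdeg /blk -sum1_size big_filter big_enum_cond.
rewrite (sum_checks (fun k => k%:R * lawE (pw tl k.-1) f)) mulrA /nchecksR big_distrr; apply: eq_bigr => k _ /=.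
have /andP[n0 l0] : (n%:R != 0 :> R) && (dpoly1 Lam != 0) by rewrite -negb_or -mulf_eq0 gt_eqF.
by rewrite /rho; field; rewrite n0 l0 gt_eqF.
Qed.

End Degree_counts.

Lemma In_map_ind (A B : Type) (Q : B -> Prop) (f : A -> B) (s : seq A) :
  (forall a, Q (f a)) -> forall b, List.In b (map f s) -> Q b.
Proof. by move=> h; elim: s => //= a s IH b [<-|/IH]. Qed.

Section Code_entropy.
Variables (R : realType) (Lam P : seq R) (n : nat).
Hypothesis dLam : deg_dist Lam.
Hypothesis dP : deg_dist P.
Hypothesis P1gt0 : 0 < dpoly1 P.
Hypothesis adm : admissible Lam P n.
Local Notation vnode := (vnode dLam adm).
Local Notation cnode := (cnode P1gt0 adm).
Implicit Types (pi : {perm 'I_(nedges Lam n)}) (x : n.-tuple bool).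

(** [ldpc_code] sends variable sockets to check sockets, whereas [cp] reads from the check side.
    Hence the inverse, which the average over all matchings absorbs. *)
Definition parity pi (c : 'I_(mC Lam P n)) : n.-tuple bool -> R :=
  pchi (cp (vspin R vnode) pi^-1%g) (blk cnode c).

Lemma parityE pi c x : parity pi c x =
  (-1) ^+ (\sum_(j < nedges Lam n | nth 0 (csock Lam P n) (pi j) == c)
             (nth false x (nth 0 (vsock Lam n) j) : nat)).
Proof.
rewrite /parity /pchi big_filter big_enum_cond /= (reindex_inj (@perm_inj _ pi)) /=.
rewrite -prodrXr; apply: eq_big => [j|j _]; first by rewrite -val_eqE.
rewrite /cp permK /vspin /sg /sgb (tnth_nth false) /=.
by case: (nth false x _); rewrite ?expr1 ?expr0.
Qed.

Lemma ldpc_parity pi x :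
  (x \in @ldpc_code R Lam P n pi) = all (fun chi => chi x == 1) [seq parity pi c | c <- enum 'I_(mC Lam P n)].
Proof.
rewrite inE all_map; apply/forallP/allP => [h c _|h c].
  by rewrite /= parityE -signr_odd (negbTE (h c)) expr0.
have := h c (mem_enum _ c); rewrite /= parityE -signr_odd.
case: odd => //; rewrite expr1 => /eqP; lra.
Qed.

Lemma parity_char pi c : ischar (parity pi c) /\ parity pi c (zerox n) = 1.
Proof.
split; first by apply: ischar_prod => a; exact: ischar_sg.
rewrite parityE big1 ?expr0// => j _; rewrite -[nth 0%N _ j]/(nat_of_ord (vnode j)).
by rewrite -tnth_nth tnth_mktuple.
Qed.

Context (disp : measure_display) (Y : measurableType disp) (mu : {measure set Y -> \bar R})
  (p : bool -> Y -> R).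
Hypothesis bms : bms_channel mu p.
Variable N : nat.
Hypothesis N0 : (0 < N)%N.
Local Notation ch := (chlaw mu p N).

Lemma code_entropy_ge pi :
  ((EE (chan n ch ++ checks R vnode cnode pi^-1%g) (@u0 R n) PhiF
     + n%:R * ln 2 - (mC Lam P n)%:R * ln 2 - n%:R * lawE ch (@gfun R))%:E
   <= cond_entropy mu p (@ldpc_code R Lam P n pi))%E.
Proof.
have := cond_entropy_ge bms N0 (chis := [seq parity pi c | c <- enum 'I_(mC Lam P n)])
  (In_map_ind (parity_char pi)) (ldpc_parity pi).
by rewrite size_map size_enum_ord EE_catC -map_comp.
Qed.

Lemma avg_entropy_ge : (0 < n)%N ->
  ((n%:R^-1 * avgP (fun pi => EE (chan n ch ++ checks R vnode cnode pi) (@u0 R n) PhiF)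
     + ln 2 - n%:R^-1 * (mC Lam P n)%:R * ln 2 - lawE ch (@gfun R))%:E
   <= ens_avg_h mu p Lam P n)%E.
Proof.
move=> n0; have nR : 0 < n%:R :> R by rewrite ltr0n.
set f := fun pi => EE _ _ _.
have -> : n%:R^-1 * avgP f + ln 2 - n%:R^-1 * (mC Lam P n)%:R * ln 2 - lawE ch (@gfun R) =
  (#|{perm 'I_(nedges Lam n)}|%:R)^-1 * n%:R^-1 * \sum_(pi : {perm 'I_(nedges Lam n)})
    (f pi^-1%g + n%:R * ln 2 - (mC Lam P n)%:R * ln 2 - n%:R * lawE ch (@gfun R)).
  have cg := card_perm_gt0 R 'I_(nedges Lam n).
  have -> : \sum_(pi : {perm 'I_(nedges Lam n)})
    (f pi^-1%g + n%:R * ln 2 - (mC Lam P n)%:R * ln 2 - n%:R * lawE ch (@gfun R)) =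
    \sum_(pi : {perm 'I_(nedges Lam n)}) f pi +
     #|{perm 'I_(nedges Lam n)}|%:R * (n%:R * ln 2 - (mC Lam P n)%:R * ln 2 - n%:R * lawE ch (@gfun R)).
    rewrite [X in _ = X + _](reindex_inj (@invg_inj _)) [X in _ = _ + X]mulr_natl -[X in _ = _ + X]sumr_const.
    rewrite (eq_bigl predT)// -big_split.
    by apply: eq_bigr => pi _ /=; ring.
  by rewrite /avgP; field; rewrite !gt_eqF.
rewrite /ens_avg_h EFinM; apply: lee_wpmul2l.
  by rewrite lee_fin mulr_ge0// invr_ge0.
by rewrite -sumEFin; apply: lee_sum => pi _; exact: code_entropy_ge.
Qed.

End Code_entropy.

Section Step_error.
Variable R : realType.

Lemma step_err_le (T : finType) (pool : seq T) K (d e : R) m r k kap :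
  (0 < m)%N -> (m < r)%N -> (r <= size pool)%N -> (k <= kap)%N -> 0 < d -> 0 <= e ->
  step_err pool K d e m k / m%:R <=
   kap%:R ^+ 2 / (r - m)%:R + kap%:R * glip R K * d + kap%:R ^+ 2 * (glip R K * d^-1 + 1) / m%:R + kap%:R * e.
Proof.
move=> m0 mr rS kk d0 e0; have mR : 0 < m%:R :> R by rewrite ltr0n.
have G0 := ge0_glip R K; have i0 : 0 <= d^-1 by rewrite invr_ge0 ltW.
have -> : step_err pool K d e m k / m%:R = k%:R ^+ 2 / (size pool - m)%:R + k%:R * glip R K * d +
   k%:R ^+ 2 * (glip R K * d^-1 + 1) / m%:R + k%:R * e.
  have q0 : (size pool - m)%:R != 0 :> R by rewrite pnatr_eq0 subn_eq0 -ltnNge (leq_trans mr rS).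
  by rewrite /step_err; field; rewrite q0 !gt_eqF.
have kR : k%:R <= kap%:R :> R by rewrite ler_nat.
have k2 : k%:R ^+ 2 <= kap%:R ^+ 2 :> R by rewrite lerXn2r ?nnegrE.
apply: lerD; last by rewrite ler_wpM2r.
apply: lerD; last first.
  by rewrite ler_wpM2r ?invr_ge0 ?(ltW mR)// ler_wpM2r// addr_ge0// mulr_ge0.
apply: lerD; last by rewrite ler_wpM2r ?(ltW d0)// ler_wpM2r.
have rm : 0 < (r - m)%:R :> R by rewrite ltr0n subn_gt0.
apply: ler_pM => //; try by rewrite ?invr_ge0 ?exprn_ge0.
rewrite lef_pV2 ?posrE//; first by rewrite ler_nat leq_sub2r.
by rewrite ltr0n subn_gt0 (leq_trans mr).
Qed.

(** Order of choice: [e] and with it [K], then [d] against the Lipschitz constant, then [m] against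
    1/d, finally the surplus [q] of the pool against collisions. Each contribution gets a quarter of
    [delta], and nothing depends on the graph, so the pool stays bounded. *)
Lemma step_params kap (delta : R) : 0 < delta ->
  exists K d e m r, [/\ (0 < m < r)%N, 0 < d, 0 <= e,
    forall x : R, -1 <= x <= 1 -> gfun x <= gpoly K x + e &
    forall (T : finType) (pool : seq T) k, (r <= size pool)%N -> (k <= kap)%N ->
      step_err pool K d e m k / m%:R + e <= delta].
Proof.
move=> D0; pose e := delta / (4 * (kap%:R + 1)).
have k1 : 0 < kap%:R + 1 :> R by rewrite ltr_wpDl.
have e0 : 0 < e by rewrite divr_gt0// mulr_gt0.
have [K ap] := gfun_approx e0; set G := glip R K; have G0 : 0 <= G := ge0_glip R K.
have kG : 0 < kap%:R * G + 1 by rewrite ltr_wpDl// mulr_ge0.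
pose d := delta / (4 * (kap%:R * G + 1)).
have d0 : 0 < d by rewrite divr_gt0// mulr_gt0.
have D4 : 0 < delta / 4 by rewrite divr_gt0.
have [m [m0 hm]] := div_small (kap%:R ^+ 2 * (G * d^-1 + 1)) D4.
have [q [q0 hq]] := div_small (kap%:R ^+ 2) D4.
exists K, d, e, m, (m + q)%N; split => //.
- by rewrite m0/= -[X in (X < _)%N]addn0 ltn_add2l.
- exact: ltW.
- by move=> x /ap/andP[].
move=> T pool k rS kk.
have mq : (m < m + q)%N by rewrite -[X in (X < _)%N]addn0 ltn_add2l.
have := step_err_le K m0 mq rS kk d0 (ltW e0); rewrite addKn -/G.
have := hm _ (leqnn _); have := hq _ (leqnn _).
have h1 : kap%:R * G * d <= delta / 4.
  have -> : kap%:R * G * d = (kap%:R * G) / (kap%:R * G + 1) * (delta / 4).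
    by rewrite /d; field; rewrite gt_eqF.
  by apply: ler_piMl; [exact: ltW|rewrite ler_pdivrMr// mul1r lerDl].
have h2 : kap%:R * e + e = delta / 4.
  by rewrite /e; field; rewrite gt_eqF.
lra.
Qed.

Lemma EE_nseq_law (X : finType) (l l' : law R) (chi : X -> R) d w Psi :
  (forall f, lawE l f = lawE l' f) -> EE (nseq d (l, chi)) w Psi = EE (nseq d (l', chi)) w Psi.
Proof.
by move=> h; elim: d w => //= d IH w; rewrite /Ob /= h; apply: eq_lawE => u; rewrite !IH.
Qed.

End Step_error.

(** * Assembly for large n *)

Section Asymptotics.
Variables (R : realType) (Lam P : seq R) (tl ch : law R).
Hypothesis dLam : deg_dist Lam.
Hypothesis dP : deg_dist P.
Hypothesis P1gt0 : 0 < dpoly1 P.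
Hypothesis tl_law : is_law tl.
Hypothesis ch_law : is_law ch.
Local Notation c := (dpoly1 Lam / dpoly1 P).

Lemma mixed_phi1 n (adm : admissible Lam P n) d : (0 < n)%N ->
  Lam`_d * phi1 (ch :: nseq d (mix (cnode P1gt0 adm) tl)) = Lam`_d * phi1 (ch :: nseq d (rmix P tl)).
Proof.
move=> n0; case: d => // d; have [->|L0] := eqVneq Lam`_d.+1 0; first by rewrite !mul0r.
have dL : (d.+1 < size Lam)%N.
  by rewrite ltnNge; apply/negP => h; move: L0; rewrite nth_default// eqxx.
have phi1E l : phi1 (ch :: nseq d.+1 l) =
    Ob (ch, @sgb R) (fun=> 2^-1) (fun w => EE (nseq d.+1 (l, @sgb R)) w PhiF).
  by rewrite /phi1 map_cons map_nseq.
congr (_ * _); rewrite !phi1E; apply: eq_lawE => u.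
have E w : EE (nseq d.+1 (mix (cnode P1gt0 adm) tl, @sgb R)) w PhiF =
    EE (nseq d.+1 (rmix P tl, @sgb R)) w PhiF.
  apply: EE_nseq_law => f; apply: lawE_mix_rmix.
  rewrite mulr_gt0 ?ltr0n// /dpoly1 (bigD1 (Ordinal dL))//= ltr_pwDl//.
    by rewrite mulr_gt0 ?ltr0n// lt_neqAle eq_sym L0 dLam.1.
  by apply: sumr_ge0 => i _; rewrite mulr_ge0// dLam.1.
by rewrite !E.
Qed.

(** Total of [samp_err] over the n variables. The number of sockets is n times [dpoly1 Lam], so [n]
    cancels. *)
Definition samp_const : R := \sum_(d < size Lam) Lam`_d * (d.+1%:R * ln 2 * (d%:R * d%:R / dpoly1 Lam)).

Lemma graph_ge n (adm : admissible Lam P n) K (d e : R) m r (delta : R) :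
  (0 < n)%N -> (0 < m < r)%N -> 0 < d -> 0 <= e -> 0 <= delta ->
  (forall x : R, -1 <= x <= 1 -> gfun x <= gpoly K x + e) ->
  (forall (T : finType) (pool : seq T) k, (r <= size pool)%N -> (k <= size P)%N ->
      step_err pool K d e m k / m%:R + e <= delta) ->
  (mC Lam P n = 0)%N \/ r%:R <= n%:R * c * \sum_(k < size P) P`_k * (0 < k)%:R ->
  n%:R * (\sum_(d < size Lam) Lam`_d * phi1 (ch :: nseq d (rmix P tl)))
   + n%:R * c * (\sum_(k < size P) P`_k * ((1 - k%:R) * lawE (pw tl k) (@gfun R)))
   - samp_const - n%:R * c * delta - (m + r * size P)%:R * ln 2 <=
  avgP (fun pi => EE (chan n ch ++ checks R (vnode dLam adm) (cnode P1gt0 adm) pi) (@u0 R n) PhiF).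
Proof.
move=> n0 /andP[m0 mr] d0 e0 D0 ap se hr.
set var := vnode dLam adm; set chk := cnode P1gt0 adm.
have nR : 0 < n%:R :> R by rewrite ltr0n.
have ncE : nchecksR Lam P n = n%:R * c by rewrite /nchecksR mulrA.
pose posC := [seq a : 'I_(mC Lam P n) <- enum 'I_(mC Lam P n) | (0 < kdeg chk a)%N].
pose zerC := [seq a : 'I_(mC Lam P n) <- enum 'I_(mC Lam P n) | ~~ (0 < kdeg chk a)%N].
(* Only checks of positive degree are dropped, so that [r] of them free between [r] and [r * size P]
   sockets. *)
pose dr := take r posC; pose kept := drop r posC ++ zerC.
have enumC : perm_eq (kept ++ dr) (enum 'I_(mC Lam P n)).
  rewrite perm_catC catA cat_take_drop; apply/permPl; exact: perm_filterC.
have posE : (size posC)%:R = n%:R * c * \sum_(k < size P) P`_k * (0 < k)%:R.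
  rewrite -ncE -(sum_checks P1gt0 adm (fun k => (0 < k)%:R)) /posC -sum1_size big_filter big_enum_cond.
  by rewrite natr_sum [LHS]big_mkcond; apply: eq_bigr => a _; case: (0 < _)%N.
have dr0 a : a \in dr -> (0 < kdeg chk a)%N.
  by move=> /mem_take; rewrite mem_filter => /andP[].
have szdr : (size dr <= r)%N by rewrite size_take_min geq_minl.
have poolE : size (dpool chk dr) = (\sum_(a <- dr) kdeg chk a)%N.
  have ud : uniq dr by apply: take_uniq; rewrite filter_uniq// enum_uniq.
  rewrite /dpool -sum1_size big_filter big_enum_cond.
  rewrite (partition_big chk (mem dr))//= big_uniq//; apply: eq_bigr => a ad.
  rewrite /kdeg /blk -sum1_size big_filter big_enum_cond; apply: eq_bigl => b.
  by case: eqP => [->|]; rewrite ?andbF// ad.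
have poolU : (size (dpool chk dr) <= r * size P)%N.
  rewrite poolE; apply: (@leq_trans (\sum_(a <- dr) size P)).
    by apply: leq_sum => a _; apply: ltnW; exact: kdeg_lt.
  by rewrite big_const_seq count_predT iter_addn_0 mulnC leq_mul2r szdr orbT.
have poolL : kept = [::] \/ (r <= size (dpool chk dr))%N.
  case: hr => [mC0|rle].
    left; have : (size (kept ++ dr) = 0)%N by rewrite (perm_size enumC) size_enum_ord.
    by rewrite size_cat => /eqP; rewrite addn_eq0 => /andP[/eqP/size0nil].
  right; rewrite poolE; rewrite -posE ler_nat in rle.
  apply: (@leq_trans (\sum_(a <- dr) 1)).
    by rewrite sum1_size size_take_min (minn_idPl rle).
  by rewrite big_seq [leqRHS]big_seq; apply: leq_sum => a /dr0.
have keptE : \sum_(a <- kept) (step_err (dpool chk dr) K d e m (kdeg chk a) / m%:R + e) <= n%:R * c * delta.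
  case: poolL => [->|rS]; first by rewrite big_nil !mulr_ge0 ?(ltW nR) ?invr_ge0 ?(ltW P1gt0)// ge0_dpoly1.
  apply: (@le_trans _ _ (\sum_(a <- kept) delta)).
    by apply: ler_sum => a _; apply: se => //; apply: ltnW; exact: kdeg_lt.
  rewrite big_const_seq count_predT iter_addr_0 -[leLHS]mulr_natl ler_wpM2r//.
  rewrite -ncE -(mC_E dP adm) ler_nat.
  have sz := perm_size enumC; rewrite size_cat size_enum_ord in sz.
  have : (size kept <= size kept + size dr)%N by exact: leq_addr.
  by rewrite sz.
have poolL' : kept = [::] \/ (m < size (dpool chk dr))%N.
  by case: poolL => [?|rS]; [left|right; exact: leq_trans rS].
have := drop_bound var tl_law ch_law enumC m0 poolL' dr0 d0 e0 ap.
have := soft_bound var chk tl_law ch_law.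
rewrite sumrB (sum_vars dLam adm (fun q => phi1 (ch :: nseq q (mix chk tl)))).
rewrite (sum_vars dLam adm (fun q => samp_err R 'I_(nedges Lam n) q)).
under eq_bigr do rewrite mixed_phi1//.
have -> : n%:R * (\sum_(d0 < size Lam) Lam`_d0 * samp_err R 'I_(nedges Lam n) d0) = samp_const.
  rewrite big_distrr; apply: eq_bigr => q _ /=.
  by rewrite /samp_err card_ord (nedges_E adm) invfM; set z := (dpoly1 Lam)^-1; field; rewrite gt_eqF.
move=> sb db.
move: db; rewrite big_enum /= (sum_checks P1gt0 adm (fun k => (1 - k%:R) * gq tl k)) ncE => db.
have ln20 : 0 <= ln 2 :> R by rewrite ln_ge0// ler1n.
have q1 : (size (dpool chk dr))%:R * ln 2 <= (r * size P)%:R * ln 2 :> R.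
  by rewrite ler_wpM2r// ler_nat.
rewrite natrD mulrDl; rewrite /gq in db; lra.
Qed.

End Asymptotics.

Section Channel_bound.
Variables (R : realType) (Lam P : seq R).
Hypothesis dLam : deg_dist Lam.
Hypothesis dP : deg_dist P.
Hypothesis P1gt0 : 0 < dpoly1 P.
Context (disp : measure_display) (Y : measurableType disp) (mu : {measure set Y -> \bar R})
  (p : bool -> Y -> R).
Hypothesis bms : bms_channel mu p.
Local Notation c := (dpoly1 Lam / dpoly1 P).

Lemma positive_checks_gt0 : 0 < \sum_(k < size P) P`_k * (0 < k)%:R.
Proof.
rewrite lt_neqAle eq_sym; apply/andP; split; last first.
  by apply: sumr_ge0 => k _; rewrite mulr_ge0// dP.1.
apply/eqP => q0; suff : dpoly1 P <= (size P)%:R * 0 by rewrite mulr0 leNgt P1gt0.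
rewrite -q0 big_distrr; apply: ler_sum => k _ /=.
case: (posnP k) => [->|k0]; first by rewrite mul0r !mulr0.
by rewrite mulr1 ler_wpM2r ?dP.1// ler_nat ltnW.
Qed.

Lemma entropy_asym N tl (eps : R) : (0 < N)%N -> is_law tl -> 0 < eps ->
  exists n0, forall n, (n0 <= n)%N -> admissible Lam P n ->
    ((Efin Lam P (chlaw mu p N) tl - eps)%:E <= ens_avg_h mu p Lam P n)%E.
Proof.
move=> N0 tl_law e0; have c0 : 0 <= c by rewrite divr_ge0 ?ge0_dpoly1.
have ch_law := is_law_chlaw bms N0; set ch := chlaw mu p N in ch_law *.
pose delta := eps / (2 * (c + 1)).
have c1 : 0 < c + 1 by rewrite ltr_wpDl.
have D0 : 0 < delta by rewrite divr_gt0// mulr_gt0.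
have [K [d [e [m [r [mr d0 ee0 ap se]]]]]] := step_params (size P) D0.
have E2 : 0 < eps / 2 by rewrite divr_gt0.
have [n1 [n10 h1]] := div_small (samp_const Lam + (m + r * size P)%:R * ln 2) E2.
have q0 := positive_checks_gt0; set q := \sum_(k < _) _ in q0.
have [n2 [_ h2]] := @div_small R (r%:R / (c * q)) 1 ltr01.
exists (maxn n1 n2) => n; rewrite geq_max => /andP[nn1 nn2] adm.
have n0 : (0 < n)%N by exact: leq_trans nn1.
have nR : 0 < n%:R :> R by rewrite ltr0n.
(* If c = 0 there are no checks at all; otherwise the checks of positive degree number
   [n%:R * c * q], which eventually exceeds [r]. *)
have hr : (mC Lam P n = 0)%N \/ r%:R <= n%:R * c * q.
  have [cz|cnz] := eqVneq c 0.
    left; apply/eqP; rewrite -(eqr_nat R) (mC_E dP adm) /nchecksR -mulrA cz mulr0//.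
  right; have cq : 0 < c * q by rewrite mulr_gt0// lt_neqAle eq_sym cnz.
  have := h2 _ nn2; rewrite ler_pdivrMr// mul1r ler_pdivrMr//.
  by rewrite -(mulrA n%:R c q).
have := graph_ge dLam dP P1gt0 tl_law ch_law adm n0 mr d0 ee0 (ltW D0) ap se hr.
have := @avg_entropy_ge R Lam P n dLam P1gt0 adm disp Y mu p bms N N0 n0.
rewrite -/ch (mC_E dP adm) => ent gr; apply: le_trans ent; rewrite lee_fin.
have ln20 : 0 <= ln 2 :> R by rewrite ln_ge0// ler1n.
have iR : 0 <= n%:R^-1 :> R by rewrite invr_ge0.
have {}gr := ler_wpM2l iR gr.
set A := avgP _ in gr *; set S1 := \sum_(_ < size Lam) _ in gr; set S2 := \sum_(_ < size P) _ in gr.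
have E1 : Efin Lam P ch tl = ln 2 - lawE ch (@gfun R) + S1 + c * S2 - c * ln 2.
  rewrite /Efin -/S2; congr (_ + _ - _).
  rewrite /S1 -[ln 2 - _ in RHS]mul1r -dLam.2 mulr_suml -big_split.
  by apply: eq_bigr => k _ /=; ring.
have E3 : n%:R^-1 * (n%:R * S1 + n%:R * c * S2 - samp_const Lam - n%:R * c * delta - (m + r * size P)%:R * ln 2)
   = S1 + c * S2 - c * delta - (samp_const Lam + (m + r * size P)%:R * ln 2) / n%:R.
  by field; rewrite !gt_eqF.
rewrite E3 in gr; have := h1 _ nn1.
have E4 : n%:R^-1 * nchecksR Lam P n = c by rewrite /nchecksR; field; rewrite !gt_eqF.
rewrite E4 E1.
have : c * delta <= eps / 2.
  have -> : c * delta = c / (c + 1) * (eps / 2).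
    by rewrite /delta; move: c1; move: c => z z1; field; rewrite gt_eqF.
  by apply: ler_piMl; [exact: ltW|rewrite ler_pdivrMr// mul1r lerDl].
lra.
Qed.

Lemma limn_einf_ge (u : nat -> \bar R) (x : \bar R) n0 :
  (forall n, (n0 <= n)%N -> (x <= u n)%E) -> (x <= limn_einf u)%E.
Proof.
move=> h; rewrite limn_einf_lim; apply: lime_ge; first exact: is_cvg_einfs.
exists n0 => // n /= nn; apply: le_ereal_inf_tmp => _ [k /= kn <-].
by apply: h; exact: leq_trans kn.
Qed.

Theorem hRS_sup_le_liminf : (hRS_sup mu p Lam P <= liminf_h mu p Lam P)%E.
Proof.
apply: ge_ereal_sup => _ [dV sym <-]; apply/lee_addgt0Pr => eps e0.
have e2 : 0 < eps / 2 by rewrite divr_gt0.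
have [N [N0 hN]] := hRS_le bms sym dLam dP P1gt0 e2.
apply: le_trans hN _.
have [n0 h] := entropy_asym N0 (is_law_tlaw dV N0) e2.
have l : ((Efin Lam P (chlaw mu p N) (tlaw dV N) - eps / 2)%:E <= liminf_h mu p Lam P)%E.
  apply: (limn_einf_ge (n0 := n0)) => n nn; case: asboolP => [adm|_]; last by rewrite leey.
  exact: h.
have -> : Efin Lam P (chlaw mu p N) (tlaw dV N) + eps / 2 =
    Efin Lam P (chlaw mu p N) (tlaw dV N) - eps / 2 + eps by lra.
by rewrite EFinD leeD2r.
Qed.

End Channel_bound.

(** * The erasure and Gaussian channels are memoryless and symmetric *)

Section Example_channels.
Variable R : realType.

Definition swap01 (y : nat) : nat := if y == 0%N then 1%N else if y == 1%N then 0%N else y.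

Lemma bec_bms (eps : R) : 0 <= eps <= 1 -> bms_channel (@counting nat R) (bec_p eps).
Proof.
move=> /andP[e0 e1]; have p0 x y : 0 <= bec_p eps x y.
  by rewrite /bec_p; case: ifP => // _; case: ifP => // _; rewrite subr_ge0.
split => //.
- move=> x; rewrite ge0_integral_count; last by move=> k; rewrite lee_fin.
  rewrite (@nneseries_split _ _ 0%N 3%N); last by move=> k _; rewrite lee_fin.
  rewrite eseries0 ?adde0.
    rewrite add0n big_mkord !big_ord_recr big_ord0 /= /bec_p /=.
    by case: x => /=; rewrite -!EFinD; congr EFin; lra.
  by move=> [|[|[|k]]] //= _ _; rewrite /bec_p; case: x.
- exists swap01; split => //.
  + by case=> [|[|]].
  + move=> A _; transitivity (\sum_(n <oo) \d_ n (swap01 @^-1` A) : \bar R)%E.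
      exact: counting_dirac.
    transitivity (\sum_(n <oo) \d_ n A : \bar R)%E; last by apply/esym; exact: counting_dirac.
    (* The involution exchanges the outputs 0 and 1 and fixes all others, so only the first two
       terms of the counting sum are permuted. *)
    rewrite (@nneseries_split _ _ 0%N 2%N)// [RHS](@nneseries_split _ _ 0%N 2%N)//.
    congr (_ + _)%E; first by rewrite add0n !big_mkord !big_ord_recr !big_ord0 /= !add0e addeC.
    by apply/congr_lim/funext => m; apply: eq_big_nat => -[|[|k]].
  + by case=> [|[|[|y]]].
Qed.

Lemma biawgn_bms (eps : R) : 0 < eps -> bms_channel (@lebesgue_measure R) (biawgn_p eps).
Proof.
move=> e0; split.
- by move=> x y; exact: normal_pdf_ge0.
- by move=> x; exact: measurable_normal_pdf.
- by move=> x; exact: integral_normal_pdf.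
have s0 : Num.sqrt 2 * eps != 0 by rewrite mulf_neq0 ?gt_eqF// sqrtr_gt0.
have fE (s y : R) : normal_fun (1 - 2 * (true : nat)%:R) s y = normal_fun (1 - 2 * (false : nat)%:R) s (- y).
  rewrite /normal_fun.
  have -> : y - (1 - 2 * (true : nat)%:R) = y + 1 by rewrite /=; ring.
  have -> : - y - (1 - 2 * (false : nat)%:R) = - (y + 1) by rewrite /=; ring.
  by rewrite sqrrN.
exists (fun y : R => - y); split => //.
- exact: oppr_measurable.
- by move=> y; exact: opprK.
- by move=> A mA; exact: lebesgue_measureN.
- by move=> y; rewrite /biawgn_p /normal_pdf (negbTE s0); congr (_ * _); exact: fE.
Qed.

End Example_channels.

Unset Implicit Arguments. Set Strict Implicit. Set Printing Implicit Defensive.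

Theorem theorem1 (R : realType) (Lam P : seq R) :
  deg_dist Lam -> deg_dist P -> 0 < dpoly1 P ->
  [/\
   (* (i) BEC(eps) *)
   forall eps : R, 0 <= eps <= 1 ->
     (hRS_sup (@counting nat R) (bec_p eps) Lam P
        <= liminf_h (@counting nat R) (bec_p eps) Lam P)%E,
   (* (ii) BIAWGNC(eps) *)
   forall eps : R, 0 < eps ->
     (hRS_sup (@lebesgue_measure R) (biawgn_p eps) Lam P
        <= liminf_h (@lebesgue_measure R) (biawgn_p eps) Lam P)%E &
   (* (iii) a BMS(eps) family on an open interval where condition H holds *)
   forall (d : measure_display) (Y : measurableType d)
          (mu : {measure set Y -> \bar R}) (pf : R -> bool -> Y -> R) (a b : R),
     a < b ->
     (forall eps, a < eps < b -> bms_channel mu (pf eps)) ->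
     smooth_family mu pf a b ->
     (forall eps, a < eps < b -> condH mu pf eps) ->
     forall eps : R, a < eps < b ->
       (hRS_sup mu (pf eps) Lam P <= liminf_h mu (pf eps) Lam P)%E].
Proof.
move=> dLam dP P1gt0; split.
- by move=> eps e01; apply: hRS_sup_le_liminf => //; exact: bec_bms.
- by move=> eps e0; apply: hRS_sup_le_liminf => //; exact: biawgn_bms.
- by move=> d Y mu pf a b _ bms _ _ eps eab; apply: hRS_sup_le_liminf => //; exact: bms.
Qed.
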